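(* Let $1\le p<\infty$, $p\neq 2$. Let $\psi\in\mathbb{A}$ and $S\in\mathbb{I}_1(H^p)$. Then $S\approx M_\psi$ if and only if $S=M_{\widetilde\psi}$ for some $\widetilde\psi\in\mathbb{A}$.
   Context: $D$ is the open unit disc in $\mathbb{C}$, $H^p$ the Hardy space of $D$ with its usual norm. $\mathbb{A}$ is the group (under composition) of holomorphic automorphisms of $D$, i.e. the maps $\phi(z)=\frac{\lambda(z-a)}{1-\overline{a}z}$ with $a\in D$, $|\lambda|=1$. For $F\in H^\infty$, $M_F$ is multiplication by $F$ on $H^p$; $C_\phi f=f\circ\phi$. For $\phi(z)=\frac{\lambda(z-a)}{1-\overline{a}z}$ in $\mathbb{A}$ put $U_\phi=M_{(\overline{\lambda}\phi')^{1/p}}C_\phi$, where $\overline\lambda\phi'(z)=\frac{1-|a|^2}{(1-\overline a z)^2}$ and the $p$-th root is the principal branch $(re^{i\theta})^{1/p}=r^{1/p}e^{i\theta/p}$, $r>0$, $-\pi<\theta<\pi$. $\mathbb{I}_1(H^p)=\{M_\psi U_\phi:\phi,\psi\in\mathbb{A}\}$, which is the set of linear isometries of $H^p$ into $H^p$ whose range has codimension one. For bounded linear operators $A,B$ on $H^p$, $A\approx B$ (isometrically equivalent) means $B=UAU^{-1}$ for some linear isometry $U$ of $H^p$ onto $H^p$. *)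

(* Defs.v *)
From HB Require Import structures.
From mathcomp Require Import all_boot all_order all_algebra.
From mathcomp Require Import all_classical all_reals all_analysis.
From mathcomp Require Import measurable_realfun.
From mathcomp Require Import complex ring.

Set Implicit Arguments.
Unset Strict Implicit.
Unset Printing Implicit Defensive.

Import Order.TTheory GRing.Theory Num.Theory numFieldNormedType.Exports.
Local Open Scope ring_scope.
Local Open Scope classical_set_scope.

(* R[i] as a normed space over itself, so that [derivable f z 1] and [derive1]
   on functions R[i] -> R[i] are complex differentiability and f'. *)
HB.instance Definition _ (R : realType) := NormedModule.copy R[i] R[i]^o.

Section defs.
Context {R : realType}.
Local Notation C := R[i].
Implicit Types (f g : C -> C) (z w : C) (r t p : R).

(* The MathComp norm of R[i] is R[i]-valued; [cmod] is the same modulus in R. *)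
Definition cmod z : R := complex.Re `|z|.

Definition cis t : C := (cos t +i* sin t)%C.

Definition unit_disc : set C := [set z | `|z| < 1].

Definition holomorphic_on (D : set C) f := forall z, D z -> derivable f z 1.

Definition circle_mean p f r : \bar R :=
  (((2 * pi)^-1)%:E *
   \int[lebesgue_measure]_(t in `[0%R, (2 * pi)%R])
     (cmod (f (r%:C%C * cis t)) `^ p)%:E)%E.

(* ||f||_p = sup_(0 <= r < 1) (1/(2 pi) \int_0^(2 pi) |f(r e^(it))|^p dt)^(1/p) *)
Definition hardy_norm p f : \bar R :=
  poweR (ereal_sup [set circle_mean p f r | r in `[0, 1[]) p^-1.

(* A function on the disc is represented by its extension by 0 to R[i], so that
   Leibniz equality of elements of H^p is equality on the disc. *)
Definition hardy_pred p : {pred C -> C} :=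
  mem [set f | [/\ holomorphic_on unit_disc f, (hardy_norm p f < +oo)%E
             & forall z, ~ unit_disc z -> f z = 0]].

Lemma cmodE z : `|z| = (cmod z)%:C%C.
Proof. by rewrite /cmod normc_def. Qed.

Lemma cmod_ge0 z : 0 <= cmod z.
Proof. by have := normr_ge0 z; rewrite cmodE lecR. Qed.

Lemma cmodM z w : cmod (z * w) = cmod z * cmod w.
Proof. by apply: complexI; rewrite rmorphM /= -!cmodE normrM. Qed.

Lemma ler_cmodD z w : cmod (z + w) <= cmod z + cmod w.
Proof. by rewrite -lecR rmorphD /= -!cmodE ler_normD. Qed.

Lemma cmod_cis t : cmod (cis t) = 1.
Proof. by rewrite /cmod normc_def /= cos2Dsin2 sqrtr1. Qed.

Lemma cmod_real r : 0 <= r -> cmod r%:C%C = r.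
Proof. by move=> r0; apply: complexI; rewrite -cmodE ger0_norm// lecR. Qed.

Lemma circle_disc r t : 0 <= r < 1 -> unit_disc (r%:C%C * cis t).
Proof.
move=> /andP[r0 r1].
by rewrite /unit_disc/= cmodE cmodM cmod_cis mulr1 cmod_real// ltcR.
Qed.

Lemma ler_cmod_sub z w : `|cmod z - cmod w| <= cmod (z - w).
Proof.
have H a b : cmod a - cmod b <= cmod (a - b).
  by rewrite lerBlDr (le_trans _ (ler_cmodD _ _))// subrK.
rewrite ler_norml H andbT lerNl opprB (le_trans (H _ _))//.
by rewrite -lecR -!cmodE distrC.
Qed.

Lemma continuous_real_complex : continuous (fun x : R => x%:C%C : C).
Proof.
move=> x; apply/cvgrPdist_lt => e e0.
have [er ei] : 0 < complex.Re e /\ e = (complex.Re e)%:C%C.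
  by case: e e0 => a b; rewrite ltcE /= => /andP[/eqP -> ->].
near=> y.
rewrite -rmorphB /= cmodE ei ltcR.
rewrite /cmod normc_def /= expr0n addr0 sqrtr_sqr.
by near: y; exact: cvgr_dist_lt.
Unshelve. all: by end_near. Qed.

Lemma continuous_cis_circle r : continuous (fun t => r%:C%C * cis t : C).
Proof.
move=> t.
have -> : (fun t => r%:C%C * cis t : C) =
    (fun t => r%:C%C * ((cos t)%:C%C + 'i%C * (sin t)%:C%C)).
  by apply/funext => u; rewrite /cis [X in _ * X]complexE.
apply: cvgM; first exact: cvg_cst.
apply: cvgD.
  apply: (continuous_comp (g := fun x : R => x%:C%C : C)).
    exact: continuous_cos.
  exact: continuous_real_complex.
apply: cvgM; first exact: cvg_cst.
apply: (continuous_comp (g := fun x : R => x%:C%C : C)).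
  exact: continuous_sin.
exact: continuous_real_complex.
Qed.

Lemma continuous_cmod : continuous (cmod : C -> R).
Proof.
move=> z; apply: (@cvgrPdist_lt _ R^o _ (nbhs z) _ _ _).2 => e e0.
have e0' : 0 < e%:C%C by rewrite ltcR.
apply/nbhs_ballP; exists e%:C%C => //= w; rewrite -ball_normE /= cmodE ltcR.
exact: le_lt_trans (ler_cmod_sub _ _).
Qed.

Lemma measurable_circle p f r : 0 <= p -> 0 <= r < 1 -> holomorphic_on unit_disc f ->
  measurable_fun setT (fun t => cmod (f (r%:C%C * cis t)) `^ p).
Proof.
move=> p0 r01 holf.
apply: (@measurableT_comp _ _ _ _ _ _ (fun x : R => x `^ p)) => //.
apply: continuous_measurable_fun => t.
have fc : {for r%:C%C * cis t, continuous f}.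
  apply: differentiable_continuous; apply/derivable1_diffP.
  exact: holf (circle_disc _ r01).
apply: continuous_comp; last exact: continuous_cmod.
apply: continuous_comp; last exact: fc.
exact: continuous_cis_circle.
Qed.

Lemma circle_mean_ge0 p f r : (0 <= circle_mean p f r)%E.
Proof.
apply: mule_ge0; first by rewrite lee_fin invr_ge0 mulr_ge0 ?pi_ge0.
by apply: integral_ge0 => t _; rewrite lee_fin powR_ge0.
Qed.

Lemma hardy_norm_ltyP p f : 0 < p ->
  (hardy_norm p f < +oo)%E <->
  exists M : R, forall r, 0 <= r < 1 -> (circle_mean p f r <= M%:E)%E.
Proof.
move=> p0; rewrite /hardy_norm; set s := ereal_sup _.
have s0 : (0 <= s)%E.
  apply: (le_trans (circle_mean_ge0 p f 0)).
  by apply: ereal_sup_ubound; exists 0 => //=; rewrite in_itv/= lexx ltr01.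
have le_s r : 0 <= r < 1 -> (circle_mean p f r <= s)%E.
  by move=> r01; apply: ereal_sup_ubound; exists r => //=; rewrite in_itv.
split=> [|[M leM]].
  clearbody s; case: s s0 le_s => [x|  |] // s0 le_s; first by exists x.
  by rewrite poweRyr ?invr_eq0 ?gt_eqF.
apply: poweR_lty.
apply: (@le_lt_trans _ _ M%:E); last exact: ltry.
apply: ge_ereal_sup => _ [r /= r01 <-]; apply: leM.
by move: r01; rewrite in_itv.
Qed.

Lemma ler_powR_cmodD p z w : 0 <= p ->
  cmod (z + w) `^ p <= 2 `^ p * (cmod z `^ p + cmod w `^ p).
Proof.
move=> p0; have z0 := cmod_ge0 z; have w0 := cmod_ge0 w.
apply: (@le_trans _ _ ((2 * Num.max (cmod z) (cmod w)) `^ p)).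
  apply: ge0_ler_powR => //; rewrite ?nnegrE ?cmod_ge0 ?mulr_ge0 ?le_max ?z0//.
  apply: le_trans (ler_cmodD _ _) _.
  by rewrite mulr_natl mulr2n lerD// le_max lexx ?orbT.
rewrite powRM ?le_max ?z0// ler_wpM2l ?powR_ge0//.
by case: (leP (cmod z) (cmod w)) => _; rewrite ?lerDl ?lerDr powR_ge0.
Qed.

Lemma circle_mean_lin p (a : C) f g r : 0 <= p -> 0 <= r < 1 ->
  holomorphic_on unit_disc f -> holomorphic_on unit_disc g ->
  (circle_mean p (a *: f + g)%R r <=
   (2 `^ p * cmod a `^ p)%:E * circle_mean p f r +
   (2 `^ p)%:E * circle_mean p g r)%E.
Proof.
move=> p0 r01 hf hg.
have mE h : holomorphic_on unit_disc h ->
  measurable_fun (`[0, 2 * pi] : set R)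
    (fun t => (cmod (h (r%:C%C * cis t)) `^ p)%:E).
  move=> hh; apply/measurable_EFinP.
  by apply: measurable_funS (measurable_circle p0 r01 hh).
have hfg : holomorphic_on unit_disc (a *: f + g).
  move=> z Dz; apply: derivableD (hg _ Dz).
  exact: derivableZ (hf _ Dz).
have c0 : 0 <= 2 `^ p * cmod a `^ p by rewrite mulr_ge0 ?powR_ge0.
rewrite /circle_mean !(muleCA _ (_^-1)%:E) -ge0_muleDr; last 2 first.
- rewrite mule_ge0 ?lee_fin ?powR_ge0// integral_ge0// => t _.
  by rewrite lee_fin powR_ge0.
- rewrite mule_ge0 ?lee_fin ?powR_ge0// integral_ge0// => t _.
  by rewrite lee_fin powR_ge0.
apply: lee_wpmul2l; first by rewrite lee_fin invr_ge0 mulr_ge0 ?pi_ge0.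
rewrite -!ge0_integralZl_EFin ?powR_ge0//; last 4 first.
- by move=> t _; rewrite lee_fin powR_ge0.
- exact: mE.
- by move=> t _; rewrite lee_fin powR_ge0.
- exact: mE.
have mk (c : R) h : holomorphic_on unit_disc h ->
  measurable_fun (`[0, 2 * pi] : set R)
    (fun t => c%:E * (cmod (h (r%:C%C * cis t)) `^ p)%:E)%E.
  by move=> hh; apply: measurable_funeM; exact: mE.
rewrite -ge0_integralD//; last 4 first.
- by move=> t _; rewrite mule_ge0// lee_fin powR_ge0.
- exact: mk.
- by move=> t _; rewrite mule_ge0// lee_fin powR_ge0.
- exact: mk.
apply: ge0_le_integral => //.
- by move=> t _; rewrite lee_fin powR_ge0.
- exact: mE.
- by apply: emeasurable_funD; exact: mk.
move=> t _; rewrite -!EFinM -EFinD lee_fin.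
apply: le_trans (ler_powR_cmodD _ _ p0) _.
by rewrite cmodM powRM ?cmod_ge0// mulrDr mulrA.
Qed.

Lemma hardy_pred_submod p : 1 <= p -> submod_closed (hardy_pred p).
Proof.
move=> p1; have p0 : 0 < p by apply: lt_le_trans p1.
split.
  rewrite inE; split => //.
  - apply: (hardy_norm_ltyP _ p0).2; exists 0 => r _.
    rewrite /circle_mean integral0_eq ?mule0// => t _.
    by rewrite /cmod normr0/= powR0// gt_eqF.
move=> a f g; rewrite !inE => -[hf /((hardy_norm_ltyP _ p0).1) [M leM] f0].
move=> [hg /((hardy_norm_ltyP _ p0).1) [N leN] g0]; split.
- by move=> z Dz; apply: derivableD (hg _ Dz); exact: derivableZ (hf _ Dz).
- apply: (hardy_norm_ltyP _ p0).2.
  exists (2 `^ p * cmod a `^ p * M + 2 `^ p * N) => r r01.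
  apply: le_trans (circle_mean_lin a (ltW p0) r01 hf hg) _.
  rewrite EFinD !EFinM leeD// lee_wpmul2l ?lee_fin ?mulr_ge0 ?powR_ge0//.
  - exact: leM.
  - exact: leN.
- by move=> z Dz; change (a * f z + g z = 0); rewrite f0// g0// mulr0 addr0.
Qed.

End defs.

Section hardy_space.
Context {R : realType} (p : R) (p1 : 1 <= p).

(* The hypothesis on p is what makes the instance below resolvable. *)
Definition hardy_mem (_ : 1 <= p) : {pred R[i] -> R[i]} := hardy_pred p.

HB.instance Definition _ := GRing.isSubmodClosed.Build R[i] (R[i] -> R[i])
  (hardy_mem p1) (hardy_pred_submod p1).

Record hardy : Type := Hardy {
  hardy_fun :> R[i] -> R[i];
  hardy_funP : hardy_fun \in hardy_mem p1 }.

HB.instance Definition _ := [isSub for hardy_fun].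
HB.instance Definition _ := [Choice of hardy by <:].
HB.instance Definition _ := [SubChoice_isSubLmodule of hardy by <:].

End hardy_space.

Section operators.
Context {R : realType}.
Local Notation C := R[i].

(* Here and for [disc_aut], only the values on the unit disc are meaningful. *)
Record hinf : Type := Hinf {
  hinf_fun :> C -> C;
  hinf_holo : holomorphic_on unit_disc hinf_fun;
  hinf_bounded : exists M : R, forall z, unit_disc z -> cmod (hinf_fun z) <= M }.

Lemma mulop_subproof (p : R) (p1 : 1 <= p) (F : hinf) (f : hardy p1) :
  (fun z => F z * f z) \in hardy_mem p1.
Proof.
case: f => f /=; rewrite /hardy_mem !inE => -[hf nf f0].
have p0 : 0 < p by apply: lt_le_trans p1.
move/((hardy_norm_ltyP _ p0).1) : nf => [M leM].
have [B leB] := hinf_bounded F.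
have hFf : holomorphic_on unit_disc (fun z => F z * f z).
  by move=> z Dz; apply: derivableM; [exact: hinf_holo|exact: hf].
split => //; last by move=> z /f0 ->; rewrite mulr0.
apply: (hardy_norm_ltyP _ p0).2; exists (B `^ p * M) => r r01.
have B0 : 0 <= B.
  by apply: le_trans (leB _ (circle_disc 0 r01)); exact: cmod_ge0.
rewrite EFinM (@le_trans _ _ ((B `^ p)%:E * circle_mean p f r)%E)//; last first.
  by rewrite lee_wpmul2l ?lee_fin ?powR_ge0//; exact: leM.
rewrite /circle_mean muleCA lee_wpmul2l//.
  by rewrite lee_fin invr_ge0 mulr_ge0 ?pi_ge0.
have mE h : holomorphic_on unit_disc h ->
  measurable_fun (`[0, 2 * pi] : set R)
    (fun t => (cmod (h (r%:C%C * cis t)) `^ p)%:E).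
  move=> hh; apply/measurable_EFinP.
  by apply: measurable_funS (measurable_circle (ltW p0) r01 hh).
rewrite -ge0_integralZl_EFin ?powR_ge0//; last 2 first.
- by move=> t _; rewrite lee_fin powR_ge0.
- exact: mE.
apply: ge0_le_integral => //.
- by move=> t _; rewrite lee_fin powR_ge0.
- exact: (mE (fun z => F z * f z)).
- by apply: measurable_funeM; exact: mE.
move=> t _; rewrite -EFinM lee_fin -powRM ?cmod_ge0// cmodM.
apply: ge0_ler_powR; rewrite ?nnegrE ?mulr_ge0 ?cmod_ge0 ?(ltW p0)//.
by rewrite ler_wpM2r ?cmod_ge0// leB//; exact: circle_disc.
Qed.

Definition mulop (p : R) (p1 : 1 <= p) (F : hinf) (f : hardy p1) : hardy p1 :=
  Hardy (mulop_subproof F f).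

(* The automorphism z |-> aut_scal * (z - aut_root) / (1 - conj aut_root * z);
   both parameters are determined by the map. *)
Record disc_aut : Type := DiscAut {
  aut_scal : C;
  aut_root : C;
  aut_scalP : `|aut_scal| = 1;
  aut_rootP : unit_disc aut_root }.

Definition aut_fun (phi : disc_aut) (z : C) : C :=
  aut_scal phi * (z - aut_root phi) / (1 - (aut_root phi)^*%C * z).

Coercion aut_fun : disc_aut >-> Funclass.

Lemma aut_den_neq0 (phi : disc_aut) z :
  unit_disc z -> 1 - (aut_root phi)^*%C * z != 0.
Proof.
move=> Dz; rewrite subr_eq0; apply/eqP => /(congr1 Num.norm); apply/eqP.
rewrite normr1 normrM normcJ gt_eqF// -[1]mulr1.
by rewrite ltr_pM ?normr_ge0//; exact: aut_rootP.
Qed.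

Lemma aut_disc (phi : disc_aut) z : unit_disc z -> unit_disc (phi z).
Proof.
move=> Dz; rewrite /unit_disc/= /aut_fun normrM normfV normrM aut_scalP mul1r.
have d0 := aut_den_neq0 phi Dz; move: d0; have := aut_rootP phi.
move: (aut_root phi) => a Da d0.
rewrite ltr_pdivrMr ?normr_gt0// mul1r -(@ltr_pXn2r _ 2)// ?nnegrE//.
rewrite !sqr_normc -subr_gt0.
have -> : (1 - a^*%C * z) * ((1 - a^*%C * z)^*)%C - (z - a) * ((z - a)^*)%C =
  (1 - a * a^*%C) * (1 - z * z^*%C).
  by rewrite !rmorphB rmorphM rmorph1 /= conjcK; ring.
by rewrite -!sqr_normc mulr_gt0// subr_gt0 expr_lt1.
Qed.

Lemma is_derive_aut (phi : disc_aut) z : unit_disc z ->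
  is_derive z 1 (phi : C -> C)
    (aut_scal phi * (1 - `|aut_root phi| ^+ 2) /
     (1 - (aut_root phi)^*%C * z) ^+ 2).
Proof.
move=> Dz; have d0 := aut_den_neq0 phi Dz.
rewrite /aut_fun sqr_normc; move: (aut_scal phi) (aut_root phi) d0 => l a d0.
have df : is_derive z 1 (fun w : C => l * (w - a)) l.
  have -> : (fun w : C => l * (w - a)) = l *: (id - cst a) by [].
  by apply: is_derive_eq; rewrite subr0 scaler1.
have dg : is_derive z 1 (fun w : C => 1 - a^*%C * w) (- a^*%C).
  have -> : (fun w : C => 1 - a^*%C * w) = cst 1 - a^*%C *: id by [].
  by apply: is_derive_eq; rewrite sub0r scaler1.
have dgV : is_derive z 1 (fun w : C => (1 - a^*%C * w)^-1)
    (a^*%C / (1 - a^*%C * z) ^+ 2).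
  apply: DeriveDef; first exact: derivableV.
  rewrite deriveV// derive_val -[LHS]/(- ((1 - a^*%C * z) ^- 2) * (- a^*%C)).
  by rewrite mulrN mulNr opprK mulrC.
have -> : (fun w : C => l * (w - a) / (1 - a^*%C * w)) =
  (fun w : C => l * (w - a)) * (fun w : C => (1 - a^*%C * w)^-1) by [].
apply: is_derive_eq; rewrite -![_ *: _]/(_ * _).
by field.
Qed.

Lemma aut_holomorphic (phi : disc_aut) : holomorphic_on unit_disc phi.
Proof. by move=> z Dz; have [] := is_derive_aut phi Dz. Qed.

Lemma aut_bounded (phi : disc_aut) :
  exists M : R, forall z, unit_disc z -> cmod (phi z) <= M.
Proof.
exists 1 => z /(aut_disc phi); rewrite /unit_disc/= cmodE => /ltW.
by rewrite -[1 in X in X -> _](rmorph1 (real_complex R)) lecR.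
Qed.

Definition aut_hinf (phi : disc_aut) : hinf :=
  Hinf (@aut_holomorphic phi) (aut_bounded phi).

(* Principal argument, in ]-pi, pi] for z != 0 (see [cargP]). *)
Definition carg (z : C) : R :=
  let x := acos (complex.Re z / cmod z) in
  if complex.Im z < 0 then - x else x.

Definition croot (p : R) (z : C) : C :=
  (cmod z `^ p^-1)%:C%C * cis (carg z / p).

Lemma cargP (z : C) : z != 0 ->
  - pi < carg z <= pi /\ z = (cmod z)%:C%C * cis (carg z).
Proof.
move=> z0.
have c0 : 0 < cmod z by rewrite -ltcR -cmodE normr_gt0.
have c1 : cmod z != 0 by rewrite gt_eqF.
have e2 : complex.Re z ^+ 2 + complex.Im z ^+ 2 = cmod z ^+ 2.
  by rewrite /cmod normc_def /= sqr_sqrtr// addr_ge0 ?sqr_ge0.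
have xb : -1 <= complex.Re z / cmod z <= 1.
  rewrite -ler_norml normrM normfV (gtr0_norm c0) ler_pdivrMr// mul1r.
  rewrite -(@ler_pXn2r _ 2)// ?nnegrE ?(ltW c0)// real_normK ?num_real// -e2.
  by rewrite lerDl sqr_ge0.
have s2 : cmod z * Num.sqrt (1 - (complex.Re z / cmod z) ^+ 2) = `|complex.Im z|.
  rewrite -{1}(gtr0_norm c0) -sqrtr_sqr -sqrtrM ?sqr_ge0// -sqrtr_sqr.
  congr Num.sqrt; rewrite -[RHS](addKr (complex.Re z ^+ 2)) e2.
  by field; rewrite gt_eqF.
have zE t : cos t = complex.Re z / cmod z -> sin t = complex.Im z / cmod z ->
    z = (cmod z)%:C%C * cis t.
  move=> ct st; apply/eqP; rewrite eq_complex /= ct st !mul0r subr0 addr0.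
  by rewrite !(mulrC (cmod z)) !divfK// !eqxx.
have sE : sin (acos (complex.Re z / cmod z)) = `|complex.Im z| / cmod z.
  by rewrite sin_acos// -s2 mulrAC divff// mul1r.
rewrite /carg /=; case: ifP => Im0; split.
- rewrite ltrN2 (le_trans _ (pi_ge0 R)) ?oppr_le0 ?acos_ge0// andbT acos_ltpi//.
  case/andP: xb => xb ->; rewrite andbT lt_neqAle xb andbT.
  apply/eqP => qE; move: s2; rewrite -qE sqrrN expr1n subrr sqrtr0 mulr0.
  by move/esym/eqP; rewrite normr_eq0 lt_eqF.
- by apply: zE; rewrite ?cosN ?acosK ?sinN ?sE ?in_itv// ltr0_norm// mulNr opprK.
- by rewrite acos_lepi// andbT (lt_le_trans _ (acos_ge0 xb))// oppr_lt0 pi_gt0.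
- by apply: zE; rewrite ?acosK ?sE ?in_itv// ger0_norm// leNgt Im0.
Qed.

(* U_phi f = (conj(aut_scal phi) phi')^(1/p) * (f o phi), with the principal root;
   see [aut_derive1] for the closed form of the weight. *)
Definition weighted_comp (p : R) (phi : disc_aut) (f : C -> C) (z : C) : C :=
  croot p ((aut_scal phi)^*%C * derive1 (phi : C -> C) z) * f (phi z).

Lemma aut_derive1 (phi : disc_aut) z : unit_disc z ->
  (aut_scal phi)^*%C * derive1 (phi : C -> C) z =
  (1 - `|aut_root phi| ^+ 2) / (1 - (aut_root phi)^*%C * z) ^+ 2.
Proof.
move=> Dz; rewrite derive1E.
have -> := @derive_val _ _ _ _ _ _ _ (is_derive_aut phi Dz).
rewrite -!mulrA mulrA [_^*%C * _]mulrC -sqr_normc aut_scalP expr1n mul1r.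
by [].
Qed.

(* The set of all M_psi U_phi, as operators on H^p. *)
Definition codim1_isometry (p : R) (p1 : 1 <= p) : set (hardy p1 -> hardy p1) :=
  [set S | exists psi phi : disc_aut, forall (f : hardy p1) z,
    unit_disc z -> S f z = psi z * weighted_comp p phi f z].

(* B = U A U^-1 for a linear isometry U of H^p onto itself; V is U^-1. *)
Definition isom_equiv (p : R) (p1 : 1 <= p) (A B : hardy p1 -> hardy p1) :=
  exists (U : {linear hardy p1 -> hardy p1}) (V : hardy p1 -> hardy p1),
  [/\ forall f, hardy_norm p (U f) = hardy_norm p f,
      cancel U V, cancel V U & B = U \o A \o V].

End operators.

Arguments mulop {R p} p1 F f.
Arguments codim1_isometry {R p} p1.

(* Main.v *)
From HB Require Import structures.
Require Import Defs.
From mathcomp Require Import all_boot all_order all_algebra.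
From mathcomp Require Import all_classical all_reals all_analysis.
From mathcomp Require Import complex ring lra.

(** Write [S = M_psi' U_phi] and let [U] be a surjective isometry with
    [U S = M_psi U].

    The multiplication [M_psi] is the identity as far as moduli on the circle are
    concerned, and this can be read off from norms. For [F] in the space and all complex
    [a], the norms of [F + a S F] and of [U (F + a S F) = U F + a psi (U F)] agree.
    Summing the [p]-th powers of these norms over [a = c, -c, i c, - i c] and letting
    [c] tend to 0, the second-order term is [p^2 c^2] times the integral over the circle
    of [|F|^(p-2) |S F|^2] on one side and of [|U F|^p |psi|^2 = |U F|^p] on the other
    ([second_variation], [variation_S]). So the function [y = |S F / F|] satisfies
    [int |F|^p y^2 = int |F|^p], and also [int |F|^p y^p = int |F|^p] as [S] is an
    isometry. Since [p <> 2], the strict Bernoulli inequality forces [y = 1] on the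
    circle ([eq_moments_eq1]). For [F z = 1 + b z] with [|b| < 1], where all functions are
    continuous up to the boundary, this reads
    [|phi'(z)|^(1/p) |1 + b phi(z)| = |1 + b z|] for [|z| = 1] ([boundary_ratio]). The
    choices [b = 0], [1/2] and [i/2] give [phi z = z] ([aut_identity]), so that [U_phi]
    is the identity and [S = M_psi'].

    Conversely, let [W_psi f = (psi')^(1/p) (f o psi)], with a holomorphic branch of the
    root. Then [W_psi M_z = M_psi W_psi], and [W_psi] is a surjective isometry:
    on the circle [psi] is a change of angle of speed [|psi'|] ([circle_avg_aut]), and the
    inverse automorphism, with the reciprocal weight, gives the inverse operator. As
    elements of the space need not extend to the circle, the change of angle is applied
    to the dilations [f (s z)] and [s] tends to 1 ([weighted_mean]). So every [M_psi] is
    equivalent to [M_z], and all of them to each other ([mulop_equiv]).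

    Both halves use that the norm, a supremum over radii, is a limit: the integral means
    of [|f|^p] increase with the radius ([radial_mean_le]). This follows from the
    inequality [|h 0|^p <= mean of |h|^p] for [h] complex differentiable on the
    closed disc ([mean_value_powR]), applied to rotated compositions of [f] with an
    automorphism. The mean value property itself comes from Goursat's theorem in
    logarithmic polar coordinates ([goursat], [circle_avg_Re_exp]), since holomorphy
    only means complex differentiability at each point. *)

Set Implicit Arguments.
Unset Strict Implicit.
Unset Printing Implicit Defensive.

Import Order.TTheory GRing.Theory Num.Theory numFieldNormedType.Exports.
Local Open Scope ring_scope.
Local Open Scope classical_set_scope.

(** * Averages over a period *)

Section circle_average.
Context {R : realType}.
Implicit Types (k l K : R -> R) (a b c x y t e : R).
Notation mu := (@lebesgue_measure R).

Lemma is_derive1_continuous (f : R -> R) x d :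
  is_derive x 1 f d -> {for x, continuous f}.
Proof.
by move=> [df _]; apply: differentiable_continuous; apply/derivable1_diffP.
Qed.

Lemma continuous_itv_integrable k a b : continuous k ->
  mu.-integrable `[a, b] (EFin \o k).
Proof.
move=> ck; apply: continuous_compact_integrable; first exact: segment_compact.
exact: continuous_subspaceT.
Qed.

(** The integral from a fixed base point is a primitive only to the right of that
    point. The base point [- `|x| - 1] moves with [x]; subtracting the integral up
    to 0 makes the result independent of it. *)
Lemma primitive_exists k : continuous k ->
  exists K, forall x, is_derive x 1 K (k x).
Proof.
move=> ck; pose I a x := (\int[mu]_(t in `[a, x]) k t)%R.
pose K x := I (- `|x| - 1) x - I (- `|x| - 1) 0.
have IB a a' x : a <= a' -> a' <= x -> I a x = I a a' + \int[mu]_(t in `]a', x]) k t.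
  move=> aa' a'x; rewrite /I.
  have := @Rintegral_itvB R k (BLeft a) (BRight x) a'.
  rewrite !bnd_simp => <- //; first by rewrite addrC subrK.
  exact: continuous_itv_integrable.
have KE a x : a <= - `|x| - 1 -> K x = I a x - I a 0.
  move=> ax; rewrite /K.
  have x1 : - `|x| - 1 <= x by have := ler_norm (-x); rewrite normrN; lra.
  have x2 : - `|x| - 1 <= 0 by have := normr_ge0 x; lra.
  set c := - `|x| - 1 in x1 x2 ax *.
  have Icc : I c c = 0 by rewrite /I set_itv1 Rintegral_set1.
  rewrite (IB a c x)// (IB a c 0)// (IB c c x)// (IB c c 0)// Icc.
  ring.
exists K => x; set a := - `|x| - 2.
have ax : a < x by rewrite /a; have := ler_norm (-x); rewrite normrN; lra.
have [d1 d2] : derivable (I a) x 1 /\ (I a)^`() x = k x.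
  apply: (@continuous_FTC1_closed _ k a x (x + 1)) => //.
  - by rewrite ltrDl.
  - exact: continuous_itv_integrable.
  - exact: ck.
have dI : is_derive x 1 (I a) (k x) := DeriveDef d1 (etrans (esym (derive1E _ _)) d2).
apply: (@near_eq_is_derive _ _ _ (I a - cst (I a 0))).
  near=> y; rewrite (KE a)//.
  suff : `|x - y| < 1.
    have := ler_normB y (y - x); rewrite subKr distrC; move=> h1.
    have : `|y| <= `|x| + `|x - y|.
      by rewrite -lerBlDl; apply: le_trans (lerB_dist _ _) _; rewrite distrC.
    rewrite /a; lra.
  by near: y; apply: cvgr_dist_lt.
by apply: is_derive_eq; rewrite subr0.
Unshelve. all: by end_near. Qed.

Lemma integral_primitive k K a b : a < b -> continuous k ->
  (forall x, is_derive x 1 K (k x)) ->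
  (\int[mu]_(t in `[a, b]) (k t)%:E = (K b - K a)%:E)%E.
Proof.
move=> ab ck dK; rewrite EFinB; apply: continuous_FTC2 => //.
- exact: continuous_subspaceT.
- have cK x : {for x, continuous K} by apply: is_derive1_continuous (dK x).
  split; first by move=> x _; have [] := dK x.
  + by apply: cvg_at_right_filter; exact: cK.
  + by apply: cvg_at_left_filter; exact: cK.
- by move=> x _; rewrite derive1E; apply: derive_val.
Qed.

Definition circle_avg k : R :=
  (2 * pi)^-1 * \int[mu]_(t in `[0, 2 * pi]) k t.

Let tpi0 : 0 < 2 * pi :> R. Proof. by rewrite mulr_gt0 ?pi_gt0. Qed.

Lemma circle_avg_primitive k K : continuous k ->
  (forall x, is_derive x 1 K (k x)) ->
  circle_avg k = (2 * pi)^-1 * (K (2 * pi) - K 0).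
Proof.
by move=> ck dK; rewrite /circle_avg /Rintegral (integral_primitive tpi0 ck dK).
Qed.

Lemma circle_avg_cst c : circle_avg (fun=> c) = c.
Proof.
have dK x : is_derive x 1 (fun x => c * x) c.
  have -> : (fun x => c * x) = c *: id by [].
  by apply: is_derive_eq; rewrite -[LHS]/(c * 1) mulr1.
rewrite (circle_avg_primitive _ dK); last by move=> x; exact: cvg_cst.
by rewrite mulr0 subr0 mulrC mulfK// gt_eqF.
Qed.

Lemma circle_avgD k l : continuous k -> continuous l ->
  circle_avg (fun t => k t + l t) = circle_avg k + circle_avg l.
Proof.
move=> ck cl; rewrite /circle_avg RintegralD// ?mulrDr//; exact: continuous_itv_integrable.
Qed.

Lemma circle_avgZ c k : continuous k ->
  circle_avg (fun t => c * k t) = c * circle_avg k.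
Proof.
move=> ck; rewrite /circle_avg RintegralZl// 1?mulrCA//; exact: continuous_itv_integrable.
Qed.

Lemma le_circle_avg k l : continuous k -> continuous l ->
  (forall t, 0 <= t <= 2 * pi -> k t <= l t) -> circle_avg k <= circle_avg l.
Proof.
move=> ck cl kl; rewrite /circle_avg ler_pM2l ?invr_gt0//.
apply: le_Rintegral => //; try exact: continuous_itv_integrable.
Qed.

Lemma continuous_bigsum n (k : 'I_n -> R -> R) : (forall i, continuous (k i)) ->
  continuous (fun t => \sum_(i < n) k i t).
Proof.
move=> ck x; rewrite (_ : (fun t => _) = \sum_(i < n) k i); last first.
  by apply/funext => t; rewrite fct_sumE.
by elim/big_ind: _ => [|f g cf cg|i _]; [exact: cvg_cst|exact: cvgD|exact: ck].
Qed.

Lemma circle_avg_sum n (k : 'I_n -> R -> R) : (forall i, continuous (k i)) ->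
  circle_avg (fun t => \sum_(i < n) k i t) = \sum_(i < n) circle_avg (k i).
Proof.
elim: n k => [|n IH] k ck.
  rewrite big_ord0 -[RHS](circle_avg_cst 0); congr circle_avg.
  by apply/funext => t; rewrite big_ord0.
rewrite big_ord_recl -IH; last by move=> i; exact: ck.
rewrite -circle_avgD; [|exact: ck|exact: continuous_bigsum].
by congr circle_avg; apply/funext => t; rewrite big_ord_recl.
Qed.

(** A primitive of [k] is nondecreasing and takes the same value at 0 and [2 * pi],
    hence is constant in between. *)
Lemma eq0_circle_avg k t : continuous k -> (forall x, 0 <= k x) ->
  circle_avg k = 0 -> 0 < t < 2 * pi -> k t = 0.
Proof.
move=> ck k0 avg0 /andP[t0 t1].
have [K dK] := primitive_exists ck.
move: avg0; rewrite (circle_avg_primitive ck dK) => /eqP.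
rewrite mulf_eq0 invr_eq0 gt_eqF//= subr_eq0 => /eqP K2.
have cK x : {for x, continuous K} := is_derive1_continuous (dK x).
have Kmono x y : x <= y -> K x <= K y.
  move=> xy.
  have [z _ e] := MVT_segment xy (fun x _ => dK x) (continuous_subspaceT cK).
  by rewrite -subr_ge0 e mulr_ge0 ?subr_ge0.
have Kc x : 0 <= x <= 2 * pi -> K x = K 0.
  by case/andP => x0 x1; apply/le_anti/andP; split; [rewrite -K2|]; exact: Kmono.
have dK0 : is_derive t 1 K 0.
  apply: (@near_eq_is_derive _ _ _ (cst (K 0))).
  near=> x; rewrite Kc//; apply/andP; split; apply: ltW.
    by near: x; exact: lt_nbhsr.
  by near: x; exact: lt_nbhsl.
have := @derive_val _ _ _ _ _ _ _ (dK t).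
by rewrite (@derive_val _ _ _ _ _ _ _ dK0).
Unshelve. all: by end_near. Qed.

End circle_average.

Section circle_average2.
Context {R : realType}.
Implicit Types (k l K : R -> R) (a b c x y t e : R).

Let tpi0 : 0 < 2 * pi :> R. Proof. by rewrite mulr_gt0 ?pi_gt0. Qed.

Let is_derive_addr a t : is_derive t 1 (fun t => t + a) (1 : R).
Proof.
have -> : (fun t => t + a) = id + cst a :> (R -> R) by [].
by apply: is_derive_eq; rewrite addr0.
Qed.

(** Both sides are increments of a primitive of [k], which grows by the same amount
    over all intervals of length [2 * pi] since [k] is periodic. *)
Lemma circle_avg_subst k (theta dtheta : R -> R) :
  continuous k -> (forall t, k (t + 2 * pi) = k t) ->
  continuous dtheta -> (forall t, is_derive t 1 theta (dtheta t)) ->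
  theta (2 * pi) = theta 0 + 2 * pi ->
  circle_avg (fun t => dtheta t * k (theta t)) = circle_avg k.
Proof.
move=> ck per cd dth th2.
have [K dK] := primitive_exists ck.
have ct t : {for t, continuous theta} := is_derive1_continuous (dth t).
have dKt t : is_derive t 1 (K \o theta) (dtheta t * k (theta t)).
  by rewrite mulrC; apply: is_derive1_comp.
have cc : continuous (fun t => dtheta t * k (theta t)).
  move=> t; apply: cvgM; first exact: cd.
  exact: (continuous_comp (ct t) (ck _)).
rewrite (circle_avg_primitive cc dKt) (circle_avg_primitive ck dK) /= th2.
congr (_ * _).
have dS t : is_derive t 1 (fun t => K (t + 2 * pi) - K t) 0.
  have d1 : is_derive t 1 (K \o (fun t => t + 2 * pi)) (k (t + 2 * pi) * 1).
    exact: is_derive1_comp.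
  have -> : (fun t => K (t + 2 * pi) - K t) = K \o (fun t => t + 2 * pi) - K by [].
  by apply: is_derive_eq; rewrite mulr1 per subrr.
by have := is_derive_0_is_cst (theta 0) 0 dS; rewrite add0r.
Qed.

Lemma circle_avg_shift k a : continuous k -> (forall t, k (t + 2 * pi) = k t) ->
  circle_avg (fun t => k (t + a)) = circle_avg k.
Proof.
move=> ck per.
have c1 : continuous (fun _ : R => 1 : R) by move=> t; exact: cvg_cst.
rewrite -(circle_avg_subst ck per c1 (is_derive_addr a)); last first.
  by rewrite add0r addrC.
by congr circle_avg; apply/funext => t; rewrite mul1r.
Qed.

Lemma segment_unif_continuous k a b e : continuous k -> 0 < e ->
  exists2 d : R, 0 < d & forall x y, a <= x <= b -> a <= y <= b -> `|x - y| < d ->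
    `|k x - k y| < e.
Proof.
move=> ck e0.
have /compact_near_coveringP cover := @segment_compact R a b.
have [|d d0 Hd] := cover R (0^'+) (fun d x => forall y, `|x - y| < d -> `|k x - k y| < e) _.
  move=> x _.
  have : \forall y \near x, `|k x - k y| < e / 2.
    by have /cvgrPdist_lt := ck x; apply; rewrite divr_gt0.
  case=> r /= r0 Hr; exists (ball x (r / 2), [set d | 0 < d < r / 2]) => /=.
    split; first by apply: nbhsx_ballx; rewrite divr_gt0.
    exists (r / 2) => /=; first by rewrite divr_gt0.
    by move=> d /=; rewrite sub0r normrN => ? d0; rewrite d0 /= (le_lt_trans (ler_norm _)).
  move=> [x' d] /= [xx' /andP[d0 dr]] y x'y.
  have h1 : `|k x - k x'| < e / 2.
    by apply: Hr; apply: lt_le_trans xx' _; rewrite ler_pdivrMr// ler_peMr ?ltW// ltr1n.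
  have h2 : `|k x - k y| < e / 2.
    apply: Hr; rewrite /= (splitr r) -(subrK x' x) -addrA.
    by apply: le_lt_trans (ler_normD _ _) _; apply: ltrD => //; exact: lt_trans dr.
  rewrite -(subrK (k x) (k x')) -addrA (splitr e).
  by apply: le_lt_trans (ler_normD _ _) _; apply: ltrD => //; rewrite distrC.
exists (d / 2); first by rewrite divr_gt0.
move=> x y xab yab xy; apply: (Hd (d / 2)) => //=.
- by rewrite sub0r normrN gtr0_norm ?divr_gt0// ltr_pdivrMr// ltr_pMr// ltr1n.
- by rewrite divr_gt0.
Qed.

(** The bound is uniform in the base point [x], which therefore may later depend on
    another variable of integration. *)
Lemma circle_avg_riemann k e : continuous k -> (forall t, k (t + 2 * pi) = k t) ->
  0 < e -> exists N0, forall N x, (N0 <= N)%N -> `|x| <= 2 * pi ->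
  `|N.+1%:R^-1 * (\sum_(j < N.+1) k (x + j%:R * (2 * pi / N.+1%:R))) - circle_avg k| <= e.
Proof.
move=> ck per e0.
have [d d0 Hd] := @segment_unif_continuous k (- (2 * pi)) (4 * pi) e ck e0.
exists (Num.truncn (2 * pi / d)) => N x N0N x2.
have hN : 2 * pi / d < N.+1%:R.
  have /andP[_ h] := truncn_itv (ltW (divr_gt0 tpi0 d0)).
  by apply: lt_le_trans h _; rewrite ler_nat ltnS.
set n := N.+1; set h := 2 * pi / n%:R.
have n0 : 0 < n%:R :> R by rewrite ltr0n.
have h0 : 0 < h by rewrite divr_gt0.
have hd : h < d by rewrite /h ltr_pdivrMr// [d * _]mulrC -ltr_pdivrMr.
have nh : n%:R * h = 2 * pi by rewrite /h mulrC divfK// gt_eqF.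
have [K dK] := primitive_exists ck.
have cK t : {for t, continuous K} := is_derive1_continuous (dK t).
rewrite -(circle_avg_shift x ck per).
have dKx t : is_derive t 1 (fun t => K (t + x)) (k (t + x)).
  rewrite -[k _]mulr1.
  by apply: (@is_derive1_comp _ K (fun t => t + x)).
rewrite (circle_avg_primitive _ dKx); last first.
  move=> t; apply: (@continuous_comp _ _ _ (fun t => t + x) k); last exact: ck.
  by apply: cvgD; [exact: cvg_id|exact: cvg_cst].
have -> : K (2 * pi + x) - K (0 + x) = \sum_(j < n) (K (x + j.+1%:R * h) - K (x + j%:R * h)).
  rewrite -(big_mkord xpredT (fun j => K (x + j.+1%:R * h) - K (x + j%:R * h))).
  by rewrite (telescope_sumr (fun j => K (x + j%:R * h)))// mul0r nh addr0 add0r (addrC x).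
have -> : (2 * pi)^-1 = n%:R^-1 * h^-1 :> R by rewrite -invfM nh.
rewrite -mulrA -mulrBr normrM gtr0_norm ?invr_gt0// mulr_sumr -sumrB.
rewrite mulrC ler_pdivrMr// mulr_natr -[X in _ <= _ *+ X](card_ord n) -sumr_const.
apply: le_trans (ler_norm_sum _ _ _) _; apply: ler_sum => j _.
have jj : x + j%:R * h <= x + j.+1%:R * h.
  by rewrite lerD2l ler_pM2r// ler_nat.
have [s + ->] := MVT_segment jj (fun t _ => dK t) (continuous_subspaceT cK).
rewrite in_itv/= => /andP[s1 s2].
have -> : x + j.+1%:R * h - (x + j%:R * h) = h by rewrite -natr1; ring.
rewrite [h^-1 * _]mulrC mulfK ?gt_eqF//.
have s3 : s <= x + j%:R * h + h.
  by apply: le_trans s2 _; rewrite -natr1 mulrDl mul1r addrA.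
have jn : j.+1%:R * h <= 2 * pi by rewrite -nh ler_pM2r// ler_nat ltn_ord.
have jh0 : 0 <= j%:R * h by rewrite mulr_ge0// ltW.
move/ler_normlP : x2 => [x2 x3].
apply/ltW/Hd.
- by apply/andP; split; lra.
- by apply/andP; split; lra.
- by apply: le_lt_trans hd; apply/ler_normlP; split; lra.
Qed.

End circle_average2.

(** * Inequalities for real powers *)

Section real_powers.
Context {R : realType}.
Implicit Types (q p u x y z a b d w r : R).

(** For [u = e^s], add [e^s (1 + (q - 1) s) < e^(q s)] to [q - 1] times
    [e^s (1 - s) < 1]; both are cases of [1 + x < e^x]. *)
Lemma bernoulli_powR_lt q u : 1 < q -> 0 <= u -> u != 1 ->
  1 + q * (u - 1) < u `^ q.
Proof.
move=> q1; rewrite le_eqVlt => /predU1P[<- _|u0 u1].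
  by rewrite powR0 ?gt_eqF ?(lt_trans ltr01)//; lra.
have q0 : 0 < q by exact: lt_trans q1.
have s0 : ln u != 0 by rewrite ln_eq0.
set s := ln u in s0.
rewrite -(lnK u0) -/s /powR gt_eqF ?expR_gt0// expRK.
have e1 : expR s * (1 + (q * s - s)) < expR (q * s).
  have -> : expR (q * s) = expR s * expR (q * s - s) by rewrite -expRD addrC subrK.
  rewrite ltr_pM2l ?expR_gt0// expR_gt1Dx//.
  by rewrite -{2}(mul1r s) -mulrBl mulf_neq0// subr_eq0 gt_eqF.
have e2 : expR s * (1 - s) < 1.
  rewrite -[X in _ < X](expR0 R) -[in X in _ < X](subrr s) expRD.
  by rewrite ltr_pM2l ?expR_gt0// expR_gt1Dx// oppr_eq0.
have : (q - 1) * (expR s * (1 - s)) < (q - 1) * 1 by rewrite ltr_pM2l// subr_gt0.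
lra.
Qed.

Lemma bernoulli_powR q u : 1 <= q -> 0 <= u -> 1 + q * (u - 1) <= u `^ q.
Proof.
rewrite le_eqVlt => /predU1P[<- u0|q1 u0]; first by rewrite powRr1// mul1r addrC subrK.
have [->|u1] := eqVneq u 1; first by rewrite powR1 subrr mulr0 addr0.
exact/ltW/bernoulli_powR_lt.
Qed.

(** For [1 < q] this is Bernoulli's inequality for the power [q] of [x ^+ 2]; for
    [q < 1], for the power [q^-1] of [x `^ (2 * q)]. *)
Lemma powR_sqr_gap q x : 0 <= x -> 0 < q -> q != 1 ->
  let g := 1 + q * (x ^+ 2 - 1) - x `^ (2 * q) in
  (1 < q -> g <= 0) /\ (q < 1 -> 0 <= g) /\ (g = 0 -> x = 1).
Proof.
move=> x0 q0 q1 g.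
have xe : x `^ (2 * q) = (x ^+ 2) `^ q.
  by rewrite powRrM -powR_mulrn.
have xe' : x ^+ 2 = (x `^ (2 * q)) `^ q^-1.
  by rewrite -powRrM mulfK ?gt_eqF// powR_mulrn.
have x2 : 0 <= x ^+ 2 by exact: sqr_ge0.
have eq1 z : 0 <= z -> z ^+ 2 = 1 -> z = 1.
  by move=> z0 /eqP; rewrite sqrf_eq1 => /orP[/eqP//|/eqP zN]; move: z0; rewrite zN; lra.
have [q1'|q1'] := ltP 1 q.
  have xne : x ^+ 2 != 1 -> g < 0.
    by move=> h; rewrite /g xe subr_lt0; exact: bernoulli_powR_lt.
  split; [|split] => //; [|by move/lt_gtF; rewrite q1'|].
    move=> _; have [h|/xne/ltW//] := eqVneq (x ^+ 2) 1.
    by rewrite /g xe h subrr mulr0 addr0 powR1 subrr.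
  by move=> g0; apply: eq1 => //; apply: contra_eq g0 => /xne h; rewrite lt_eqF.
have {}q1' : q < 1 by rewrite lt_neqAle q1.
have qi : 1 < q^-1 by rewrite invf_gt1.
have y0 : 0 <= x `^ (2 * q) by exact: powR_ge0.
set z := x `^ (2 * q) in xe xe' g y0 *.
have zne : z != 1 -> 0 < g.
  move=> h; have := bernoulli_powR_lt qi y0 h; rewrite -xe'.
  rewrite -(ltr_pM2l q0) mulrDr mulr1 mulrA divff ?gt_eqF// mul1r /g.
  lra.
split=> //; split.
- move=> _; have [h|/zne/ltW//] := eqVneq z 1.
  by rewrite /g xe' h powR1 subrr mulr0 addr0 subrr.
- move=> g0; have z1 : z = 1 by apply: contra_eq g0 => /zne h; rewrite gt_eqF.
  by apply: eq1 => //; rewrite xe' z1 powR1.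
Qed.

(** Bernoulli's inequality at [x / y]: a convex power lies above its tangents. *)
Lemma powR_tangent p x y : 1 <= p -> 0 <= x -> 0 < y ->
  y `^ p + p * y `^ (p - 1) * (x - y) <= x `^ p.
Proof.
move=> p1 x0 y0.
have u0 : 0 <= x / y by rewrite divr_ge0// ltW.
have := bernoulli_powR p1 u0.
have yp : 0 < y `^ p by rewrite powR_gt0.
have -> : x `^ p = (x / y) `^ p * y `^ p.
  by rewrite -powRM ?divfK ?gt_eqF// ltW.
move=> h; apply: le_trans (ler_wpM2r (ltW yp) h).
have -> : y `^ p = y `^ (p - 1) * y.
  rewrite -[X in _ * X]powRr1 ?ltW// -powRD ?subrK//.
  by apply/implyP => _; rewrite gt_eqF.
rewrite le_eqVlt; apply/orP; left; apply/eqP; field.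
by rewrite gt_eqF.
Qed.

Let scaleRE a b : a *: (b : R) = a * b. Proof. by []. Qed.

(** Taylor's formula with Peano's remainder: the derivative [g] of the remainder is
    [o(u)] since [g] has derivative 0 at 0, and the mean value theorem gains one
    order. *)
Lemma powR_taylor2 q (e : R) : 0 < e -> exists2 d : R, 0 < d & forall u, `|u| <= d ->
  `|(1 + u) `^ q - (1 + q * u + q * (q - 1) / 2 * u ^+ 2)| <= e * u ^+ 2.
Proof.
move=> e0.
pose f u := (1 + u) `^ q - (1 + q * u + q * (q - 1) / 2 * u ^+ 2).
pose g u := q * ((1 + u) `^ (q - 1) - (1 + (q - 1) * u)).
have dpow r u : -1 < u -> is_derive u 1 (fun u => (1 + u) `^ r) (r * (1 + u) `^ (r - 1)).
  move=> u1; rewrite -[X in is_derive _ _ _ X]mulr1.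
  apply: (@is_derive1_comp _ (fun x => x `^ r) (fun u => 1 + u)).
    by apply: is_derive1_powR; rewrite -ltrBlDl sub0r.
  have -> : (fun u => 1 + u) = cst 1 + id :> (R -> R) by [].
  by apply: is_derive_eq; rewrite add0r.
have df u : -1 < u -> is_derive u 1 f (g u).
  move=> u1; have := dpow q u u1 => d1.
  have did := is_derive_id u (1 : R).
  have d2 := is_deriveD (is_deriveD (is_derive_cst (1 : R) u 1) (is_deriveZ q did))
    (is_deriveZ (q * (q - 1) / 2) (is_deriveM did did)).
  have := is_deriveB d1 d2; rewrite !scaleRE => d3.
  have -> : f = (fun u => (1 + u) `^ q) -
      (cst 1 + q *: id + (q * (q - 1) / 2) *: (id * id)) :> (R -> R).
    by apply/funext => v; rewrite /f expr2.
  by apply: (is_derive_eq d3); rewrite /g; field.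
have dg0 : is_derive (0 : R) 1 g 0.
  have d1 := dpow (q - 1) 0 (ltrN10 _).
  have d2 := is_deriveD (is_derive_cst (1 : R) (0 : R) 1)
    (is_deriveZ (q - 1) (is_derive_id (0 : R) (1 : R))).
  have := is_deriveZ q (is_deriveB d1 d2); rewrite !scaleRE => d3.
  have -> : g = q *: ((fun u => (1 + u) `^ (q - 1)) - (cst 1 + (q - 1) *: id)) by [].
  by apply: (is_derive_eq d3); rewrite addr0 powR1; ring.
have g0 : g 0 = 0 by rewrite /g addr0 powR1 mulr0 addr0 subrr mulr0.
have f0 : f 0 = 0 by rewrite /f addr0 powR1 expr0n/= !mulr0 !addr0 subrr.
have [d d0 Hd] : exists2 d : R, 0 < d & forall u, `|u| < d -> `|g u| <= e * `|u|.
  have [dg dge] := dg0.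
  move: dg; rewrite /derivable => /cvgP; rewrite -/(derive g 0 1) dge.
  move/cvgrPdist_le => /(_ _ e0) [d /= d0 H]; exists d => // u ud.
  have [->|u0] := eqVneq u 0; first by rewrite g0 !normr0 mulr0.
  have := H u; rewrite /= sub0r normrN => /(_ ud u0).
  rewrite sub0r normrN addr0 g0 subr0 -[_ *: _]/(u^-1 * g (u * 1)) mulr1 normrM normfV.
  by rewrite mulrC ler_pdivrMr// normr_gt0.
pose d' := Num.min (d / 2) (1 / 2).
have d'0 : 0 < d' by rewrite lt_min !divr_gt0.
have d'd : d' < d.
  by rewrite gt_min ltr_pdivrMr// ltr_pMr// ltr1n.
have d'1 : d' < 1 by rewrite gt_min; apply/orP; right; lra.
exists d' => // u ud.
have dfu w : `|w| <= `|u| -> is_derive w 1 f (g w).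
  move=> wu; apply: df; have /ler_normlP[h _] := le_trans wu ud.
  lra.
have key a b : a <= b -> (forall w, a <= w <= b -> `|w| <= `|u|) ->
    `|f b - f a| <= e * `|u| * (b - a).
  move=> ab abu.
  have [||w + ->] := @MVT_segment _ f g a b ab.
  - move=> w; rewrite in_itv/= => /andP[/ltW w1 /ltW w2].
    by apply: dfu; apply: abu; rewrite w1 w2.
  - apply: continuous_in_subspaceT => w; rewrite inE/= in_itv/= => wab.
    exact: is_derive1_continuous (dfu w (abu w wab)).
  rewrite in_itv/= => /abu wu; rewrite normrM (@ger0_norm _ (b - a)) ?subr_ge0//.
  rewrite ler_wpM2r ?subr_ge0//.
  apply: le_trans (Hd w _) _.
    exact: le_lt_trans (le_trans wu ud) d'd.
  by rewrite ler_pM2l.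
rewrite -/(f u).
have [u0|u0] := leP 0 u.
  have := key 0 u u0; rewrite f0 !subr0 (ger0_norm u0) -mulrA -expr2; apply.
  by move=> w /andP[w0 wu]; rewrite ger0_norm.
have := key u 0 (ltW u0); rewrite f0 !sub0r normrN (ltr0_norm u0) -mulrA mulrNN -expr2.
apply => w /andP[w0 wu]; rewrite ler0_norm// lerN2//.
Qed.

End real_powers.

Section gap.
Context {R : realType}.
Implicit Types (q t : R) (A y : R -> R).

(** By linearity, the gap [1 + q * (y ^+ 2 - 1) - y `^ (2 * q)] has mean 0 against the
    weight [A]. Its sign is constant, so it vanishes wherever [A] does not, and
    [powR_sqr_gap] concludes. *)
Lemma eq_moments_eq1 q A y t : 0 < q -> q != 1 ->
  (forall s, 0 <= A s) -> (forall s, 0 <= y s) ->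
  continuous A -> continuous (fun t => A t * y t ^+ 2) ->
  continuous (fun t => A t * y t `^ (2 * q)) ->
  circle_avg (fun t => A t * y t ^+ 2) = circle_avg A ->
  circle_avg A = circle_avg (fun t => A t * y t `^ (2 * q)) ->
  0 < t < 2 * pi -> A t != 0 -> y t = 1.
Proof.
move=> q0 q1 A0 y0 c1 c2 c3 e2 e3 t2 At0.
pose gap s := 1 + q * (y s ^+ 2 - 1) - y s `^ (2 * q).
have cC k (a : R) : continuous k -> continuous (fun t => a * k t : R).
  by move=> ck s; apply: cvgM; [exact: cvg_cst|exact: ck].
have cD k l : continuous k -> continuous l -> continuous (fun t => k t + l t : R).
  by move=> ck cl s; apply: cvgD; [exact: ck|exact: cl].
have gapE : (fun t => A t * gap t) = (fun t => ((1 - q) * A t +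
    q * (A t * y t ^+ 2)) + (-1) * (A t * y t `^ (2 * q))).
  by apply/funext => s; rewrite /gap; ring.
have cg : continuous (fun t => A t * gap t).
  by rewrite gapE; exact: (cD _ _ (cD _ _ (cC _ _ c1) (cC _ _ c2)) (cC _ _ c3)).
have avg0 : circle_avg (fun t => A t * gap t) = 0.
  rewrite gapE (circle_avgD (cD _ _ (cC _ _ c1) (cC _ _ c2)) (cC _ _ c3)).
  rewrite (circle_avgD (cC _ _ c1) (cC _ _ c2)) !circle_avgZ// e2 -e3; ring.
have avg0N : circle_avg (fun t => -1 * (A t * gap t)) = 0.
  by rewrite circle_avgZ// avg0 mulr0.
have [_ [_ gap_eq0]] := powR_sqr_gap (y0 t) q0 q1.
have gap0 : A t * gap t = 0.
  have [q_gt1|q_le1] := ltP 1 q.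
    have h := @eq0_circle_avg R _ t (cC _ (-1) cg) _ avg0N t2.
    apply/oppr_inj; rewrite oppr0 -mulN1r h// => s.
    have [gs _] := powR_sqr_gap (y0 s) q0 q1.
    by rewrite mulN1r oppr_ge0 mulr_ge0_le0// gs.
  have q_lt1 : q < 1 by rewrite lt_neqAle q1.
  apply: (@eq0_circle_avg R _ t cg _ avg0 t2) => s.
  have [_ [gs _]] := powR_sqr_gap (y0 s) q0 q1.
  by rewrite mulr_ge0// gs.
by apply: gap_eq0; move/eqP : gap0; rewrite mulf_eq0 (negPf At0) => /eqP.
Qed.

End gap.

(** * Modulus, exponential and logarithm of complex numbers *)

Section complex_modulus.
Context {R : realType}.
Local Notation C := R[i].
Implicit Types (z w k : C) (r t x y e : R).

Lemma cmod0 : cmod (0 : C) = 0. Proof. by rewrite /cmod normr0. Qed.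
Lemma cmod1 : cmod (1 : C) = 1. Proof. by rewrite /cmod normr1. Qed.
Lemma cmodN z : cmod (- z) = cmod z. Proof. by rewrite /cmod normrN. Qed.
Lemma cmodBC z w : cmod (z - w) = cmod (w - z). Proof. by rewrite -cmodN opprB. Qed.

Lemma cmod_eq0 z : (cmod z == 0) = (z == 0).
Proof. by rewrite -[RHS]normr_eq0 cmodE -(inj_eq (@complexI R)). Qed.

Lemma cmod_gt0 z : (0 < cmod z) = (z != 0).
Proof. by rewrite lt_neqAle cmod_ge0 andbT eq_sym cmod_eq0. Qed.

Lemma cmodV z : cmod z^-1 = (cmod z)^-1.
Proof.
have [->|z0] := eqVneq z 0; first by rewrite invr0 cmod0 invr0.
have h : cmod z != 0 by rewrite cmod_eq0.
by apply: (mulfI h); rewrite -cmodM !divff// cmod1.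
Qed.

Lemma cmodX z n : cmod (z ^+ n) = cmod z ^+ n.
Proof. by elim: n => [|n IH]; rewrite ?cmod1// !exprS cmodM IH. Qed.

Lemma cmodJ z : cmod (z^*)%C = cmod z.
Proof. by rewrite /cmod normcJ. Qed.

Lemma ltr1_cmod z : (`|z| < 1) = (cmod z < 1).
Proof. by rewrite cmodE -[1 in LHS](rmorph1 (real_complex R)) ltcR. Qed.

Lemma unit_discE z : unit_disc z = (cmod z < 1) :> Prop.
Proof. by rewrite /unit_disc/= ltr1_cmod. Qed.

Lemma sqr_cmod z : cmod z ^+ 2 = complex.Re z ^+ 2 + complex.Im z ^+ 2.
Proof. by rewrite /cmod normc_def /= sqr_sqrtr// addr_ge0 ?sqr_ge0. Qed.

Lemma sqr_cmodC z : (cmod z ^+ 2)%:C%C = z * (z^*)%C.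
Proof. by rewrite rmorphXn /= -cmodE sqr_normc. Qed.

Lemma norm_Re_le_cmod z : `|complex.Re z| <= cmod z.
Proof.
rewrite -(@ler_pXn2r _ 2)// ?nnegrE ?cmod_ge0// real_normK ?num_real//.
by rewrite sqr_cmod lerDl sqr_ge0.
Qed.

Lemma norm_Im_le_cmod z : `|complex.Im z| <= cmod z.
Proof.
rewrite -(@ler_pXn2r _ 2)// ?nnegrE ?cmod_ge0// real_normK ?num_real//.
by rewrite sqr_cmod lerDr sqr_ge0.
Qed.

Lemma cmod_le_ReIm z : cmod z <= `|complex.Re z| + `|complex.Im z|.
Proof.
rewrite -(@ler_pXn2r _ 2)// ?nnegrE ?cmod_ge0// ?addr_ge0//.
rewrite sqr_cmod sqrrD !real_normK ?num_real// lerD2r lerDl.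
by rewrite mulrn_wge0// mulr_ge0.
Qed.

Lemma ReD z w : complex.Re (z + w) = complex.Re z + complex.Re w.
Proof. by case: z; case: w. Qed.
Lemma ImD z w : complex.Im (z + w) = complex.Im z + complex.Im w.
Proof. by case: z; case: w. Qed.
Lemma ReN z : complex.Re (- z) = - complex.Re z.
Proof. by case: z. Qed.
Lemma ImN z : complex.Im (- z) = - complex.Im z.
Proof. by case: z. Qed.
Lemma ReM z w : complex.Re (z * w) =
  complex.Re z * complex.Re w - complex.Im z * complex.Im w.
Proof. by case: z; case: w. Qed.
Lemma ImM z w : complex.Im (z * w) =
  complex.Re z * complex.Im w + complex.Im z * complex.Re w.
Proof. by case: z; case: w. Qed.

Lemma cisD x y : cis (x + y) = cis x * cis y :> C.
Proof. by apply/eqP; rewrite eq_complex /= cosD sinD eqxx addrC eqxx. Qed.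

Lemma cis0 : cis 0 = 1 :> C.
Proof. by rewrite /cis cos0 sin0. Qed.

Lemma cis_periodic t : cis (t + 2 * pi) = cis t :> C.
Proof. by rewrite cisD /cis mulr_natl cos2pi sin2pi mulr1. Qed.

Lemma circle_polar z : cmod z = 1 -> exists2 t, `|t| <= pi & z = cis t.
Proof.
move=> z1; have z0 : z != 0 by rewrite -cmod_gt0 z1.
have [/andP[h1 h2] e] := cargP z0; exists (carg z).
  by rewrite ler_norml h2 ltW.
by rewrite {1}e z1 mul1r.
Qed.

Lemma continuous_mulR (k l : C -> R) z : {for z, continuous k} ->
  {for z, continuous l} -> {for z, continuous (fun w => k w * l w)}.
Proof. exact: continuousM. Qed.

Lemma lipschitz_continuous (g : C -> R) :
  (forall z w, `|g z - g w| <= cmod (z - w)) -> continuous g.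
Proof.
move=> gl z; apply: (@cvgrPdist_lt _ R^o _ (nbhs z) _ _ _).2 => e e0.
have e0' : 0 < e%:C%C by rewrite ltcR.
apply/nbhs_ballP; exists e%:C%C => //= w; rewrite -ball_normE /= cmodE ltcR.
exact: le_lt_trans (gl _ _).
Qed.

Lemma continuous_Re : continuous (@complex.Re R : C -> R).
Proof.
apply: lipschitz_continuous => z w.
by rewrite -ReN -ReD; exact: norm_Re_le_cmod.
Qed.

Lemma continuous_Im : continuous (@complex.Im R : C -> R).
Proof.
apply: lipschitz_continuous => z w.
by rewrite -ImN -ImD; exact: norm_Im_le_cmod.
Qed.

Lemma continuous_complex (f g : R -> R) x :
  {for x, continuous f} -> {for x, continuous g} ->
  {for x, continuous (fun t => (f t +i* g t)%C : C)}.
Proof.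
move=> cf cg.
have -> : (fun t => (f t +i* g t)%C : C) =
    (fun t => (f t)%:C%C + 'i%C * (g t)%:C%C).
  by apply/funext => u; rewrite [LHS]complexE.
apply: cvgD; first exact: (continuous_comp cf (@continuous_real_complex R _)).
apply: cvgM; first exact: cvg_cst.
exact: (continuous_comp cg (@continuous_real_complex R _)).
Qed.

Lemma continuous_cis : continuous (fun t => cis t : C).
Proof.
by move=> t; apply: continuous_complex; [exact: continuous_cos|exact: continuous_sin].
Qed.

End complex_modulus.

Section complex_derivative.
Context {R : realType}.
Local Notation C := R[i].
Implicit Types (z w k d : C) (r t x y e : R) (f g h : C -> C).

(** The norm and the radii of the topology of [C] are themselves complex numbers; here
    they are replaced by real ones. *)
Lemma is_derive_cmodP f z d : is_derive z 1 f d <->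
  forall e, 0 < e -> exists2 r : R, 0 < r & forall k, cmod k < r ->
    cmod (f (z + k) - f z - d * k) <= e * cmod k.
Proof.
split.
  move=> [df dE] e e0; have eC : 0 < e%:C%C by rewrite ltcR.
  move: df; rewrite /derivable => /cvgP; rewrite -/(derive f z 1) dE.
  move/cvgrPdist_le => /(_ _ eC) [q /= q0 H].
  have qE : q = (complex.Re q)%:C%C.
    by case: q q0 {H} => a b; rewrite ltcE /= => /andP[/eqP -> _].
  exists (complex.Re q); first by rewrite -ltcR -qE.
  move=> k kq; have [->|k0] := eqVneq k 0.
    by rewrite addr0 subrr mulr0 subrr cmod0 mulr0.
  have := H k; rewrite /= sub0r normrN cmodE qE ltcR => /(_ kq k0).
  rewrite cmodE lecR -[_ *: _ as X in _ - X]/(k^-1 * (f (k * 1 + z) - f z)).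
  rewrite mulr1 [k + z]addrC => h.
  have -> : f (z + k) - f z - d * k = - (d - k^-1 * (f (z + k) - f z)) * k by field.
  by rewrite cmodM cmodN ler_wpM2r// cmod_ge0.
move=> H.
suff L : h^-1 *: ((f \o shift z) (h *: 1) - f z) @[h --> (0 : C)^'] --> d.
  apply: DeriveDef; first by apply/cvg_ex; exists d.
  exact: cvg_lim L.
apply/cvgrPdist_le => e e0.
have [er ei] : 0 < complex.Re e /\ e = (complex.Re e)%:C%C.
  by case: e e0 => a b; rewrite ltcE /= => /andP[/eqP -> ->].
have [r r0 Hr] := H _ er.
have r0' : 0 < r%:C%C by rewrite ltcR.
exists r%:C%C => //= k /=; rewrite sub0r normrN cmodE ltcR => kr k0.
rewrite ei cmodE lecR -[_ *: _ as X in _ - X]/(k^-1 * (f (k * 1 + z) - f z)).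
rewrite mulr1 [k + z]addrC.
have := Hr _ kr.
have -> : f (z + k) - f z - d * k = - (d - k^-1 * (f (z + k) - f z)) * k by field.
by rewrite cmodM cmodN ler_pM2r// cmod_gt0.
Qed.

Lemma is_derive_normP (f : R -> R) x (d : R) : is_derive x 1 f d ->
  forall e, 0 < e -> exists2 r : R, 0 < r & forall k : R, `|k| < r ->
    `|f (x + k) - f x - d * k| <= e * `|k|.
Proof.
move=> [df dE] e e0.
move: df; rewrite /derivable => /cvgP; rewrite -/(derive f x 1) dE.
move/cvgrPdist_le => /(_ _ e0) [q /= q0 H].
exists q => // k kq; have [->|k0] := eqVneq k 0.
  by rewrite addr0 subrr mulr0 subrr normr0 mulr0.
have := H k; rewrite /= sub0r normrN => /(_ kq k0).
rewrite -[_ *: _ as X in _ - X]/(k^-1 * (f (k * 1 + x) - f x)).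
rewrite mulr1 [k + x]addrC => h.
have -> : f (x + k) - f x - d * k = - (d - k^-1 * (f (x + k) - f x)) * k by field.
by rewrite normrM normrN ler_wpM2r.
Qed.

Lemma derivable_continuous f z : derivable f z 1 -> {for z, continuous f}.
Proof. by move=> df; apply/differentiable_continuous/derivable1_diffP. Qed.

Lemma derivable_compC f g z : derivable g z 1 -> derivable f (g z) 1 ->
  derivable (f \o g) z 1.
Proof.
move=> /derivable1_diffP dg /derivable1_diffP df; apply/derivable1_diffP.
exact: (@differentiable_comp C C C C g f z dg df).
Qed.

Definition cexp z : C := (expR (complex.Re z))%:C%C * cis (complex.Im z).

Lemma cexp0 : cexp (0 : C) = 1.
Proof. by rewrite /cexp /= expR0 cis0 mulr1. Qed.

Lemma cmod_cexp z : cmod (cexp z) = expR (complex.Re z).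
Proof. by rewrite /cexp cmodM cmod_cis mulr1 cmod_real// expR_ge0. Qed.

Lemma cexpD z w : cexp (z + w) = cexp z * cexp w.
Proof. by rewrite /cexp ReD ImD expRD cisD rmorphM /=; ring. Qed.

(** The first-order expansions of [expR], [cos] and [sin] at 0, combined in real and
    imaginary parts. *)
Lemma is_derive_cexp0 : is_derive (0 : C) 1 cexp 1.
Proof.
apply/is_derive_cmodP => e e0.
(* the errors add up to 4 units in the real and 5 in the imaginary part *)
have e8 : 0 < Num.min (e / 9) 1 by rewrite lt_min divr_gt0//=.
set q := Num.min (e / 9) 1 in e8.
have qe : 9 * q <= e by rewrite mulrC -ler_pdivlMr// ge_min lexx.
have q1 : q <= 1 by rewrite ge_min lexx orbT.
clearbody q.
have [r1 r10 H1] := is_derive_normP (is_derive_expR 0) e8.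
have [r2 r20 H2] := is_derive_normP (is_derive_cos 0) e8.
have [r3 r30 H3] := is_derive_normP (is_derive_sin 0) e8.
exists (Num.min q (Num.min r1 (Num.min r2 r3))).
  by rewrite !lt_min e8 r10 r20 r30.
move=> k; rewrite !lt_min => /and4P[kq k1 k2 k3].
set x := complex.Re k; set y := complex.Im k; set m := cmod k in kq k1 k2 k3 *.
have xm : `|x| <= m by exact: norm_Re_le_cmod.
have ym : `|y| <= m by exact: norm_Im_le_cmod.
have := H1 x (le_lt_trans xm k1); rewrite !add0r expR0 mul1r => hx.
have := H2 y (le_lt_trans ym k2); rewrite !add0r cos0 sin0 oppr0 mul0r subr0 => hc.
have := H3 y (le_lt_trans ym k3); rewrite !add0r sin0 cos0 mul1r subr0 => hs.
rewrite mul1r.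
rewrite cexp0.
apply: le_trans (cmod_le_ReIm _) _.
have eR : complex.Re (cexp k - 1 - k) =
    expR x * (cos y - 1) + (expR x - 1 - x).
  by rewrite /cexp !ReD !ReN ReM /= -/x -/y; ring.
have eI : complex.Im (cexp k - 1 - k) =
    expR x * (sin y - y) + (expR x - 1 - x) * y + x * y.
  by rewrite /cexp !ImD !ImN ImM /= -/x -/y; ring.
have m0 : 0 <= m by exact: cmod_ge0.
have qm0 : 0 <= q * m by rewrite mulr_ge0// ltW.
have hx' : `|expR x - 1 - x| <= q * m by apply: le_trans hx _; rewrite ler_pM2l.
have hc' : `|cos y - 1| <= q * m by apply: le_trans hc _; rewrite ler_pM2l.
have hs' : `|sin y - y| <= q * m by apply: le_trans hs _; rewrite ler_pM2l.
have m1 : m <= 1 by exact/ltW/(lt_le_trans kq).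
have qm1 : q * m <= 1 by apply: mulr_ile1 => //; exact: ltW.
have ex0 : 0 <= expR x by exact: expR_ge0.
have ex : expR x <= 3.
  move/ler_normlP : hx' => [_ hx'']; move/ler_normlP : xm => [_ xm'].
  clear -hx'' xm' m1 qm1; lra.
have b1 : `|expR x * (cos y - 1)| <= 3 * (q * m).
  by rewrite normrM (ger0_norm ex0) ler_pM.
have b2 : `|expR x * (sin y - y)| <= 3 * (q * m).
  by rewrite normrM (ger0_norm ex0) ler_pM.
have b3 : `|(expR x - 1 - x) * y| <= q * m.
  by rewrite normrM -[X in _ <= X]mulr1 ler_pM// (le_trans ym).
have b4 : `|x * y| <= q * m.
  rewrite normrM ler_pM//; exact: le_trans xm (ltW kq).
have c1 : `|complex.Re (cexp k - 1 - k)| <= 4 * (q * m).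
  rewrite eR; apply: le_trans (ler_normD _ _) _.
  clear -b1 hx'; lra.
have c2 : `|complex.Im (cexp k - 1 - k)| <= 5 * (q * m).
  rewrite eI; apply: le_trans (ler_normD _ _) _.
  have := ler_normD (expR x * (sin y - y)) ((expR x - 1 - x) * y).
  clear -b2 b3 b4; lra.
apply: le_trans (lerD c1 c2) _.
by rewrite -mulrDl mulrA (_ : 4 + 5 = 9) ?ler_wpM2r//; ring.
Qed.

Lemma is_derive_cexp z : is_derive z 1 cexp (cexp z).
Proof.
apply/is_derive_cmodP => e e0.
have c0 : 0 < cmod (cexp z) by rewrite cmod_cexp expR_gt0.
have [r r0 H] := (is_derive_cmodP _ _ _).1 is_derive_cexp0 _ (divr_gt0 e0 c0).
exists r => // k /H; rewrite add0r mul1r.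
rewrite cexp0.
have -> : cexp (z + k) - cexp z - cexp z * k = cexp z * (cexp k - 1 - k).
  by rewrite cexpD; ring.
by rewrite cmodM (mulrC (cmod _)) mulrAC ler_pdivlMr.
Qed.

End complex_derivative.

Section complex_logarithm.
Context {R : realType}.
Local Notation C := R[i].
Implicit Types (z w k : C) (r s t x y e c : R).

(** This is the principal logarithm on the right half-plane only, where [atan] gives
    the argument. *)
Definition clog z : C := (ln (cmod z) +i* atan (complex.Im z / complex.Re z))%C.

Lemma Re_gt0_neq0 z : 0 < complex.Re z -> z != 0.
Proof. by move=> x0; apply/eqP => z0; move: x0; rewrite z0 ltxx. Qed.

Lemma cmod_cis_atan z : 0 < complex.Re z ->
  (cmod z)%:C%C * cis (atan (complex.Im z / complex.Re z)) = z.
Proof.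
move=> x0; have c0 : 0 < cmod z by rewrite cmod_gt0 Re_gt0_neq0.
have x0' : complex.Re z != 0 by rewrite gt_eqF.
have sq : Num.sqrt (1 + (complex.Im z / complex.Re z) ^+ 2) = cmod z / complex.Re z.
  have -> : 1 + (complex.Im z / complex.Re z) ^+ 2 = (cmod z / complex.Re z) ^+ 2.
    by rewrite !exprMn sqr_cmod; field.
  by rewrite sqrtr_sqr ger0_norm// divr_ge0// ltW.
have ct : cos (atan (complex.Im z / complex.Re z)) = complex.Re z / cmod z.
  by rewrite cos_atan sq invf_div.
have st : sin (atan (complex.Im z / complex.Re z)) = complex.Im z / cmod z.
  have := atanK (complex.Im z / complex.Re z); rewrite /tan ct => h.
  have cz0 : complex.Re z / cmod z != 0 by rewrite mulf_neq0// invr_eq0 gt_eqF.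
  have -> : sin (atan (complex.Im z / complex.Re z)) =
    complex.Im z / complex.Re z * (complex.Re z / cmod z) by rewrite -[in RHS]h divfK.
  by field; rewrite x0' gt_eqF.
apply/eqP; rewrite eq_complex /= ct st !mul0r subr0 addr0.
have c0' : cmod z != 0 by rewrite gt_eqF.
by rewrite !(mulrC (cmod z)) !(divfK c0') !eqxx.
Qed.

Lemma cexp_clog z : 0 < complex.Re z -> cexp (clog z) = z.
Proof.
move=> x0; rewrite /cexp /= lnK ?cmod_cis_atan// posrE cmod_gt0.
exact: Re_gt0_neq0.
Qed.

Lemma continuous_clog z : 0 < complex.Re z -> {for z, continuous clog}.
Proof.
move=> x0; have z0 := Re_gt0_neq0 x0.
have c1 : {for z, continuous (fun w => ln (cmod w))}.
  apply: (continuous_comp (@continuous_cmod R z)); apply: continuous_ln.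
  by rewrite cmod_gt0.
have c2 : {for z, continuous (fun w => atan (complex.Im w / complex.Re w))}.
  have cq : {for z, continuous (fun w : C => complex.Im w / complex.Re w)}.
    apply: continuous_mulR; first exact: continuous_Im.
    by apply: continuousV; [rewrite gt_eqF|exact: continuous_Re].
  exact: (continuous_comp cq (@continuous_atan R _)).
have -> : clog = (fun w => (ln (cmod w))%:C%C + 'i%C * (atan (complex.Im w / complex.Re w))%:C%C).
  by apply/funext => u; rewrite [LHS]complexE.
apply: continuousD; first exact: (continuous_comp c1 (@continuous_real_complex R _)).
apply: continuousM; first exact: cst_continuous.
exact: (continuous_comp c2 (@continuous_real_complex R _)).
Qed.

Lemma near_Re_gt0 z : 0 < complex.Re z -> \forall w \near z, 0 < complex.Re w.
Proof.
move=> x0; near=> w; near: w.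
by apply: (cvgr_gt (complex.Re z)) => //; exact: continuous_Re.
Unshelve. all: by end_near. Qed.

Lemma nbhs_cmod z (P : set C) : nbhs z P ->
  exists2 r : R, 0 < r & forall k, cmod k < r -> P (z + k).
Proof.
move=> /nbhs_ballP[q /= q0 Hq].
have qE : q = (complex.Re q)%:C%C.
  by case: q q0 {Hq} => a b; rewrite ltcE /= => /andP[/eqP -> _].
exists (complex.Re q); first by rewrite -ltcR -qE.
move=> k kq; apply: Hq; rewrite -ball_normE /= opprD addrA subrr add0r normrN.
by rewrite cmodE qE ltcR.
Qed.

(** [clog] is a continuous right inverse of the exponential, whose derivative does not
    vanish. *)
Lemma is_derive_clog z : 0 < complex.Re z -> is_derive z 1 clog z^-1.
Proof.
move=> x0; have z0 := Re_gt0_neq0 x0; have c0 : 0 < cmod z by rewrite cmod_gt0.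
apply/is_derive_cmodP => e e0.
pose q := Num.min (1 / 2) (e * cmod z / 2).
have q0 : 0 < q by rewrite lt_min !divr_gt0// mulr_gt0.
have q1 : q <= 1 / 2 by rewrite ge_min lexx.
have qe : 2 * q <= e * cmod z by rewrite mulrC -ler_pdivlMr// ge_min lexx orbT.
clearbody q.
have [r r0 Hr] := (is_derive_cmodP _ _ _).1 is_derive_cexp0 _ q0.
have near1 := near_Re_gt0 x0.
have near2 : \forall w \near z, cmod (clog z - clog w) < r.
  have := continuous_clog x0 => /(@cvgrPdist_lt _ C _ (nbhs z) _ _ _).1 /(_ r%:C%C).
  rewrite ltcR => /(_ r0); apply: filterS => w /=.
  by rewrite cmodE ltcR.
have [r1 r10 H1] := nbhs_cmod (filterI near1 near2).
exists r1 => // k /H1 [Rk]; rewrite cmodBC => hr.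
set h := clog (z + k) - clog z in hr *.
have kE : k = z * (cexp h - 1).
  have : cexp (clog (z + k)) = z * cexp h.
    by rewrite -[X in _ = X * _](cexp_clog x0) -cexpD /h subrKC.
  by rewrite cexp_clog// mulrBr mulr1 => <-; rewrite addrC addKr.
have := Hr h hr; rewrite add0r mul1r.
rewrite cexp0 => hh.
have kz : z^-1 * k = cexp h - 1 by rewrite kE mulKf.
rewrite kz cmodBC.
have hk : cmod h <= 2 * (cmod k / cmod z).
  have -> : cmod k / cmod z = cmod (cexp h - 1) by rewrite kE cmodM mulrC mulKf// gt_eqF.
  have t1 : cmod h <= cmod (cexp h - 1) + cmod (cexp h - 1 - h).
    by rewrite -[X in cmod X <= _](subKr (cexp h - 1)) (le_trans (ler_cmodD _ _))// cmodN.
  have t2 : q * cmod h <= 1 / 2 * cmod h by rewrite ler_wpM2r ?cmod_ge0.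
  have := le_trans hh t2; lra.
apply: le_trans hh _.
apply: le_trans (ler_wpM2l (ltW q0) hk) _.
have -> : q * (2 * (cmod k / cmod z)) = 2 * q * (cmod k / cmod z) by ring.
have m0 : 0 <= cmod k / cmod z by rewrite divr_ge0 ?cmod_ge0.
apply: le_trans (ler_wpM2r m0 qe) _.
have -> : e * cmod z * (cmod k / cmod z) = e * cmod k by field; rewrite gt_eqF.
by [].
Qed.

(** The inverse of [z] is a positive multiple of its conjugate, and [atan] is odd. *)
Lemma clogV c z : 0 < c -> 0 < complex.Re z ->
  clog (c%:C%C / z) = (ln c)%:C%C - clog z.
Proof.
move=> c0 x0; have z0 := Re_gt0_neq0 x0; have m0 : 0 < cmod z by rewrite cmod_gt0.
have zE : z^-1 = ((cmod z ^+ 2)^-1)%:C%C * (z^*)%C.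
  apply: (mulfI z0); rewrite divff// mulrCA -sqr_cmodC -rmorphM /= mulVf//.
  by rewrite expf_neq0// gt_eqF.
have e1 : ln (cmod (c%:C%C / z)) = ln c - ln (cmod z).
  by rewrite cmodM cmodV cmod_real ?(ltW c0)// lnM ?posrE ?invr_gt0// lnV ?posrE.
have e2 : complex.Im (c%:C%C / z) / complex.Re (c%:C%C / z) = - (complex.Im z / complex.Re z).
  rewrite zE mulrA -rmorphM /=.
  have k0 : 0 < c / cmod z ^+ 2 by rewrite divr_gt0// exprn_gt0.
  case: z {x0 z0 m0 zE e1} (x0) k0 => x y /= xx0; set k := c / _ => k0.
  by rewrite !mul0r subr0 addr0; field; rewrite !gt_eqF.
apply/eqP; rewrite eq_complex /= e1 e2 atanN eqxx /=.
by rewrite sub0r.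
Qed.

End complex_logarithm.

(** * A theorem of Goursat *)

Section goursat.
Context {R : realType}.
Implicit Types (u v P Q W : R -> R -> R) (a b c d x y l k e s t A B C : R).

(** The mixed second difference. For smooth [W] it is the integral over the rectangle
    of the mixed derivative of [W]; it is additive under subdivision. *)
Definition rect_diff W x y l k : R :=
  W (x + l) (y + k) - W (x + l) y - W x (y + k) + W x y.

(** By additivity, one of the four quarters carries at least a quarter of the modulus. *)
Lemma rect_diff_quarter W x y l k : exists z : R * R,
  [/\ z.1 = x \/ z.1 = x + l / 2, z.2 = y \/ z.2 = y + k / 2 &
      `|rect_diff W x y l k| <= 4 * `|rect_diff W z.1 z.2 (l / 2) (k / 2)| ].
Proof.
have e1 : x + l / 2 + l / 2 = x + l by field.
have e2 : y + k / 2 + k / 2 = y + k by field.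
pose J x y := rect_diff W x y (l / 2) (k / 2).
have Jsum : rect_diff W x y l k =
    J x y + J (x + l / 2) y + (J x (y + k / 2) + J (x + l / 2) (y + k / 2)).
  by rewrite /J /rect_diff !e1 !e2; ring.
have tri : `|rect_diff W x y l k| <=
    `|J x y| + `|J (x + l / 2) y| + (`|J x (y + k / 2)| + `|J (x + l / 2) (y + k / 2)|).
  rewrite Jsum; apply: le_trans (ler_normD _ _) _.
  by apply: lerD; exact: ler_normD.
set T := `|rect_diff _ _ _ _ _| in tri *.
have [h1|h1] := leP T (4 * `|J x y|); first by exists (x, y); split; auto.
have [h2|h2] := leP T (4 * `|J (x + l / 2) y|).
  by exists (x + l / 2, y); split; auto.
have [h3|h3] := leP T (4 * `|J x (y + k / 2)|).
  by exists (x, y + k / 2); split; auto.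
exists (x + l / 2, y + k / 2); split; auto => /=.
rewrite -/(J _ _); lra.
Qed.

(** By the mean value theorem, the mixed differences of [P] and [Q] are [k] times a
    difference of [u] and [l] times a difference of [v]. Both have the same main term
    [A * l * k], so that only the errors of the expansions remain. *)
Lemma goursat_local P Q u v x y l k x0 y0 A B C e :
  0 <= l -> 0 <= k -> x <= x0 <= x + l -> y <= y0 <= y + k ->
  (forall s t, x <= s <= x + l -> is_derive t 1 (P s) (u s t)) ->
  (forall s t, x <= s <= x + l -> is_derive s 1 (Q^~ t) (v s t)) ->
  (forall s t, x <= s <= x + l -> y <= t <= y + k ->
    `|u s t - (u x0 y0 + A * (s - x0) + B * (t - y0))| <= e * (l + k) /\
    `|v s t - (v x0 y0 + C * (s - x0) + A * (t - y0))| <= e * (l + k)) ->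
  `|rect_diff (fun s t => P s t - Q s t) x y l k| <= 2 * e * (l + k) ^+ 2.
Proof.
move=> l0 k0 xx0 yy0 dP dQ H.
have xl : x <= x + l by rewrite lerDl.
have yk : y <= y + k by rewrite lerDl.
have dp t : is_derive t 1 (P (x + l) - P x) (u (x + l) t - u x t).
  by apply: is_deriveB; apply: dP; rewrite ?lexx ?xl.
have dq s : x <= s <= x + l ->
    is_derive s 1 (Q^~ (y + k) - Q^~ y) (v s (y + k) - v s y).
  by move=> ?; apply: is_deriveB; apply: dQ.
have [t + et] := MVT_segment yk (fun t _ => dp t)
  (continuous_subspaceT (fun t => is_derive1_continuous (dp t))).
rewrite in_itv/= => tyk.
have dq' s : s \in `]x, x + l[%R ->
    is_derive s 1 (Q^~ (y + k) - Q^~ y) (v s (y + k) - v s y).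
  by rewrite in_itv/= => /andP[? ?]; apply: dq; rewrite !ltW.
have cq : {within `[x, x + l], continuous (Q^~ (y + k) - Q^~ y)}.
  apply: continuous_in_subspaceT => s; rewrite inE/= in_itv/= => xs.
  exact: is_derive1_continuous (dq _ xs).
have [s + es] := MVT_segment xl dq' cq.
rewrite in_itv/= => sxl.
have -> : rect_diff (fun s t => P s t - Q s t) x y l k =
    ((P (x + l) - P x) (y + k) - (P (x + l) - P x) y) -
    ((Q^~ (y + k) - Q^~ y) (x + l) - (Q^~ (y + k) - Q^~ y) x).
  by rewrite /rect_diff -![(_ - _ : _ -> _) _]/(_ - _); ring.
rewrite et es (addrC x) (addrC y) !addrK (addrC l) (addrC k).
have [] := H (x + l) t; rewrite ?lexx ?xl//= => /ler_normlP[p1 p2] _.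
have [] := H x t; rewrite ?lexx ?xl//= => /ler_normlP[p3 p4] _.
have [] := H s (y + k); rewrite ?lexx ?yk//= => _ /ler_normlP[p5 p6].
have [] := H s y; rewrite ?lexx ?yk//= => _ /ler_normlP[p7 p8].
set du := u (x + l) t - u x t; set dv := v s (y + k) - v s y.
have hu : `|du - A * l| <= 2 * e * (l + k).
  by rewrite /du; apply/ler_normlP; split; lra.
have hv : `|dv - A * k| <= 2 * e * (l + k).
  by rewrite /dv; apply/ler_normlP; split; lra.
have -> : du * k - dv * l = (du - A * l) * k - (dv - A * k) * l by ring.
apply: le_trans (ler_normB _ _) _; rewrite !normrM (ger0_norm l0) (ger0_norm k0).
have -> : 2 * e * (l + k) ^+ 2 = 2 * e * (l + k) * k + 2 * e * (l + k) * l by ring.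
by apply: lerD; apply: ler_wpM2r.
Qed.

Lemma dist_itv_le x l s t : x <= s <= x + l -> x <= t <= x + l -> `|s - t| <= l.
Proof. by move=> /andP[? ?] /andP[? ?]; apply/ler_normlP; split; lra. Qed.

(** For a holomorphic [u + i v], the coefficient [A] common to both expansions is
    the Cauchy-Riemann equation [du/ds = dv/dt], assumed without any continuity of the
    derivatives. As in Goursat's proof, repeated quartering gives rectangles on which
    the mixed difference is at least [4 ^- n] times the original one; they shrink to
    a point, where [goursat_local] bounds it by a multiple of [e * 4 ^- n] for any [e]. *)
Lemma goursat P Q u v a b c d :
  a <= b -> c <= d ->
  (forall s t, a <= s <= b -> is_derive t 1 (P s) (u s t)) ->
  (forall s t, a <= s <= b -> is_derive s 1 (Q^~ t) (v s t)) ->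
  (forall x0 y0, a <= x0 <= b -> c <= y0 <= d ->
    exists A B C, forall e, 0 < e -> exists2 r, 0 < r &
    forall s t, a <= s <= b -> `|s - x0| < r -> `|t - y0| < r ->
    `|u s t - (u x0 y0 + A * (s - x0) + B * (t - y0))| <= e * (`|s - x0| + `|t - y0|) /\
    `|v s t - (v x0 y0 + C * (s - x0) + A * (t - y0))| <= e * (`|s - x0| + `|t - y0|)) ->
  rect_diff (fun s t => P s t - Q s t) a c (b - a) (d - c) = 0.
Proof.
move=> ab cd dP dQ H; set W := fun s t => _; set L := b - a; set K := d - c.
have L0 : 0 <= L by rewrite subr_ge0.
have K0 : 0 <= K by rewrite subr_ge0.
pose h n : R := 2 ^- n.
have h0 n : 0 < h n by rewrite invr_gt0 exprn_gt0.
have hS n : h n.+1 = h n / 2 by rewrite /h exprS invfM mulrC.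
have step n (z : R * R) := cid (rect_diff_quarter W z.1 z.2 (L * h n) (K * h n)).
pose z := fix z n := if n is m.+1 then projT1 (step m (z m)) else (a, c).
have zS n : [/\ (z n.+1).1 = (z n).1 \/ (z n.+1).1 = (z n).1 + L * h n / 2,
    (z n.+1).2 = (z n).2 \/ (z n.+1).2 = (z n).2 + K * h n / 2 &
    `|rect_diff W (z n).1 (z n).2 (L * h n) (K * h n)| <=
    4 * `|rect_diff W (z n.+1).1 (z n.+1).2 (L * h n / 2) (K * h n / 2)|].
  by rewrite /=; case: (step _ _).
(* the lower ends increase and the upper ends decrease: nested intervals *)
have nest (w : nat -> R) M : 0 <= M ->
    (forall n, w n.+1 = w n \/ w n.+1 = w n + M * h n / 2) ->
    exists x0, forall n, [/\ w n <= x0 <= w n + M * h n, w 0%N <= w n &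
      w n + M * h n <= w 0%N + M].
  move=> M0 wS.
  have wi m n : (m <= n)%N -> w m <= w n.
    move=> /subnK <-; elim: (n - m)%N => //= i; rewrite addSn => /le_trans -> //.
    have hh : 0 <= M * h (i + m)%N / 2 by rewrite !mulr_ge0// ?ltW.
    by case: (wS (i + m)%N) => ->//; rewrite lerDl.
  have wd m n : (m <= n)%N -> w n + M * h n <= w m + M * h m.
    move=> /subnK <-; elim: (n - m)%N => //= i; rewrite addSn; apply: le_trans.
    have hh : 0 <= M * h (i + m)%N / 2 by rewrite !mulr_ge0// ?ltW.
    rewrite hS mulrA; case: (wS (i + m)%N) => ->.
      rewrite lerD2l; lra.
    rewrite -addrA lerD2l; lra.
  have wu m n : w m <= w n + M * h n.
    have hh i : 0 <= M * h i by rewrite mulr_ge0// ltW.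
    have [mn|/ltnW nm] := leqP m n.
      by apply: le_trans (wi _ _ mn) _; rewrite lerDl.
    by apply: le_trans (wd _ _ nm); rewrite lerDl.
  exists (sup (range w)) => n.
  have wn0 : range w !=set0 by exists (w 0%N), 0%N.
  split.
  - apply/andP; split.
      apply: ub_le_sup; last by exists n.
      by exists (w 0%N + M * h 0%N) => _ [m _ <-].
    by apply: ge_sup => // _ [m _ <-].
  - exact: wi.
  - by apply: le_trans (wd 0%N n _) _ => //; rewrite /h expr0 invr1 mulr1.
have [x0 hx] := nest (fun n => (z n).1) L L0 (fun n => let: And3 p _ _ := zS n in p).
have [y0 hy] := nest (fun n => (z n).2) K K0 (fun n => let: And3 _ p _ := zS n in p).
have big n : `|rect_diff W a c L K| <=
    4 ^+ n * `|rect_diff W (z n).1 (z n).2 (L * h n) (K * h n)|.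
  elim: n => [|n IH]; first by rewrite /h expr0 invr1 !mulr1 mul1r.
  apply: le_trans IH _; rewrite exprSr -mulrA ler_wpM2l ?exprn_ge0//.
  by have [_ _] := zS n; rewrite hS !mulrA.
have small : forall e, 0 < e -> `|rect_diff W a c L K| <= 2 * e * (L + K) ^+ 2.
  move=> e e0.
  have ax0 : a <= x0 <= b.
    have [/andP[p1 p2] p3 p4] := hx 0%N; rewrite /= in p1 p2 p3 p4.
    move: p2; rewrite p1 /h expr0 invr1 mulr1 /L addrC subrK => ->.
    by [].
  have cy0 : c <= y0 <= d.
    have [/andP[p1 p2] p3 p4] := hy 0%N; rewrite /= in p1 p2 p3 p4.
    move: p2; rewrite p1 /h expr0 invr1 mulr1 /K addrC subrK => ->.
    by [].
  have [A [B [C /(_ _ e0)[r r0 Hr]]]] := H _ _ ax0 cy0.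
  have [n hn] : exists n, (L + K + 1) * h n < r.
    have LK0 : 0 < L + K + 1 by lra.
    have : h @ \oo --> (0 : R).
      have -> : h = (fun n => (2^-1) ^+ n) by apply/funext => n; rewrite /h exprVn.
      by apply: cvg_expr; rewrite ger0_norm; lra.
    move/cvgrPdist_lt => /(_ (r / (L + K + 1))); rewrite divr_gt0// => /(_ isT).
    case=> N _ /(_ N (leqnn _)); rewrite /= sub0r normrN gtr0_norm//.
    by rewrite ltr_pdivlMr// => ?; exists N; rewrite mulrC.
  set l := L * h n; set k := K * h n.
  have l0 : 0 <= l by rewrite mulr_ge0// ltW.
  have k0 : 0 <= k by rewrite mulr_ge0// ltW.
  have lkr : l + k < r.
    apply: le_lt_trans hn; have -> : (L + K + 1) * h n = l + k + h n by rewrite /l /k; ring.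
    by rewrite lerDl ltW.
  have [xn1 xn2 xn3] := hx n; have [yn1 yn2 yn3] := hy n.
  rewrite /= -/l in xn1 xn2 xn3; rewrite /= -/k in yn1 yn2 yn3.
  have xb s : (z n).1 <= s <= (z n).1 + l -> a <= s <= b.
    case/andP => xs sx; rewrite (le_trans xn2 xs); apply: le_trans sx _.
    by apply: le_trans xn3 _; rewrite /L addrC subrK.
  have := @goursat_local P Q u v (z n).1 (z n).2 l k x0 y0 A B C e l0 k0 xn1 yn1
    (fun s t h => dP s t (xb s h)) (fun s t h => dQ s t (xb s h)) _.
  move=> HJ; have {}HJ : `|rect_diff W (z n).1 (z n).2 l k| <= 2 * e * (l + k) ^+ 2.
    apply: HJ => s t sx ty.
    have b1 : `|s - x0| <= l.
      exact: dist_itv_le sx xn1.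
    have b2 : `|t - y0| <= k.
      exact: dist_itv_le ty yn1.
    have b3 : `|s - x0| < r.
      by apply: le_lt_trans b1 _; apply: le_lt_trans lkr; rewrite lerDl.
    have b4 : `|t - y0| < r.
      by apply: le_lt_trans b2 _; apply: le_lt_trans lkr; rewrite lerDr.
    have [c1 c2] := Hr s t (xb s sx) b3 b4.
    have b5 : e * (`|s - x0| + `|t - y0|) <= e * (l + k).
      by rewrite ler_pM2l//; exact: lerD.
    by split; [exact: le_trans c1 b5|exact: le_trans c2 b5].
  apply: le_trans (big n) _.
  apply: le_trans (ler_wpM2l _ HJ) _; first by rewrite exprn_ge0.
  have e4 : (4 : R) ^+ n * h n ^+ 2 = 1.
    rewrite /h -exprVn exprAC -exprMn (_ : 4 * 2^-1 ^+ 2 = 1) ?expr1n//.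
    by rewrite expr2; field.
  have -> : 2 * e * (L + K) ^+ 2 = 2 * e * (L + K) ^+ 2 * (4 ^+ n * h n ^+ 2).
    by rewrite e4 mulr1.
  by rewrite le_eqVlt; apply/orP; left; apply/eqP; rewrite /l /k; ring.
apply/eqP; rewrite -normr_le0; apply/ler_addgt0Pr => e e0.
rewrite add0r; apply: le_trans (small (e / (2 * ((L + K) ^+ 2 + 1))) _) _.
  by rewrite divr_gt0// mulr_gt0// ltr_wpDl// sqr_ge0.
have q0 : 0 < (L + K) ^+ 2 + 1 by rewrite ltr_wpDl// sqr_ge0.
have -> : 2 * (e / (2 * ((L + K) ^+ 2 + 1))) * (L + K) ^+ 2 =
   e * ((L + K) ^+ 2 / ((L + K) ^+ 2 + 1)) by field; rewrite gt_eqF.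
by rewrite ler_piMr ?(ltW e0)// ler_pdivrMr// mul1r lerDl.
Qed.

End goursat.

(** * The mean value inequality *)

Section mean_value.
Context {R : realType}.
Local Notation C := R[i].
Implicit Types (z w d : C) (p r s t x y c e : R) (f g h : C -> C).

Lemma circle_avg_near (k : R -> R) c e : continuous k ->
  (forall t, `|c - k t| <= e) -> `|c - circle_avg k| <= e.
Proof.
move=> ck kb.
have cc (b : R) : continuous (fun _ : R => b) by move=> t; exact: cvg_cst.
apply/ler_normlP; split.
  rewrite opprB lerBlDr -(circle_avg_cst (e + c)); apply: le_circle_avg => // t _.
  by have /ler_normlP[+ _] := kb t; rewrite opprB lerBlDr.
rewrite lerBlDr -lerBlDl -(circle_avg_cst (c - e)); apply: le_circle_avg => // t _.
by have /ler_normlP[_] := kb t; rewrite lerBlDr -lerBlDl.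
Qed.

Lemma derivable_MlC (a : C) h z : derivable h z 1 -> derivable (fun w => a * h w) z 1.
Proof. exact: derivableZ. Qed.

(** Write [h (e^(s + i t)) = u + i v], and let [P] be a primitive of [u] in [t] and [Q]
    one of [v] in [s]. By the Cauchy-Riemann equations and [goursat], the mixed
    difference of [P - Q] over the rectangle [a <= s <= 0], [0 <= t <= 2 pi]
    vanishes. The contribution of [Q] is 0 because [v] is periodic in [t]; that of [P]
    is the difference of the two averages. *)
Lemma circle_avg_Re_exp h a : (forall z, cmod z <= 1 -> derivable h z 1) -> a < 0 ->
  circle_avg (fun t => complex.Re (h (cexp (a +i* t)%C))) =
  circle_avg (fun t => complex.Re (h (cis t))).
Proof.
move=> dh a0.
(* [s] is capped at 0 so that [e^(s + i t)] stays in the closed disc for every [s] *)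
pose m x := Num.min x 0.
have m0 x : m x <= 0 by rewrite ge_min lexx orbT.
have cexp1 x t : cmod (cexp (m x +i* t)%C) <= 1.
  by rewrite cmod_cexp /= -expR0 ler_expR.
have cm : continuous m.
  by move=> x; apply: continuous_min; [exact: cvg_id|exact: cvg_cst].
pose G s t := h (cexp (m s +i* t)%C).
have cG (phi : C -> R) (p q : R -> R) x : continuous phi -> {for x, continuous p} ->
    {for x, continuous q} -> {for x, continuous (fun x => phi (G (p x) (q x)))}.
  move=> cphi cp cq; apply: (@continuous_comp _ _ _ (fun x => G (p x) (q x)) phi); last exact: cphi.
  apply: (@continuous_comp _ _ _ (fun x => cexp (m (p x) +i* (q x))%C) h); last first.
    exact/derivable_continuous/dh/cexp1.
  apply: (@continuous_comp _ _ _ (fun x => (m (p x) +i* (q x))%C : C) cexp); last first.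
    by have [dE _] := is_derive_cexp (m (p x) +i* (q x))%C; exact: derivable_continuous.
  apply: continuous_complex => //.
  exact: (continuous_comp cp (cm _)).
pose u s t := complex.Re (G s t); pose v s t := complex.Im (G s t).
have cu s : continuous (u s).
  move=> t; apply: (cG _ (fun=> s) id t (@continuous_Re R)); first exact: cvg_cst.
  exact: cvg_id.
have cv t : continuous (v^~ t).
  move=> s; apply: (cG _ id (fun=> t) s (@continuous_Im R)); first exact: cvg_id.
  exact: cvg_cst.
have [P dP] := choice (fun s => primitive_exists (cu s)).
have [Q' dQ'] := choice (fun t => primitive_exists (cv t)).
pose Q s t := Q' t s.
have b0 : 0 <= 2 * pi :> R by rewrite mulr_ge0 ?pi_ge0.
have per s : G s (2 * pi) = G s 0.
  by rewrite /G /cexp /= -[X in cis X]add0r cis_periodic.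
have J : rect_diff (fun s t => P s t - Q s t) a 0 (0 - a) (2 * pi - 0) = 0.
  apply: (@goursat R P Q u v a 0 0 (2 * pi) (ltW a0) b0 (fun s t _ => dP s t)
    (fun s t _ => dQ' t s)).
  move=> x0 y0 /andP[ax0 x00] _.
  have mx s : s <= 0 -> m s = s by move=> s0; apply/min_idPl.
  have dg : derivable (h \o cexp) (x0 +i* y0)%C 1.
    have [dE _] := is_derive_cexp (x0 +i* y0)%C.
    apply: (derivable_compC dE); apply: dh.
    by rewrite -(mx _ x00).
  move: dg => /derivableP; move: ('D_1 (h \o cexp) _) => d /is_derive_cmodP H.
  exists (complex.Re d), (- complex.Im d), (complex.Im d) => e e0.
  have [r r0 Hr] := H _ e0; exists (r / 2); first by rewrite divr_gt0.
  move=> s t /andP[as_ s0] sx ty.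
  have kle : cmod ((s - x0) +i* (t - y0))%C <= `|s - x0| + `|t - y0|.
    exact: cmod_le_ReIm.
  have klt : cmod ((s - x0) +i* (t - y0))%C < r.
    by apply: le_lt_trans kle _; rewrite (splitr r) ltrD.
  have {klt} := Hr _ klt.
  have -> : (x0 +i* y0)%C + ((s - x0) +i* (t - y0))%C = (s +i* t)%C.
    by apply/eqP; rewrite eq_complex /= !subrKC !eqxx.
  have uE s' t' : s' <= 0 -> u s' t' = complex.Re ((h \o cexp) (s' +i* t')%C).
    by move=> ?; rewrite /u /G mx.
  have vE s' t' : s' <= 0 -> v s' t' = complex.Im ((h \o cexp) (s' +i* t')%C).
    by move=> ?; rewrite /v /G mx.
  rewrite !uE// !vE//.
  move: ((h \o cexp) (s +i* t)%C) ((h \o cexp) (x0 +i* y0)%C) => g1 g0 hk.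
  have {}hk := le_trans hk (ler_wpM2l (ltW e0) kle).
  split.
    apply: le_trans hk; apply: le_trans (norm_Re_le_cmod _).
    by rewrite le_eqVlt; apply/orP; left; apply/eqP; congr `|_|;
      rewrite !ReD !ReN ReM /=; ring.
  apply: le_trans hk; apply: le_trans (norm_Im_le_cmod _).
  by rewrite le_eqVlt; apply/orP; left; apply/eqP; congr `|_|;
      rewrite !ImD !ImN ImM /=; ring.
move: J; rewrite /rect_diff subrKC add0r subr0 => J.
have dQd s : is_derive s 1 (Q^~ (2 * pi) - Q^~ 0) 0.
  have := is_deriveB (dQ' (2 * pi) s) (dQ' 0 s).
  by rewrite /v per subrr.
have := is_derive_0_is_cst a 0 dQd.
rewrite -![(_ - _ : _ -> _) _]/(_ - _) => QQ.
have PP : P a (2 * pi) - P a 0 = P 0 (2 * pi) - P 0 0.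
  by apply/eqP; rewrite -subr_eq0; apply/eqP; move: J QQ; lra.
have e1 : circle_avg (u a) = circle_avg (u 0).
  by rewrite (circle_avg_primitive (cu a) (dP a)) (circle_avg_primitive (cu 0) (dP 0)) PP.
transitivity (circle_avg (u a)).
  by congr circle_avg; apply/funext => t; rewrite /u /G /m (min_idPl (ltW a0)).
rewrite e1; congr circle_avg; apply/funext => t.
by rewrite /u /G /m minxx /cexp /= expR0 mul1r.
Qed.

(** The average over the circle of radius [e^a] is independent of [a], and tends to
    the value at the centre as the radius tends to 0. *)
Lemma mean_value_Re h : (forall z, cmod z <= 1 -> derivable h z 1) ->
  circle_avg (fun t => complex.Re (h (cis t))) = complex.Re (h 0).
Proof.
move=> dh; apply/eqP; rewrite -subr_eq0 -normr_le0; apply/ler_addgt0Pr => e e0.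
rewrite add0r.
have : {for (0 : C), continuous (@complex.Re R \o h)}.
  apply: (@continuous_comp _ _ _ h (@complex.Re R)); last exact: continuous_Re.
  by apply: derivable_continuous; apply: dh; rewrite cmod0.
move=> /(@cvgrPdist_le _ R^o _ (nbhs (0 : C)) _ _ _).1 /(_ _ e0) /nbhs_ballP [q /= q0 Hq].
have qE : q = (complex.Re q)%:C%C.
  by case: q q0 {Hq} => a b; rewrite ltcE /= => /andP[/eqP -> _].
have qr0 : 0 < complex.Re q by rewrite -ltcR -qE.
pose a := Num.min (ln (complex.Re q / 2)) (-1).
have a0 : a < 0 by rewrite gt_min ltrN10 orbT.
have aq : expR a < complex.Re q.
  apply: le_lt_trans (_ : complex.Re q / 2 < _); last first.
    by rewrite ltr_pdivrMr// ltr_pMr// ltr1n.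
  rewrite -[X in _ <= X]lnK ?posrE ?divr_gt0// ler_expR.
  by rewrite ge_min lexx.
have a1 : expR a <= 1 by rewrite -expR0 ler_expR ltW.
rewrite -(circle_avg_Re_exp dh a0).
set k := fun t => _.
have ck : continuous k.
  move=> t; apply: (@continuous_comp _ _ _ (fun t => h (cexp (a +i* t)%C))); last exact: continuous_Re.
  apply: (@continuous_comp _ _ _ (fun t => cexp (a +i* t)%C)); last first.
    by apply/derivable_continuous/dh; rewrite cmod_cexp.
  apply: (@continuous_comp _ _ _ (fun t => (a +i* t)%C : C)); last first.
    by have [dE _] := is_derive_cexp (a +i* t)%C; exact: derivable_continuous.
  by apply: continuous_complex; [exact: cvg_cst|exact: cvg_id].
have kb t : `|complex.Re (h 0) - k t| <= e.
  by apply: Hq; rewrite -ball_normE /= sub0r normrN cmodE qE ltcR cmod_cexp.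
by rewrite distrC; exact: circle_avg_near.
Qed.

Lemma mean_value_cmod h : (forall z, cmod z <= 1 -> derivable h z 1) ->
  cmod (h 0) <= circle_avg (fun t => cmod (h (cis t))).
Proof.
move=> dh.
have chcis t : {for t, continuous (fun t => h (cis t))}.
  apply: (@continuous_comp _ _ _ (fun t => cis t : C) h); first exact: continuous_cis.
  by apply/derivable_continuous/dh; rewrite cmod_cis.
have [h0|h0] := eqVneq (h 0) 0.
  rewrite h0 cmod0 -(circle_avg_cst 0); apply: le_circle_avg => [t|t|t _].
  - exact: cvg_cst.
  - exact: (continuous_comp (chcis t) (@continuous_cmod R _)).
  - exact: cmod_ge0.
(* rotating h makes its value at the centre real *)
pose a := (h 0)^*%C / (cmod (h 0))%:C%C.
have c0 : cmod (h 0) != 0 by rewrite cmod_eq0.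
have a1 : cmod a = 1.
  by rewrite /a cmodM cmodV cmodJ cmod_real ?cmod_ge0// divff.
have ah0 : a * h 0 = (cmod (h 0))%:C%C.
  rewrite /a mulrAC [_^*%C * _]mulrC -sqr_cmodC expr2 rmorphM /= mulfK//.
  by rewrite -(inj_eq (@complexI R)) in c0.
have := mean_value_Re (fun z hz => derivable_MlC (a := a) (dh z hz)).
rewrite ah0 /= => <-.
apply: le_circle_avg => [t|t|t _].
- apply: (@continuous_comp _ _ _ (fun t => a * h (cis t))); last exact: continuous_Re.
  by apply: cvgM; [exact: cvg_cst|exact: chcis].
- exact: (continuous_comp (chcis t) (@continuous_cmod R _)).
- apply: le_trans (ler_norm _) _; apply: le_trans (norm_Re_le_cmod _) _.
  by rewrite cmodM a1 mul1r.
Qed.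

(** The value of [powR] at negative arguments is 1, hence the absolute value. *)
Lemma continuous_norm_powR p : 0 < p -> continuous (fun x : R => `|x| `^ p).
Proof.
move=> p0 x; have [->|x0] := eqVneq x 0.
  apply/cvgrPdist_lt => e e0; rewrite normr0 powR0 ?gt_eqF//.
  exists (e `^ p^-1) => /=; first exact: powR_gt0.
  move=> y /=; rewrite sub0r normrN => ye.
  rewrite sub0r normrN ger0_norm ?powR_ge0//.
  rewrite -[X in _ < X]powRr1 ?ltW// -(mulVf (lt0r_neq0 p0)) powRrM.
  by apply: gt0_ltr_powR => //; rewrite ?nnegrE ?powR_ge0.
apply: (@continuous_comp _ _ _ (fun x : R => `|x|) (fun x => x `^ p)).
  exact: norm_continuous.
have x0' : 0 < `|x| by rewrite normr_gt0.
exact: is_derive1_continuous (is_derive1_powR p x0').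
Qed.

Lemma continuous_cmod_powR p : 0 < p -> continuous (fun z : C => cmod z `^ p).
Proof.
move=> p0 z.
have -> : (fun z : C => cmod z `^ p) = (fun x : R => `|x| `^ p) \o (@cmod R).
  by apply/funext => w /=; rewrite ger0_norm// cmod_ge0.
by apply: continuous_comp; [exact: continuous_cmod|exact: continuous_norm_powR].
Qed.

Lemma continuous_powR_comp p (g : R -> C) (t : R) : 0 < p -> {for t, continuous g} ->
  {for t, continuous (fun x => cmod (g x) `^ p)}.
Proof.
move=> p0 cg.
exact: (@continuous_comp _ _ _ g (fun z => cmod z `^ p) t cg (@continuous_cmod_powR p p0 _)).
Qed.

(** Jensen's inequality, by the tangent of the power at [cmod (h 0)]. *)
Lemma mean_value_powR p h : 1 <= p -> (forall z, cmod z <= 1 -> derivable h z 1) ->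
  cmod (h 0) `^ p <= circle_avg (fun t => cmod (h (cis t)) `^ p).
Proof.
move=> p1 dh; have p0 : 0 < p by exact: lt_le_trans p1.
have chcis t : {for t, continuous (fun t => h (cis t))}.
  apply: (@continuous_comp _ _ _ (fun t => cis t : C) h); first exact: continuous_cis.
  by apply/derivable_continuous/dh; rewrite cmod_cis.
have cc t : {for t, continuous (fun t => cmod (h (cis t)))}.
  exact: (continuous_comp (chcis t) (@continuous_cmod R _)).
have cp : continuous (fun t => cmod (h (cis t)) `^ p).
  by move=> t; exact: (continuous_powR_comp p0 (chcis t)).
have [h0|h0] := eqVneq (cmod (h 0)) 0.
  rewrite h0 powR0 ?gt_eqF// -(circle_avg_cst 0); apply: le_circle_avg => // [t|t _].
    exact: cvg_cst.
  exact: powR_ge0.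
have y0 : 0 < cmod (h 0) by rewrite lt_neqAle eq_sym h0 cmod_ge0.
set y := cmod (h 0) in h0 y0 *; set c := p * y `^ (p - 1).
have c0 : 0 <= c by rewrite mulr_ge0 ?powR_ge0// ltW.
apply: (@le_trans _ _ (circle_avg (fun t => (y `^ p - c * y) + c * cmod (h (cis t))))).
  rewrite circle_avgD; last 2 first.
  - by move=> t; exact: cvg_cst.
  - by move=> t; apply: cvgM; [exact: cvg_cst|exact: cc].
  rewrite circle_avg_cst circle_avgZ//.
  rewrite -addrA lerDl addrC -mulrBr mulr_ge0// subr_ge0.
  exact: mean_value_cmod.
apply: le_circle_avg => // t.
  by apply: cvgD; [exact: cvg_cst|apply: cvgM; [exact: cvg_cst|exact: cc]].
move=> _; apply: le_trans (powR_tangent p1 (cmod_ge0 (h (cis t))) y0).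
by rewrite mulrBr addrA addrAC.
Qed.

End mean_value.

(** * Disc automorphisms on the closed disc *)

Section disc_automorphism_closed_disc.
Context {R : realType}.
Local Notation C := R[i].
Implicit Types (phi : @disc_aut R) (z w a : C).

Lemma derivable_mulC (f g : C -> C) z : derivable f z 1 -> derivable g z 1 ->
  derivable (fun w => f w * g w) z 1.
Proof. exact: derivableM. Qed.

Lemma cmod_aut_scal phi : cmod (aut_scal phi) = 1.
Proof. by rewrite /cmod aut_scalP. Qed.

Lemma cmod_aut_root phi : cmod (aut_root phi) < 1.
Proof. by rewrite -ltr1_cmod; exact: aut_rootP. Qed.

Lemma aut_den_closed phi z : cmod z <= 1 -> 1 - (aut_root phi)^*%C * z != 0.
Proof.
move=> z1; rewrite subr_eq0; apply/eqP => /(congr1 (@cmod R)); apply/eqP.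
rewrite cmod1 cmodM cmodJ gt_eqF//.
apply: le_lt_trans (_ : cmod (aut_root phi) * 1 < 1).
  by rewrite ler_wpM2l ?cmod_ge0.
by rewrite mulr1 cmod_aut_root.
Qed.

Lemma derivable_aut phi z : cmod z <= 1 -> derivable (phi : C -> C) z 1.
Proof.
move=> z1; have d0 := aut_den_closed phi z1.
rewrite /aut_fun; move: (aut_scal phi) (aut_root phi) d0 => l a d0.
have did := @derivable_id C C z 1.
have dn : derivable (fun w : C => l * (w - a)) z 1.
  by apply: derivableZ; apply: (derivableB did); exact: derivable_cst.
have dd : derivable (fun w : C => 1 - a^*%C * w) z 1.
  by apply: derivableB; [exact: derivable_cst|apply: derivableZ; exact: did].
have dv : derivable (fun w : C => (1 - a^*%C * w)^-1) z 1.
  by apply: (@derivableV C C (fun w : C => 1 - a^*%C * w)).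
exact: derivable_mulC dn dv.
Qed.

(** The Schwarz-Pick identity. *)
Lemma aut_sqr_cmod phi z : cmod z <= 1 ->
  1 - cmod (phi z) ^+ 2 =
  (1 - cmod (aut_root phi) ^+ 2) * (1 - cmod z ^+ 2) /
  cmod (1 - (aut_root phi)^*%C * z) ^+ 2.
Proof.
move=> z1; have d0 := aut_den_closed phi z1.
rewrite /aut_fun !cmodM cmod_aut_scal mul1r cmodV; move: (aut_root phi) d0 => a d0.
have d1 : cmod (1 - a^*%C * z) != 0 by rewrite cmod_eq0.
have key : cmod (1 - a^*%C * z) ^+ 2 - cmod (z - a) ^+ 2 =
    (1 - cmod a ^+ 2) * (1 - cmod z ^+ 2).
  apply: complexI; rewrite rmorphM /= !rmorphB /= rmorph1 !sqr_cmodC.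
  by rewrite !rmorphB rmorphM rmorph1 /= conjcK; ring.
by rewrite -key; field.
Qed.

Lemma cmod_aut_le1 phi z : cmod z <= 1 -> cmod (phi z) <= 1.
Proof.
move=> z1; rewrite -(@ler_pXn2r _ 2)// ?nnegrE ?cmod_ge0// expr1n -subr_ge0.
rewrite aut_sqr_cmod// divr_ge0 ?sqr_ge0// mulr_ge0// subr_ge0 expr_le1 ?cmod_ge0//.
exact/ltW/cmod_aut_root.
Qed.

Lemma cmod_aut_eq1 phi z : cmod z = 1 -> cmod (phi z) = 1.
Proof.
move=> z1; have := @aut_sqr_cmod phi z; rewrite z1 lexx => /(_ isT).
rewrite expr1n subrr mulr0 mul0r => /eqP; rewrite subr_eq0 eq_sym => /eqP h.
apply/eqP; rewrite -(@eqrXn2 _ 2)// ?cmod_ge0// h expr1n//.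
Qed.

End disc_automorphism_closed_disc.

(** * Monotonicity of the integral means *)

Section monotone_means.
Context {R : realType}.
Local Notation C := R[i].
Implicit Types (f g : C -> C) (p r s t e : R).

(** The real-valued form of [circle_mean]. *)
Definition radial_mean p f r := circle_avg (fun t => cmod (f (r%:C%C * cis t)) `^ p).

Lemma continuous_circle_path r : continuous (fun t => r%:C%C * cis t : C).
Proof. exact: continuous_cis_circle. Qed.

Lemma continuous_radial p f r : 0 < p ->
  (forall t, {for r%:C%C * cis t, continuous f}) ->
  continuous (fun t => cmod (f (r%:C%C * cis t)) `^ p).
Proof.
move=> p0 cf t.
have h := continuous_comp (@continuous_circle_path r t) (cf t).
exact: (continuous_powR_comp p0 h).
Qed.

Lemma circle_meanE p f r : 0 < p ->
  (forall t, {for r%:C%C * cis t, continuous f}) ->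
  circle_mean p f r = (radial_mean p f r)%:E.
Proof.
move=> p0 cf; have ck := continuous_radial p0 cf.
rewrite /circle_mean /radial_mean /circle_avg EFinM; congr (_ * _)%E.
rewrite /Rintegral fineK//; apply: integrable_fin_num => //.
exact: continuous_itv_integrable.
Qed.

Lemma holomorphic_continuous f z : holomorphic_on unit_disc f -> cmod z < 1 ->
  {for z, continuous f}.
Proof. by move=> hf z1; apply: derivable_continuous; apply: hf; rewrite unit_discE. Qed.

Lemma cmod_circle r t : 0 <= r -> cmod (r%:C%C * cis t : C) = r.
Proof. by move=> r0; rewrite cmodM cmod_cis mulr1 cmod_real. Qed.

Lemma unit_disc_continuous_circle f r t : holomorphic_on unit_disc f -> 0 <= r < 1 ->
  {for r%:C%C * cis t, continuous f}.
Proof.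
by move=> hf /andP[r0 r1]; apply: holomorphic_continuous => //; rewrite cmod_circle.
Qed.

(** Let [phi] be the automorphism with [phi 0 = r / s] used below. The mean value
    inequality for [z |-> f (s e^(i y) phi z)] bounds [|f (r e^(i y))|^p] by the average
    over [t] of [|f (s e^(i y) phi (e^(i t)))|^p]. Average this over the angles
    [y = 2 pi j / n]: on the left appears a Riemann sum of the mean of radius [r], and
    on the right, for each [t], a Riemann sum of the mean of radius [s] based at the
    angle of the unimodular number [phi (e^(i t))]. This takes the place of the
    Poisson kernel and of an interchange of integrals. *)
Lemma radial_mean_le p f r s : 1 <= p -> holomorphic_on unit_disc f ->
  0 <= r -> r < s -> s < 1 -> radial_mean p f r <= radial_mean p f s.
Proof.
move=> p1 hf r0 rs s1; have p0 : 0 < p by exact: lt_le_trans p1.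
have s0 : 0 < s by exact: le_lt_trans rs.
pose x := r / s.
have x01 : 0 <= x < 1 by rewrite divr_ge0 ?(ltW s0)//= ltr_pdivrMr// mul1r.
have xD : unit_disc (- x%:C%C : C).
  by case/andP: x01 => x0 x1; rewrite unit_discE cmodN cmod_real.
pose phi := DiscAut (@normr1 _ : `|1 : C| = 1) xD.
have phi0 : phi 0 = x%:C%C.
  by rewrite /aut_fun /= mulr0 subr0 sub0r opprK divr1 mul1r.
have crs t' : 0 <= t' < 1 -> continuous (fun t => cmod (f (t'%:C%C * cis t)) `^ p).
  by move=> t01; apply: continuous_radial => // t; exact: unit_disc_continuous_circle.
have perC q t : (q%:C%C * cis (t + 2 * pi) : C) = q%:C%C * cis t by rewrite cis_periodic.
have r01 : 0 <= r < 1 by rewrite r0 (lt_trans rs).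
have s01 : 0 <= s < 1 by rewrite ltW.
pose h (y : R) z := f (s%:C%C * cis y * phi z).
have dh y z : cmod z <= 1 -> derivable (h y) z 1.
  move=> z1.
  have dphi := derivable_MlC (a := s%:C%C * cis y) (derivable_aut (phi := phi) z1).
  apply: (derivable_compC (f := f) dphi).
  apply: hf; rewrite unit_discE cmodM cmod_circle ?(ltW s0)//.
  apply: le_lt_trans s1; rewrite -[X in _ <= X]mulr1 ler_wpM2l ?(ltW s0)//.
  exact: cmod_aut_le1.
have h0 y : h y 0 = f (r%:C%C * cis y).
  by rewrite /h phi0 mulrAC -rmorphM /= /x [s * _]mulrC divfK ?gt_eqF.
have sub y : cmod (f (r%:C%C * cis y)) `^ p <=
    circle_avg (fun t => cmod (f (s%:C%C * cis y * phi (cis t))) `^ p).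
  by rewrite -h0; exact: (mean_value_powR (h := h y) p1 (dh y)).
apply/ler_addgt0Pr => e e0.
have e20 : 0 < e / 2 by rewrite divr_gt0.
have per q t : cmod (f (q%:C%C * cis (t + 2 * pi))) `^ p = cmod (f (q%:C%C * cis t)) `^ p.
  by rewrite perC.
have [N1 H1] := circle_avg_riemann (crs r r01) (per r) e20.
have [N2 H2] := circle_avg_riemann (crs s s01) (per s) e20.
pose N := maxn N1 N2; pose n := N.+1; pose d : R := 2 * pi / n%:R.
have n0 : 0 < n%:R^-1 :> R by rewrite invr_gt0 ltr0n.
have pi20 : 0 <= 2 * pi :> R by rewrite mulr_ge0 ?pi_ge0.
have := H1 N 0 (leq_maxl _ _); rewrite normr0 => /(_ pi20) /ler_normlP[+ _].
rewrite opprB lerBlDr => /le_trans; apply.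
have ch (j : 'I_n) : continuous (fun t => cmod (h (j%:R * d) (cis t)) `^ p).
  move=> t; apply: (continuous_powR_comp p0).
  apply: (@continuous_comp _ _ _ (fun t => cis t : C) (h (j%:R * d))); first exact: continuous_cis.
  by apply/derivable_continuous/dh; rewrite cmod_cis.
apply: (@le_trans _ _ (e / 2 +
    circle_avg (fun t => n%:R^-1 * \sum_(j < n) cmod (h (j%:R * d) (cis t)) `^ p))).
  rewrite lerD2l circle_avgZ; last exact: continuous_bigsum.
  rewrite ler_pM2l// circle_avg_sum//; apply: ler_sum => j _.
  by rewrite add0r; exact: sub.
rewrite -lerBrDl -(circle_avg_cst (_ - _)); apply: le_circle_avg => [t|t|t _].
- by apply: cvgM; [exact: cvg_cst|exact: continuous_bigsum].
- exact: cvg_cst.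
have [y ypi ey] := circle_polar (@cmod_aut_eq1 R phi (cis t) (cmod_cis t)).
have := H2 N y (leq_maxr _ _).
have ypi2 : `|y| <= 2 * pi by apply: (le_trans ypi); rewrite ler_peMl ?pi_ge0// ler1n.
move=> /(_ ypi2) /ler_normlP[_]; rewrite lerBlDr => h2.
have -> : radial_mean p f s + e - e / 2 = e / 2 + radial_mean p f s by field.
apply: le_trans h2; rewrite ler_pM2l// ler_sum// => j _.
by rewrite /h ey -mulrA -cisD addrC.
Qed.

End monotone_means.

(** * The norm as a limit of integral means *)

Section hardy_power.
Context {R : realType}.
Local Notation C := R[i].
Implicit Types (f g b : C -> C) (k : C -> R) (p r s t e c W X : R) (n N : nat).

Definition rad n : R := 1 - n.+1%:R^-1.

Lemma rad_itv n : 0 <= rad n < 1.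
Proof.
rewrite /rad subr_ge0 invf_le1 ?ltr0n// ler1n /=.
by rewrite ltrBlDr ltrDl invr_gt0 ltr0n.
Qed.

Lemma rad_homo : {homo rad : m n / (m <= n)%N >-> m <= n}.
Proof. by move=> m n mn; rewrite lerB// lef_pV2 ?posrE ?ltr0n// ler_nat. Qed.

Lemma rad_gt r : r < 1 -> exists n, r <= rad n.
Proof.
move=> r1; exists (Num.truncn (1 - r)^-1).
have h : 0 < (1 - r)^-1 by rewrite invr_gt0 subr_gt0.
have /andP[_ /ltW h2] := truncn_itv (ltW h).
by rewrite lerBrDr -lerBrDl invf_ple ?posrE ?ltr0n// subr_gt0.
Qed.

Lemma cvg_rad : rad @ \oo --> (1 : R).
Proof.
rewrite -[X in _ --> X]subr0; apply: cvgB; first exact: cvg_cst.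
exact: cvg_harmonic.
Qed.

Lemma radial_mean_homo p f : 1 <= p -> holomorphic_on unit_disc f ->
  forall r s, 0 <= r -> r <= s -> s < 1 -> radial_mean p f r <= radial_mean p f s.
Proof.
move=> p1 hf r s r0; rewrite le_eqVlt => /predU1P[->//|rs] s1.
exact: radial_mean_le.
Qed.

(** The [p]-th power of the norm, by [hardy_powP]. *)
Definition hardy_pow p f : R := limn (fun n => radial_mean p f (rad n)).

(** Since the means increase with the radius, their supremum is their limit along the
    radii [rad n]. *)
Lemma hardy_powP p f : 1 <= p -> holomorphic_on unit_disc f ->
  (hardy_norm p f < +oo)%E ->
  [/\ 0 <= hardy_pow p f, hardy_norm p f = (hardy_pow p f `^ p^-1)%:E,
      radial_mean p f (rad n) @[n --> \oo] --> hardy_pow p f &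
      forall r, 0 <= r < 1 -> radial_mean p f r <= hardy_pow p f].
Proof.
move=> p1 hf; have p0 : 0 < p by exact: lt_le_trans p1.
move=> /((hardy_norm_ltyP _ p0).1)[M leM].
have rmE r : 0 <= r < 1 -> circle_mean p f r = (radial_mean p f r)%:E.
  by move=> r01; apply: circle_meanE => // t; exact: unit_disc_continuous_circle.
have rmM r : 0 <= r < 1 -> radial_mean p f r <= M.
  by move=> r01; rewrite -lee_fin -rmE// leM.
have nd : nondecreasing_seq (fun n => radial_mean p f (rad n)).
  move=> m n mn; have [/andP[m0 _] /andP[_ n1]] := (rad_itv m, rad_itv n).
  by apply: radial_mean_homo => //; exact: rad_homo.
have cv : cvgn (fun n => radial_mean p f (rad n)).
  by apply: nondecreasing_is_cvgn => //; exists M => _ [n _ <-]; apply/rmM/rad_itv.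
have le_r r : 0 <= r < 1 -> radial_mean p f r <= hardy_pow p f.
  move=> /andP[r0 r1]; have [n rn] := rad_gt r1.
  apply: le_trans (nondecreasing_cvgn_le nd cv n).
  by apply: radial_mean_homo => //; have /andP[] := rad_itv n.
have l0 : 0 <= hardy_pow p f.
  have z01 : 0 <= (0 : R) < 1 by rewrite lexx ltr01.
  by apply: le_trans (le_r 0 z01); rewrite -lee_fin -rmE// circle_mean_ge0.
split => //; rewrite /hardy_norm.
suff -> : ereal_sup [set circle_mean p f r | r in `[0, 1[] = (hardy_pow p f)%:E.
  by rewrite poweR_EFin.
apply/le_anti/andP; split.
  apply: ge_ereal_sup => _ [r /= + <-]; rewrite in_itv/= => r01.
  by rewrite rmE// lee_fin le_r.
set s := ereal_sup _.
have sge r : 0 <= r < 1 -> ((radial_mean p f r)%:E <= s)%E.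
  by move=> r01; apply: ereal_sup_ubound; exists r; rewrite /= ?in_itv ?rmE.
clearbody s; case: s sge => [x||] sge; last 2 first.
- by rewrite leey.
- have z01 : 0 <= (0 : R) < 1 by rewrite lexx ltr01.
  by have := sge 0 z01; rewrite leeNy_eq.
rewrite lee_fin; apply: limr_le => //; apply: nearW => n.
by rewrite -lee_fin; apply/sge/rad_itv.
Qed.

Lemma hardy_norm_eq_pow p f g : 1 <= p -> holomorphic_on unit_disc f ->
  holomorphic_on unit_disc g -> (hardy_norm p f < +oo)%E ->
  hardy_norm p f = hardy_norm p g -> hardy_pow p f = hardy_pow p g.
Proof.
move=> p1 hf hg nf fg; have ng : (hardy_norm p g < +oo)%E by rewrite -fg.
have p0 : 0 < p by exact: lt_le_trans p1.
have [f0 ef _ _] := hardy_powP p1 hf nf; have [g0 eg _ _] := hardy_powP p1 hg ng.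
have := congr1 fine (etrans (esym ef) (etrans fg eg)).
rewrite /fine.
move: (hardy_pow p f) (hardy_pow p g) f0 g0 => x y x0 y0 xy.
rewrite -(powRr1 x0) -(powRr1 y0) -(mulVf (lt0r_neq0 p0)) !powRrM.
by congr (_ `^ _).
Qed.

(** Compactness of the interval turns continuity of [k] along the path into uniform
    convergence along the dilated paths. *)
Lemma cvg_path_unif k (gamma : R -> C) e : continuous gamma ->
  (forall t, {for gamma t, continuous k}) ->
  0 < e -> exists N, forall n t, (N <= n)%N -> 0 <= t <= 2 * pi ->
    `|k ((rad n)%:C%C * gamma t) - k (gamma t)| < e.
Proof.
move=> cgamma ck e0.
have /compact_near_coveringP cover := @segment_compact R 0 (2 * pi).
have [|N _ HN] := cover nat \oo
  (fun n t => `|k ((rad n)%:C%C * gamma t) - k (gamma t)| < e) _; last first.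
  by exists N => n t Nn t01; apply: (HN n Nn); rewrite /= in_itv.
move=> t _.
have e20 : 0 < e / 2 by rewrite divr_gt0.
have /(@cvgrPdist_lt _ R^o _ (nbhs (gamma t)) _ _ _).1 /(_ _ e20) near_k := ck t.
have c1 : (fun x : R * nat => (rad x.2)%:C%C * gamma x.1 : C) @ filter_prod (nbhs t) \oo --> gamma t.
  rewrite -[X in _ --> X]mul1r; apply: cvgM.
    have c0 : (fun x : R * nat => rad x.2) @ filter_prod (nbhs t) \oo --> (1 : R).
      by apply: cvg_comp; [exact: cvg_snd|exact: cvg_rad].
    rewrite -[X in _ --> X]/((1 : R)%:C%C : C).
    exact: (@cvg_comp _ _ _ (fun x : R * nat => rad x.2) (fun x : R => x%:C%C : C)
      _ _ _ c0 (@continuous_real_complex R 1)).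
  by apply: cvg_comp; [exact: cvg_fst|exact: cgamma].
have c2 : (fun x : R * nat => gamma x.1 : C) @ filter_prod (nbhs t) \oo --> gamma t.
  by apply: cvg_comp; [exact: cvg_fst|exact: cgamma].
have n1 := c1 _ near_k; have n2 := c2 _ near_k.
near=> x.
have h1 : `|k (gamma t) - k ((rad x.2)%:C%C * gamma x.1)| < e / 2 by near: x; exact: n1.
have h2 : `|k (gamma t) - k (gamma x.1)| < e / 2 by near: x; exact: n2.
rewrite -(subrK (k (gamma t)) (k _)) -addrA (splitr e).
by apply: le_lt_trans (ler_normD _ _) _; apply: ltrD => //; rewrite distrC.
Unshelve. all: by end_near. Qed.

Lemma cvg_circle_unif k e : (forall z, cmod z <= 1 -> {for z, continuous k}) ->
  0 < e -> exists N, forall n t, (N <= n)%N -> 0 <= t <= 2 * pi ->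
    `|k ((rad n)%:C%C * cis t) - k (cis t)| < e.
Proof.
move=> ck; apply: cvg_path_unif; first exact: continuous_cis.
by move=> t; apply: ck; rewrite cmod_cis.
Qed.

Lemma continuous_circle_le1 k r : (forall z, cmod z <= 1 -> {for z, continuous k}) ->
  0 <= r <= 1 -> continuous (fun t => k (r%:C%C * cis t)).
Proof.
move=> ck /andP[r0 r1] t.
apply: (@continuous_comp _ _ _ (fun t => r%:C%C * cis t : C) k).
  exact: continuous_circle_path.
by apply: ck; rewrite cmod_circle.
Qed.

Lemma circle_avg_diff (k1 k2 k3 : R -> R) :
  continuous k1 -> continuous k2 -> continuous k3 ->
  (forall t, 0 <= t <= 2 * pi -> `|k1 t - k2 t| <= k3 t) ->
  `|circle_avg k1 - circle_avg k2| <= circle_avg k3.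
Proof.
move=> c1 c2 c3 H; apply/ler_normlP; split.
  rewrite opprB lerBlDr -circle_avgD//.
  apply: le_circle_avg => // [t|t /H /ler_normlP[]].
    by apply: cvgD; [exact: c3|exact: c1].
  by rewrite opprB lerBlDr.
rewrite lerBlDr -circle_avgD//.
apply: le_circle_avg => // [t|t /H /ler_normlP[_]].
  by apply: cvgD; [exact: c3|exact: c2].
by rewrite lerBlDr.
Qed.

Lemma cvg_circle_avg k : (forall z, cmod z <= 1 -> {for z, continuous k}) ->
  circle_avg (fun t => k ((rad n)%:C%C * cis t)) @[n --> \oo] -->
  circle_avg (fun t => k (cis t)).
Proof.
move=> ck; apply/cvgrPdist_le => e e0.
have [N HN] := cvg_circle_unif ck e0.
exists N => // n /= Nn; rewrite distrC -(circle_avg_cst e).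
apply: circle_avg_diff; last by move=> t t01; apply/ltW/HN.
- by apply: continuous_circle_le1 => //; have /andP[-> /ltW ->] := rad_itv n.
- rewrite (_ : (fun t => _) = (fun t => k (1%:C%C * cis t))); last first.
    by apply/funext => t; rewrite mul1r.
  by apply: continuous_circle_le1 => //; rewrite ler01 lexx.
- by move=> t; exact: cvg_cst.
Qed.

(** The weight is uniformly close to 1 on the circles of radius close to 1, and the
    means of [|f|^p] are bounded. *)
Lemma cvg_radial_weight p f k : 1 <= p -> holomorphic_on unit_disc f ->
  (hardy_norm p f < +oo)%E ->
  (forall z, cmod z <= 1 -> {for z, continuous k}) ->
  (forall z, cmod z = 1 -> k z = 1) ->
  circle_avg (fun t => cmod (f ((rad n)%:C%C * cis t)) `^ p * k ((rad n)%:C%C * cis t))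
    @[n --> \oo] --> hardy_pow p f.
Proof.
move=> p1 hf nf ck k1; have p0 : 0 < p by exact: lt_le_trans p1.
have [H0 _ cf le_f] := hardy_powP p1 hf nf.
set H := hardy_pow p f in H0 cf le_f *.
pose A n := circle_avg (fun t => cmod (f ((rad n)%:C%C * cis t)) `^ p * k ((rad n)%:C%C * cis t)).
suff d0 : A n - radial_mean p f (rad n) @[n --> \oo] --> (0 : R).
  change (A @ \oo --> H); have -> : A = (fun n => A n - radial_mean p f (rad n)) + (fun n => radial_mean p f (rad n)).
    by apply/funext => n; rewrite -[RHS]/(_ - _ + _) subrK.
  by rewrite -[H]add0r; exact: cvgD d0 cf.
rewrite {}/A.
apply/cvgrPdist_le => e e0.
have e10 : 0 < e / (H + 1) by rewrite divr_gt0// ltr_wpDl.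
have [N HN] := cvg_circle_unif ck e10.
exists N => // n /= Nn; rewrite sub0r normrN.
have n01 := rad_itv n; have n01' : 0 <= rad n <= 1 by have /andP[-> /ltW ->] := n01.
have c1 : continuous (fun t => cmod (f ((rad n)%:C%C * cis t)) `^ p).
  by apply: continuous_radial => // t; exact: unit_disc_continuous_circle.
have c2 := continuous_circle_le1 ck n01'.
have c12 : continuous (fun t => cmod (f ((rad n)%:C%C * cis t)) `^ p * k ((rad n)%:C%C * cis t)).
  by move=> t; apply: cvgM; [exact: c1|exact: c2].
have cZ c : continuous (fun t => c * cmod (f ((rad n)%:C%C * cis t)) `^ p).
  by move=> t; apply: cvgM; [exact: cvg_cst|exact: c1].
set e1 := e / (H + 1) in e10 HN.
have b t : 0 <= t <= 2 * pi -> 1 - e1 <= k ((rad n)%:C%C * cis t) <= 1 + e1.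
  move=> t01; have := HN n t Nn t01; rewrite (k1 _ (cmod_cis t)) => /ltW.
  by rewrite ler_distl.
have rm0 : 0 <= radial_mean p f (rad n).
  rewrite -(circle_avg_cst 0); apply: le_circle_avg => // [t|t _]; first exact: cvg_cst.
  exact: powR_ge0.
have rmle : e1 * radial_mean p f (rad n) <= e.
  rewrite /e1 mulrAC ler_pdivrMr ?ltr_wpDl// ler_pM2l//.
  by apply: le_trans (le_f _ n01) _; rewrite lerDl.
apply: le_trans rmle.
have lo : (1 - e1) * radial_mean p f (rad n) <= circle_avg (fun t =>
    cmod (f ((rad n)%:C%C * cis t)) `^ p * k ((rad n)%:C%C * cis t)).
  rewrite -circle_avgZ//; apply: le_circle_avg => // t /b /andP[b1 b2].
  by rewrite mulrC ler_wpM2l ?powR_ge0.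
have hi : circle_avg (fun t => cmod (f ((rad n)%:C%C * cis t)) `^ p *
    k ((rad n)%:C%C * cis t)) <= (1 + e1) * radial_mean p f (rad n).
  rewrite -circle_avgZ//; apply: le_circle_avg => // t /b /andP[b1 b2].
  by rewrite [X in _ <= X]mulrC ler_wpM2l ?powR_ge0.
move: lo hi; rewrite mulrBl mulrDl mul1r lerBlDr -lerBlDl => lo hi.
by apply/ler_normlP; split; [rewrite opprB|rewrite lerBlDl].
Qed.

End hardy_power.

(** * Elements of the Hardy space *)

Section cutoff.
Context {R : realType}.
Local Notation C := R[i].
Implicit Types (f : C -> C) (p : R).

(** Elements of the Hardy space are represented by functions with value 0 off the
    disc. *)
Definition cutoff f : C -> C := fun z => if cmod z < 1 then f z else 0.

Lemma cutoff_in f z : cmod z < 1 -> cutoff f z = f z.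
Proof. by rewrite /cutoff => ->. Qed.

Lemma near_cutoff f z : cmod z < 1 -> \near z, f z = cutoff f z.
Proof.
move=> z1; near=> w; rewrite cutoff_in//.
by near: w; apply: (cvgr_lt (cmod z)) => //; exact: continuous_cmod.
Unshelve. all: by end_near. Qed.

Lemma holomorphic_cutoff f : holomorphic_on unit_disc f ->
  holomorphic_on unit_disc (cutoff f).
Proof.
move=> hf z Dz; apply: (near_eq_derivable _ (hf z Dz)).
by apply: near_cutoff; rewrite -unit_discE.
Qed.

Lemma radial_mean_cutoff p f r : 0 <= r < 1 ->
  radial_mean p (cutoff f) r = radial_mean p f r.
Proof.
move=> /andP[r0 r1]; congr circle_avg; apply/funext => t.
by rewrite cutoff_in// cmod_circle.
Qed.

Lemma cutoff_hardy p (p1 : 1 <= p) f M : holomorphic_on unit_disc f ->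
  (forall r, 0 <= r < 1 -> radial_mean p f r <= M) -> cutoff f \in hardy_mem p1.
Proof.
move=> hf fM; have p0 : 0 < p by exact: lt_le_trans p1.
have hc := holomorphic_cutoff hf.
rewrite /hardy_mem inE; split => //.
  apply: (hardy_norm_ltyP _ p0).2; exists M => r r01.
  rewrite circle_meanE//; last by move=> t; exact: unit_disc_continuous_circle.
  by rewrite lee_fin radial_mean_cutoff// fM.
by move=> z; rewrite unit_discE /cutoff; case: ifP.
Qed.

End cutoff.

Section hardy_elements.
Context {R : realType} {p : R} {p1 : 1 <= p}.
Local Notation C := R[i].
Implicit Types (f g : hardy p1) (b : C -> C) (c e W X : R).

Lemma hardy_holo f : holomorphic_on unit_disc f.
Proof. by have := hardy_funP f; rewrite /hardy_mem inE => -[]. Qed.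

Lemma hardy_fin f : (hardy_norm p f < +oo)%E.
Proof. by have := hardy_funP f; rewrite /hardy_mem inE => -[]. Qed.

Lemma hardy_out f z : ~ unit_disc z -> f z = 0.
Proof. by have := hardy_funP f; rewrite /hardy_mem inE => -[_ _]; apply. Qed.

Lemma hardy_ext f g : (forall z, unit_disc z -> f z = g z) -> f = g.
Proof.
move=> fg; apply: val_inj; apply/funext => z /=.
have [Dz|Dz] := pselect (unit_disc z); first exact: fg.
by rewrite !hardy_out.
Qed.

Lemma hardy_cvg f : radial_mean p f (rad n) @[n --> \oo] --> hardy_pow p f.
Proof. by have [] := hardy_powP p1 (@hardy_holo f) (hardy_fin f). Qed.

Lemma hardy_pow_ge0 f : 0 <= hardy_pow p f.
Proof. by have [] := hardy_powP p1 (@hardy_holo f) (hardy_fin f). Qed.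

Lemma le_hardy_pow f r : 0 <= r < 1 -> radial_mean p f r <= hardy_pow p f.
Proof. by have [_ _ _] := hardy_powP p1 (@hardy_holo f) (hardy_fin f); apply. Qed.

Lemma eq_hardy_pow f g : hardy_norm p f = hardy_norm p g ->
  hardy_pow p f = hardy_pow p g.
Proof.
exact: (hardy_norm_eq_pow p1 (@hardy_holo f) (@hardy_holo g) (hardy_fin f)).
Qed.

Let p0 : 0 < p. Proof. exact: lt_le_trans p1. Qed.

Lemma continuous_hardy_circle f n :
  continuous (fun t => cmod (f ((rad n)%:C%C * cis t)) `^ p).
Proof.
apply: continuous_radial => // t.
by apply: unit_disc_continuous_circle (rad_itv n); exact: hardy_holo.
Qed.

Lemma rad_disc n t : cmod ((rad n)%:C%C * cis t : C) < 1.
Proof. by have /andP[h1 h2] := @rad_itv R n; rewrite cmod_circle. Qed.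

End hardy_elements.

(** * The second variation of the norm *)

Section second_variation.
Context {R : realType}.
Local Notation C := R[i].
Implicit Types (w : C) (p c e W X : R).

Lemma powR_sqrt_cmod p w : cmod w `^ p = (cmod w ^+ 2) `^ (p / 2).
Proof.
rewrite -powR_mulrn ?cmod_ge0// -powRrM; congr (_ `^ _).
by rewrite mulrC divfK.
Qed.

(** The sum over the four unimodular multiples [1], [-1], [i], [-i] of [w] removes the
    linear part of the expansion at [w = 0] and makes its quadratic part a multiple of
    [|w|^2]. *)
Definition quad_powR p w : R :=
  cmod (1 + w) `^ p + cmod (1 - w) `^ p +
  (cmod (1 + 'i%C * w) `^ p + cmod (1 - 'i%C * w) `^ p).

(** Let [q = p / 2] and expand [(1 + u) ^ q] at [u = 2 Re (a w) + |w|^2], where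
    [1 + u = |1 + a w|^2] and [a] runs over the fourth roots of unity. The sum of the
    [u] is [4 |w|^2], that of their squares [8 |w|^2] up to order 4; the coefficient is
    [4 q + 4 q (q - 1) = p ^ 2]. *)
Lemma quad_powR_expand p e : 0 < e -> exists2 d : R, 0 < d & forall w, cmod w <= d ->
  `|quad_powR p w - (4 + p ^+ 2 * cmod w ^+ 2)| <= e * cmod w ^+ 2.
Proof.
move=> e0; set q := p / 2.
have e10 : 0 < e / 24 by rewrite divr_gt0.
have [d1 d10 H1] := powR_taylor2 q e10.
set K := `|2 * q * (q - 1)| + 1.
have K0 : 0 < K by rewrite ltr_wpDl.
exists (Num.min 1 (Num.min (d1 / 3) (e / (2 * K)))).
  by rewrite !lt_min ltr01 !divr_gt0// mulr_gt0.
move=> w; rewrite !le_min => /and3P[w1 wd we].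
set x := complex.Re w; set y := complex.Im w; set m := cmod w ^+ 2.
have w0 : 0 <= cmod w by exact: cmod_ge0.
have mE : m = x ^+ 2 + y ^+ 2 by exact: sqr_cmod.
have m0 : 0 <= m by exact: sqr_ge0.
have mw : m <= cmod w by rewrite /m expr2 ler_piMr.
have m1 : m <= 1 by exact: le_trans mw w1.
have xw : `|x| <= cmod w by exact: norm_Re_le_cmod.
have yw : `|y| <= cmod w by exact: norm_Im_le_cmod.
have T (v : C) u : cmod v ^+ 2 = 1 + u -> `|u| <= d1 ->
    `|cmod v `^ p - (1 + q * u + q * (q - 1) / 2 * u ^+ 2)| <= e / 24 * u ^+ 2.
  by move=> vu ud; rewrite powR_sqrt_cmod vu; exact: H1.
have ub s : `|s| <= cmod w -> `|2 * s + m| <= d1.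
  move=> sw; apply: le_trans (ler_normD _ _) _.
  rewrite normrM (ger0_norm m0) (@ger0_norm _ 2)//.
  move: wd; rewrite ler_pdivlMr// => wd.
  by clear -sw mw wd; lra.
have e1 : cmod (1 + w) ^+ 2 = 1 + (2 * x + m).
  by rewrite sqr_cmod mE ReD ImD /= -/x -/y; ring.
have e2 : cmod (1 - w) ^+ 2 = 1 + (2 * (- x) + m).
  by rewrite sqr_cmod mE ReD ImD ReN ImN /= -/x -/y; ring.
have e3 : cmod (1 + 'i%C * w) ^+ 2 = 1 + (2 * (- y) + m).
  by rewrite sqr_cmod mE ReD ImD ReM ImM /= -/x -/y; ring.
have e4 : cmod (1 - 'i%C * w) ^+ 2 = 1 + (2 * y + m).
  by rewrite sqr_cmod mE ReD ImD ReN ImN ReM ImM /= -/x -/y; ring.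
have t1 := T _ _ e1 (ub _ xw).
have t2 : `|cmod (1 - w) `^ p - (1 + q * (2 * (- x) + m) +
    q * (q - 1) / 2 * (2 * (- x) + m) ^+ 2)| <= e / 24 * (2 * (- x) + m) ^+ 2.
  by apply: T => //; apply: ub; rewrite normrN.
have t3 : `|cmod (1 + 'i%C * w) `^ p - (1 + q * (2 * (- y) + m) +
    q * (q - 1) / 2 * (2 * (- y) + m) ^+ 2)| <= e / 24 * (2 * (- y) + m) ^+ 2.
  by apply: T => //; apply: ub; rewrite normrN.
have t4 := T _ _ e4 (ub _ yw).
have sq : (2 * x + m) ^+ 2 + (2 * (- x) + m) ^+ 2 + ((2 * (- y) + m) ^+ 2 + (2 * y + m) ^+ 2) =
    8 * m + 4 * m ^+ 2.
  by rewrite [in 8 * m]mE; ring.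
have pq : p ^+ 2 = 4 * q ^+ 2 by rewrite /q; field.
have mm : m ^+ 2 <= m by rewrite expr2 ler_piMr.
have Km : `|2 * q * (q - 1) * m ^+ 2| <= e / 2 * m.
  rewrite normrM (ger0_norm (sqr_ge0 m)) expr2 mulrA ler_wpM2r//.
  apply: (@le_trans _ _ (K * m)); first by rewrite ler_wpM2r// lerDl.
  apply: le_trans (ler_wpM2l (ltW K0) mw) _.
  apply: le_trans (ler_wpM2l (ltW K0) we) _.
  have -> : K * (e / (2 * K)) = e / 2 by field; rewrite gt_eqF.
  by [].
have tot : `|quad_powR p w - (4 + p ^+ 2 * m) - 2 * q * (q - 1) * m ^+ 2| <=
    e / 24 * (8 * m + 4 * m ^+ 2).
  have -> : quad_powR p w - (4 + p ^+ 2 * m) - 2 * q * (q - 1) * m ^+ 2 =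
    (cmod (1 + w) `^ p - (1 + q * (2 * x + m) + q * (q - 1) / 2 * (2 * x + m) ^+ 2)) +
    (cmod (1 - w) `^ p - (1 + q * (2 * (- x) + m) + q * (q - 1) / 2 * (2 * (- x) + m) ^+ 2)) +
    ((cmod (1 + 'i%C * w) `^ p - (1 + q * (2 * (- y) + m) + q * (q - 1) / 2 * (2 * (- y) + m) ^+ 2)) +
    (cmod (1 - 'i%C * w) `^ p - (1 + q * (2 * y + m) + q * (q - 1) / 2 * (2 * y + m) ^+ 2))).
    rewrite /quad_powR pq; move: (congr1 (fun z => q * (q - 1) / 2 * z) sq).
    by rewrite /=; clear; lra.
  rewrite -sq !(mulrDr (e / 24)).
  by do 3?[apply: le_trans (ler_normD _ _) _; apply: lerD => //].
have -> : quad_powR p w - (4 + p ^+ 2 * m) = (quad_powR p w - (4 + p ^+ 2 * m) -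
    2 * q * (q - 1) * m ^+ 2) + 2 * q * (q - 1) * m ^+ 2 by rewrite subrK.
apply: le_trans (ler_normD _ _) _.
apply: le_trans (lerD tot Km) _.
have : e / 24 * m ^+ 2 <= e / 24 * m by rewrite ler_wpM2l// ltW.
clear; lra.
Qed.

End second_variation.

Section norm_second_variation.
Context {R : realType} {p : R} {p1 : 1 <= p}.
Local Notation C := R[i].
Implicit Types (f g : hardy p1) (b : C -> C) (c e W X : R).

Let p0 : 0 < p. Proof. exact: lt_le_trans p1. Qed.

Definition quad_hardy_pow f g c : R :=
  hardy_pow p (f + c%:C%C *: g) + hardy_pow p (f - c%:C%C *: g) +
  (hardy_pow p (f + ('i%C * c%:C%C) *: g) + hardy_pow p (f - ('i%C * c%:C%C) *: g)).

(** Integrate [quad_powR_expand] at [w = c * b] against [|f|^p] over the circles of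
    radius [rad n]. As [b] is bounded, the error is uniform in [n], which can tend to
    infinity. *)
Lemma second_variation f g b W X e :
  (forall z, cmod z < 1 -> g z = b z * f z) ->
  (forall z, cmod z < 1 -> cmod (b z) <= W) ->
  (forall z, cmod z < 1 -> {for z, continuous b}) ->
  circle_avg (fun t => cmod (f ((rad n)%:C%C * cis t)) `^ p *
    cmod (b ((rad n)%:C%C * cis t)) ^+ 2) @[n --> \oo] --> X ->
  0 < e -> exists2 d : R, 0 < d & forall c, 0 < c -> c <= d ->
    `|quad_hardy_pow f g c - (4 * hardy_pow p f + p ^+ 2 * c ^+ 2 * X)| <= e * c ^+ 2.
Proof.
move=> gb bW cb cX e0.
have W0 : 0 <= W.
  by apply: le_trans (bW 0 _); rewrite ?cmod_ge0// cmod0.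
set H := hardy_pow p f; have H0 : 0 <= H := hardy_pow_ge0 f.
pose M := (W ^+ 2 + 1) * (H + 1).
have M0 : 0 < M by rewrite mulr_gt0// ltr_wpDl// sqr_ge0.
have e10 : 0 < e / M by rewrite divr_gt0.
have [d0 d00 Hd] := quad_powR_expand p e10.
have W10 : 0 < W + 1 by rewrite ltr_wpDl.
exists (d0 / (W + 1)); first by rewrite divr_gt0.
move=> c c0; rewrite ler_pdivlMr// => cd.
pose Y n := circle_avg (fun t => cmod (f ((rad n)%:C%C * cis t)) `^ p *
    cmod (b ((rad n)%:C%C * cis t)) ^+ 2).
pose Q n := radial_mean p (f + c%:C%C *: g) (rad n) + radial_mean p (f - c%:C%C *: g) (rad n) +
  (radial_mean p (f + ('i%C * c%:C%C) *: g) (rad n) + radial_mean p (f - ('i%C * c%:C%C) *: g) (rad n)).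
pose D n := Q n - (4 * radial_mean p f (rad n) + p ^+ 2 * c ^+ 2 * Y n).
have cD : D n @[n --> \oo] --> quad_hardy_pow f g c - (4 * H + p ^+ 2 * c ^+ 2 * X).
  apply: cvgB; first by apply: cvgD; apply: cvgD; exact: hardy_cvg.
  apply: cvgD; first by apply: cvgM; [exact: cvg_cst|exact: hardy_cvg].
  by apply: cvgM; [exact: cvg_cst|exact: cX].
apply: (cvgr_to_le (cvg_norm cD)); apply: nearW => n.
pose F t := cmod (f ((rad n)%:C%C * cis t)) `^ p.
pose B t := cmod (b ((rad n)%:C%C * cis t)).
have cF : continuous F := @continuous_hardy_circle R p p1 f n.
have cB : continuous (fun t => B t ^+ 2).
  have cB1 : continuous B.
    move=> t; apply: (@continuous_comp _ _ _ (fun t => b ((rad n)%:C%C * cis t)) (@cmod R)); last exact: continuous_cmod.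
    apply: (@continuous_comp _ _ _ (fun t => (rad n)%:C%C * cis t : C) b).
      exact: continuous_circle_path.
    by apply/cb/rad_disc.
  have -> : (fun t => B t ^+ 2) = B \* B by apply/funext => t; rewrite /= expr2.
  by move=> t; apply: cvgM; exact: cB1.
have ptw (a : C) t : cmod ((f + a *: g) ((rad n)%:C%C * cis t)) `^ p =
    F t * cmod (1 + a * b ((rad n)%:C%C * cis t)) `^ p.
  rewrite -[(f + a *: g) _]/(f _ + a * g _) gb ?rad_disc//.
  have -> : f ((rad n)%:C%C * cis t) + a * (b ((rad n)%:C%C * cis t) * f ((rad n)%:C%C * cis t)) =
    f ((rad n)%:C%C * cis t) * (1 + a * b ((rad n)%:C%C * cis t)) by ring.
  by rewrite cmodM powRM ?cmod_ge0.
have cC (a : R) (k : R -> R) : continuous k -> continuous (fun t => a * k t).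
  by move=> ck t; apply: cvgM; [exact: cvg_cst|exact: ck].
have cS (k1 k2 : R -> R) : continuous k1 -> continuous k2 -> continuous (fun t => k1 t + k2 t).
  by move=> ck1 ck2 t; apply: cvgD; [exact: ck1|exact: ck2].
have cG (h : hardy p1) := @continuous_hardy_circle R p p1 h n.
pose h1 : hardy p1 := f + c%:C%C *: g; pose h2 : hardy p1 := f - c%:C%C *: g.
pose h3 : hardy p1 := f + ('i%C * c%:C%C) *: g.
pose h4 : hardy p1 := f - ('i%C * c%:C%C) *: g.
pose S (h : hardy p1) t := cmod (h ((rad n)%:C%C * cis t)) `^ p.
have SE : (fun t => F t * quad_powR p (c%:C%C * b ((rad n)%:C%C * cis t))) =
    (fun t => S h1 t + S h2 t + (S h3 t + S h4 t)).
  apply/funext => t.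
  by rewrite /S /h1 /h2 /h3 /h4 -!scaleNr !ptw /quad_powR !mulNr -!mulrA; ring.
have cFQ : continuous (fun t => F t * quad_powR p (c%:C%C * b ((rad n)%:C%C * cis t))).
  by rewrite SE; exact: (cS _ _ (cS _ _ (cG h1) (cG h2)) (cS _ _ (cG h3) (cG h4))).
have QE : Q n = circle_avg (fun t => F t * quad_powR p (c%:C%C * b ((rad n)%:C%C * cis t))).
  rewrite SE (circle_avgD (cS _ _ (cG h1) (cG h2)) (cS _ _ (cG h3) (cG h4))).
  by rewrite (circle_avgD (cG h1) (cG h2)) (circle_avgD (cG h3) (cG h4)).
have cFB : continuous (fun t => F t * B t ^+ 2).
  by move=> t; apply: cvgM; [exact: cF|exact: cB].
have RE : 4 * radial_mean p f (rad n) + p ^+ 2 * c ^+ 2 * Y n =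
    circle_avg (fun t => 4 * F t + p ^+ 2 * c ^+ 2 * (F t * B t ^+ 2)).
  rewrite circle_avgD; [|exact: cC|exact: cC].
  by rewrite !circle_avgZ.
rewrite /D QE RE.
apply: (@le_trans _ _ (circle_avg (fun t => e / M * (c ^+ 2 * W ^+ 2) * F t))).
  apply: circle_avg_diff => //; [by apply: cS; exact: cC|exact: cC|].
  move=> t _.
  have F0 : 0 <= F t by exact: powR_ge0.
  have bt : B t <= W by apply: bW; exact: rad_disc.
  have Bc : cmod (c%:C%C * b ((rad n)%:C%C * cis t)) = c * B t.
    by rewrite cmodM cmod_real// ltW.
  have cBd : c * B t <= d0.
    by apply: le_trans cd; rewrite ler_pM2l// (le_trans bt)// lerDl.
  have := Hd (c%:C%C * b ((rad n)%:C%C * cis t)); rewrite Bc => /(_ cBd) h.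
  have -> : F t * quad_powR p (c%:C%C * b ((rad n)%:C%C * cis t)) -
     (4 * F t + p ^+ 2 * c ^+ 2 * (F t * B t ^+ 2)) =
     F t * (quad_powR p (c%:C%C * b ((rad n)%:C%C * cis t)) - (4 + p ^+ 2 * (c * B t) ^+ 2)).
    by ring.
  rewrite normrM (ger0_norm F0) [X in _ <= X]mulrC ler_wpM2l//.
  apply: le_trans h _; rewrite ler_pM2l// exprMn ler_pM2l ?exprn_gt0//.
  by rewrite ler_pXn2r// nnegrE ?cmod_ge0.
rewrite circle_avgZ// -/(radial_mean p f (rad n)).
have rmH : radial_mean p f (rad n) <= H by apply: le_hardy_pow; exact: rad_itv.
have k0 : 0 <= e / M * (c ^+ 2 * W ^+ 2).
  by rewrite mulr_ge0 ?(ltW e10)// mulr_ge0// sqr_ge0.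
apply: le_trans (ler_wpM2l k0 rmH) _.
have -> : e / M * (c ^+ 2 * W ^+ 2) * H = e * c ^+ 2 * (W ^+ 2 * H / M).
  by field; rewrite gt_eqF.
apply: ler_piMr; first by rewrite mulr_ge0 ?sqr_ge0// ltW.
rewrite ler_pdivrMr// mul1r.
by rewrite /M ler_pM ?sqr_ge0// lerDl.
Qed.

(** The norms of all [f + a *: g] determine the coefficient of [c ^+ 2] in
    [second_variation]. *)
Lemma second_variation_unique f g f' g' b b' W W' X X' :
  (forall z, cmod z < 1 -> g z = b z * f z) ->
  (forall z, cmod z < 1 -> cmod (b z) <= W) ->
  (forall z, cmod z < 1 -> {for z, continuous b}) ->
  circle_avg (fun t => cmod (f ((rad n)%:C%C * cis t)) `^ p *
    cmod (b ((rad n)%:C%C * cis t)) ^+ 2) @[n --> \oo] --> X ->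
  (forall z, cmod z < 1 -> g' z = b' z * f' z) ->
  (forall z, cmod z < 1 -> cmod (b' z) <= W') ->
  (forall z, cmod z < 1 -> {for z, continuous b'}) ->
  circle_avg (fun t => cmod (f' ((rad n)%:C%C * cis t)) `^ p *
    cmod (b' ((rad n)%:C%C * cis t)) ^+ 2) @[n --> \oo] --> X' ->
  (forall a : C, hardy_pow p (f + a *: g) = hardy_pow p (f' + a *: g')) ->
  X = X'.
Proof.
move=> h1 h2 h3 h4 h1' h2' h3' h4' same.
have same0 : hardy_pow p f = hardy_pow p f'.
  by have := same 0; rewrite !scale0r !addr0.
have qq c : quad_hardy_pow f g c = quad_hardy_pow f' g' c.
  by rewrite /quad_hardy_pow -!scaleNr !same.
apply/eqP; rewrite -subr_eq0 -normr_le0; apply/ler_addgt0Pr => e e0.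
have p20 : 0 < p ^+ 2 := exprn_gt0 2 p0.
have e10 : 0 < p ^+ 2 * e / 2 := divr_gt0 (mulr_gt0 p20 e0) (ltr0Sn R 1).
have [d d0 Hd] := second_variation h1 h2 h3 h4 e10.
have [d' d'0 Hd'] := second_variation h1' h2' h3' h4' e10.
pose c := Num.min d d'.
have c0 : 0 < c by rewrite lt_min d0.
have := Hd c c0; have := Hd' c c0; rewrite !ge_min !lexx orbT /= => /(_ isT) k1 /(_ isT) k2.
move: k2; rewrite qq same0 distrC => k2.
rewrite add0r; have pc0 : 0 < p ^+ 2 * c ^+ 2 := mulr_gt0 p20 (exprn_gt0 2 c0).
rewrite -(ler_pM2l pc0) -[X in X * `|_|](gtr0_norm pc0) -normrM.
have -> : p ^+ 2 * c ^+ 2 * (X - X') =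
  (4 * hardy_pow p f' + p ^+ 2 * c ^+ 2 * X - quad_hardy_pow f' g' c) +
  (quad_hardy_pow f' g' c - (4 * hardy_pow p f' + p ^+ 2 * c ^+ 2 * X')) by ring.
apply: le_trans (ler_normD _ _) _; apply: le_trans (lerD k2 k1) _.
by rewrite le_eqVlt; apply/orP; left; apply/eqP; field.
Qed.

End norm_second_variation.

(** * Intertwining an isometry with a multiplication operator *)

Section forward.
Context {R : realType} {p : R} {p1 : 1 <= p}.
Local Notation C := R[i].
Implicit Types (phi psi : @disc_aut R) (b z w : C).

Let p0 : 0 < p. Proof. exact: lt_le_trans p1. Qed.

Lemma hardy_pow_circle (h : hardy p1) (k : C -> R) :
  (forall z, cmod z <= 1 -> {for z, continuous k}) ->
  (forall z, cmod z < 1 -> cmod (h z) `^ p = k z) ->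
  hardy_pow p h = circle_avg (fun t => k (cis t)).
Proof.
move=> ck hk; rewrite /hardy_pow.
have -> : (fun n => radial_mean p h (rad n)) =
    (fun n => circle_avg (fun t => k ((rad n)%:C%C * cis t))).
  by apply/funext => n; congr circle_avg; apply/funext => s; rewrite hk// rad_disc.
by apply: cvg_lim => //; exact: (@cvg_circle_avg R k ck).
Qed.

Lemma hardy_pow_weight (f g : hardy p1) (k : C -> R) :
  (forall z, cmod z <= 1 -> {for z, continuous k}) ->
  (forall z, cmod z = 1 -> k z = 1) ->
  (forall z, cmod z < 1 -> cmod (g z) `^ p = cmod (f z) `^ p * k z) ->
  hardy_pow p g = hardy_pow p f.
Proof.
move=> ck k1 gk; rewrite {1}/hardy_pow.
have -> : (fun n => radial_mean p g (rad n)) = (fun n => circle_avg (fun t =>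
    cmod (f ((rad n)%:C%C * cis t)) `^ p * k ((rad n)%:C%C * cis t))).
  by apply/funext => n; congr circle_avg; apply/funext => s; rewrite gk// rad_disc.
apply: cvg_lim => //.
exact: (@cvg_radial_weight R p f k p1 (@hardy_holo _ _ _ f) (hardy_fin f) ck k1).
Qed.

Lemma aut_continuous psi z : cmod z <= 1 -> {for z, continuous psi}.
Proof. by move=> z1; exact: derivable_continuous (derivable_aut z1). Qed.

(** The modulus of [psi] is 1 on the circle. *)
Lemma hardy_pow_mulop psi (f : hardy p1) :
  hardy_pow p (mulop p1 (aut_hinf psi) f) = hardy_pow p f.
Proof.
apply: (@hardy_pow_weight f _ (fun z => cmod (psi z) `^ p)) => z z1.
- exact: (continuous_comp (@aut_continuous psi z z1) (@continuous_cmod_powR R _ p0 _)).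
- by rewrite cmod_aut_eq1// powR1.
- by rewrite -[mulop _ _ _ z]/(psi z * f z) cmodM powRM ?cmod_ge0// mulrC.
Qed.

Lemma cvg_mulop_weight psi (f : hardy p1) :
  circle_avg (fun t => cmod (f ((rad n)%:C%C * cis t)) `^ p *
    cmod (psi ((rad n)%:C%C * cis t)) ^+ 2) @[n --> \oo] --> hardy_pow p f.
Proof.
apply: (@cvg_radial_weight R p f (fun z => cmod (psi z) ^+ 2) p1 (@hardy_holo _ _ _ f) (hardy_fin f)) => z z1.
  by apply: continuous_mulR; exact: (continuous_comp (@aut_continuous psi z z1) (@continuous_cmod R _)).
by rewrite cmod_aut_eq1// expr1n.
Qed.

(** Nonvanishing continuous functions on the closed disc for [cmod b < 1], numerous
    enough to separate the points of the circle by their moduli. *)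
Definition affine b : C -> C := fun z => 1 + b * z.

Lemma derivable_affine b z : derivable (affine b) z 1.
Proof.
apply: (derivableD (derivable_cst (1 : C) z 1)).
exact: derivableZ (@derivable_id C C z 1).
Qed.

Lemma cmod_affine_le b z : cmod b < 1 -> cmod z <= 1 -> cmod (affine b z) <= 2.
Proof.
move=> b1 z1; apply: le_trans (ler_cmodD _ _) _; rewrite cmod1 cmodM.
by rewrite (natrD _ 1 1) lerD2l mulr_ile1 ?cmod_ge0// ltW.
Qed.

Lemma cmod_affine_ge b z : cmod b < 1 -> cmod z <= 1 ->
  1 - cmod b <= cmod (affine b z).
Proof.
move=> b1 z1; rewrite lerBlDr.
have -> : 1 = cmod (affine b z + - (b * z)) by rewrite /affine addrK cmod1.
apply: le_trans (ler_cmodD _ _) _; rewrite lerD2l cmodN cmodM.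
by rewrite ler_piMr// cmod_ge0.
Qed.

Lemma affine_neq0 b z : cmod b < 1 -> cmod z <= 1 -> affine b z != 0.
Proof.
move=> b1 z1; rewrite -cmod_gt0.
by apply: lt_le_trans (cmod_affine_ge b1 z1); rewrite subr_gt0.
Qed.

Lemma affine_hardy_subproof b : cmod b < 1 -> cutoff (affine b) \in hardy_mem p1.
Proof.
move=> b1; apply: (@cutoff_hardy _ _ _ _ (2 `^ p)).
  by move=> z _; exact: derivable_affine.
move=> r /andP[r0 r1]; rewrite -(circle_avg_cst (2 `^ p)); apply: le_circle_avg.
- apply: continuous_radial => // t; exact/derivable_continuous/derivable_affine.
- by move=> t; exact: cvg_cst.
move=> t _; apply: ge0_ler_powR => //; rewrite ?nnegrE ?cmod_ge0 ?(ltW p0)//.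
by apply: cmod_affine_le => //; rewrite cmod_circle// ltW.
Qed.

Definition affine_hardy b (b1 : cmod b < 1) : hardy p1 := Hardy (affine_hardy_subproof b1).

(** The derivative of [phi] divided by its unimodular factor; see [aut_derive1]. *)
Definition aut_weight phi z : C :=
  (1 - `|aut_root phi| ^+ 2) / (1 - (aut_root phi)^*%C * z) ^+ 2.

Lemma derivable_aut_weight phi z : cmod z <= 1 -> derivable (aut_weight phi) z 1.
Proof.
move=> z1; have d0 := aut_den_closed phi z1.
have dd : derivable (fun w : C => 1 - (aut_root phi)^*%C * w) z 1.
  apply: derivableB; [exact: derivable_cst|apply: derivableZ; exact: (@derivable_id C C)].
have dd2 : derivable (fun w : C => (1 - (aut_root phi)^*%C * w) ^+ 2) z 1.
  exact: (derivable_mulC dd dd).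
have dv : derivable (fun w : C => ((1 - (aut_root phi)^*%C * w) ^+ 2)^-1) z 1.
  by apply: (@derivableV C C (fun w : C => (1 - (aut_root phi)^*%C * w) ^+ 2)); rewrite ?expf_neq0.
exact: derivable_MlC dv.
Qed.

Lemma cmod_croot q z : cmod (croot q z) = cmod z `^ q^-1.
Proof. by rewrite /croot cmodM cmod_cis mulr1 cmod_real// powR_ge0. Qed.

Lemma cmod_weighted_comp phi (f : C -> C) z : unit_disc z ->
  cmod (weighted_comp p phi f z) = cmod (aut_weight phi z) `^ p^-1 * cmod (f (phi z)).
Proof. by move=> Dz; rewrite /weighted_comp cmodM cmod_croot aut_derive1. Qed.

Lemma cmod_aut_weight_le phi z : cmod z <= 1 ->
  cmod (aut_weight phi z) <= cmod (1 - `|aut_root phi| ^+ 2) / (1 - cmod (aut_root phi)) ^+ 2.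
Proof.
move=> z1; rewrite /aut_weight cmodM cmodV cmodX ler_wpM2l ?cmod_ge0//.
have a1 : cmod (- (aut_root phi)^*%C) < 1 by rewrite cmodN cmodJ cmod_aut_root.
have := cmod_affine_ge a1 z1; rewrite /affine mulNr cmodN cmodJ => h.
have h0 : 0 < 1 - cmod (aut_root phi) by rewrite subr_gt0 cmod_aut_root.
rewrite lef_pV2 ?posrE ?exprn_gt0//; last exact: lt_le_trans h.
by rewrite ler_pXn2r// nnegrE ?cmod_ge0// ltW.
Qed.

Variables (psi psi' phi : @disc_aut R) (S : hardy p1 -> hardy p1).
Variable U : {linear hardy p1 -> hardy p1}.
Hypothesis Sdef : forall (f : hardy p1) z, unit_disc z ->
  S f z = psi' z * weighted_comp p phi f z.
Hypothesis Uiso : forall f, hardy_norm p (U f) = hardy_norm p f.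
Hypothesis intertwine : forall f, U (S f) = mulop p1 (aut_hinf psi) (U f).

(** The modulus of [S F / F] for [F = affine b], continuous up to the boundary. *)
Let ratio b z : R :=
  cmod (psi' z * affine b (phi z) / affine b z) * cmod (aut_weight phi z) `^ p^-1.

Let ratio_ge0 b z : 0 <= ratio b z.
Proof. by rewrite mulr_ge0 ?cmod_ge0 ?powR_ge0. Qed.

Let continuous_ratio b z : cmod b < 1 -> cmod z <= 1 -> {for z, continuous (ratio b)}.
Proof.
move=> b1 z1.
have d1 : derivable (fun w => affine b (phi w)) z 1.
  exact: (derivable_compC (derivable_aut (phi := phi) z1) (@derivable_affine b (phi z))).
have d2 : derivable (fun w => (affine b w)^-1) z 1.
  by apply: (@derivableV C C (affine b)); [exact: affine_neq0|exact: derivable_affine].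
have d3 := derivable_mulC (derivable_mulC (derivable_aut (phi := psi') z1) d1) d2.
have pi0 : 0 < p^-1 by rewrite invr_gt0.
apply: continuous_mulR.
  exact: (continuous_comp (derivable_continuous d3) (@continuous_cmod R _)).
exact: (continuous_comp (derivable_continuous (derivable_aut_weight (phi := phi) z1))
  (@continuous_cmod_powR R _ pi0 _)).
Qed.

Let S_affine b (b1 : cmod b < 1) z : cmod z < 1 ->
  cmod (S (affine_hardy b1) z) = ratio b z * cmod (affine b z).
Proof.
move=> z1; have Dz : unit_disc z by rewrite unit_discE.
have Dphi := aut_disc phi Dz.
rewrite Sdef// cmodM cmod_weighted_comp//= cutoff_in -?unit_discE// /ratio.
have a0 := affine_neq0 b1 (ltW z1).
rewrite mulrAC -cmodM divfK// cmodM; ring.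
Qed.

Let ratio_le b : cmod b < 1 -> exists W, forall z, cmod z <= 1 -> ratio b z <= W.
Proof.
move=> b1.
exists (2 / (1 - cmod b) * (cmod (1 - `|aut_root phi| ^+ 2) / (1 - cmod (aut_root phi)) ^+ 2) `^ p^-1).
move=> z z1; rewrite /ratio ler_pM ?cmod_ge0 ?powR_ge0//.
  rewrite (cmodM (psi' z * _)) (cmodM (psi' z)) cmodV ler_pM ?invr_ge0 ?mulr_ge0 ?cmod_ge0//.
    rewrite -[2]mul1r ler_pM ?cmod_ge0 ?cmod_aut_le1//.
    by apply: cmod_affine_le => //; exact: cmod_aut_le1.
  have h0 : 0 < 1 - cmod b by rewrite subr_gt0.
  have h := cmod_affine_ge b1 z1.
  by rewrite lef_pV2 ?posrE//; exact: lt_le_trans h.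
apply: ge0_ler_powR; rewrite ?nnegrE ?invr_ge0 ?(ltW p0) ?cmod_ge0 ?divr_ge0 ?sqr_ge0 ?cmod_ge0//.
exact: cmod_aut_weight_le.
Qed.

Let continuous_A b z : {for z, continuous (fun z => cmod (affine b z) `^ p)}.
Proof.
exact: (continuous_comp (derivable_continuous (@derivable_affine b z)) (@continuous_cmod_powR R _ p0 _)).
Qed.

Let continuous_A_ratio b z : cmod b < 1 -> cmod z <= 1 ->
  {for z, continuous (fun z => cmod (affine b z) `^ p * ratio b z `^ p)}.
Proof.
move=> b1 z1; apply: continuous_mulR; first exact: continuous_A.
have -> : (fun z => ratio b z `^ p) = (fun x => `|x| `^ p) \o ratio b.
  by apply/funext => w; rewrite /= ger0_norm.
exact: (continuous_comp (continuous_ratio b1 z1) (@continuous_norm_powR R _ p0 _)).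
Qed.

Let continuous_A_ratio2 b z : cmod b < 1 -> cmod z <= 1 ->
  {for z, continuous (fun z => cmod (affine b z) `^ p * ratio b z ^+ 2)}.
Proof.
move=> b1 z1; apply: continuous_mulR; first exact: continuous_A.
by apply: continuous_mulR; exact: continuous_ratio.
Qed.

Let pow_affine b (b1 : cmod b < 1) :
  hardy_pow p (affine_hardy b1) = circle_avg (fun t => cmod (affine b (cis t)) `^ p).
Proof.
apply: (@hardy_pow_circle _ _ (fun z _ => @continuous_A b z)) => z z1 /=.
by rewrite cutoff_in.
Qed.

Let pow_S_affine b (b1 : cmod b < 1) : hardy_pow p (S (affine_hardy b1)) =
  circle_avg (fun t => cmod (affine b (cis t)) `^ p * ratio b (cis t) `^ p).
Proof.
apply: (@hardy_pow_circle _ _ (fun z => @continuous_A_ratio b z b1)) => z z1.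
rewrite (S_affine b1 z1) (powRM p (ratio_ge0 b z) (cmod_ge0 _)).
exact: mulrC.
Qed.

Let pow_U f : hardy_pow p (U f) = hardy_pow p f.
Proof. by apply: eq_hardy_pow; exact: Uiso. Qed.

Let pow_S f : hardy_pow p (S f) = hardy_pow p f.
Proof. by rewrite -(pow_U (S f)) intertwine hardy_pow_mulop pow_U. Qed.

(** For [F = affine b], the functions [F + a S F] and [U F + a psi (U F)] have the same
    norm for every [a], hence the pairs have the same second variation. As [|psi| = 1] on
    the circle, that of the second pair is the norm of [U F], which is that of [F]. *)
Let variation_S b (b1 : cmod b < 1) :
  circle_avg (fun t => cmod (affine b (cis t)) `^ p * ratio b (cis t) ^+ 2) =
  hardy_pow p (affine_hardy b1).
Proof.
have FE z : cmod z < 1 -> affine_hardy b1 z = affine b z by exact: cutoff_in.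
have same (a : C) : hardy_pow p (affine_hardy b1 + a *: S (affine_hardy b1)) =
    hardy_pow p (U (affine_hardy b1) + a *: mulop p1 (aut_hinf psi) (U (affine_hardy b1))).
  by rewrite -[LHS]pow_U linearD linearZ /= intertwine.
have cvgU := @cvg_mulop_weight psi (U (affine_hardy b1)).
rewrite pow_U in cvgU.
have SE := @S_affine b b1.
have [W hW] := ratio_le b1.
have cAy2 := fun z => @continuous_A_ratio2 b z b1.
have Fz z : cmod z < 1 -> affine_hardy b1 z != 0.
  by move=> z1; rewrite FE// affine_neq0// ltW.
move: (hardy_pow p (affine_hardy b1)) cvgU => X' cvgU.
move: (affine_hardy b1) FE SE Fz same cvgU => F FE SE Fz same cvgU.
move: (S F) SE same => G GE same.
move: (U F) same cvgU => f same cvgU.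
have ratioE z : cmod z < 1 -> cmod (G z / F z) = ratio b z.
  move=> z1; rewrite cmodM cmodV (GE z z1) FE// mulfK// cmod_eq0 -FE//.
  exact: Fz.
apply: (@second_variation_unique R p p1 F G f (mulop p1 (aut_hinf psi) f)
  (fun z => G z / F z) psi W 1 _ _ _ _ _ _ _ _ _ cvgU same).
- by move=> z z1; rewrite divfK// Fz.
- by move=> z z1; rewrite ratioE// hW// ltW.
- move=> z z1; have Dz : unit_disc z by rewrite unit_discE.
  apply: derivable_continuous; apply: derivable_mulC; first exact: hardy_holo.
  by apply: (@derivableV C C F); [exact: Fz|exact: hardy_holo].
- have -> : (fun n => circle_avg (fun t => cmod (F ((rad n)%:C%C * cis t)) `^ p *
      cmod (G ((rad n)%:C%C * cis t) / F ((rad n)%:C%C * cis t)) ^+ 2)) =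
    (fun n => circle_avg (fun t => cmod (affine b ((rad n)%:C%C * cis t)) `^ p *
      ratio b ((rad n)%:C%C * cis t) ^+ 2)).
    apply/funext => n; congr circle_avg; apply/funext => s.
    by rewrite ratioE ?rad_disc// FE// rad_disc.
  exact: (@cvg_circle_avg R _ cAy2).
- by [].
- by move=> z /ltW; exact: cmod_aut_le1.
- by move=> z /ltW; exact: aut_continuous.
Qed.

(** With respect to the density [|affine b|^p] on the circle, the moments of order 0, 2
    and [p] of [ratio b] agree: the first two by [variation_S], the first and the last
    because [S] is an isometry. As [p] is not 2, [eq_moments_eq1] applies. *)
Lemma boundary_ratio b t : p != 2 -> cmod b < 1 -> 0 < t < 2 * pi ->
  cmod (aut_weight phi (cis t)) `^ p^-1 * cmod (affine b (phi (cis t))) =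
  cmod (affine b (cis t)).
Proof.
move=> p2 b1 t2.
have eF := pow_affine b1; have eG := pow_S_affine b1; have eV := variation_S b1.
rewrite pow_S eF in eG; rewrite eF in eV; clear eF.
have rb := ratio_ge0 b.
pose q := p / 2.
have q2 : 2 * q = p by rewrite /q mulrC divfK.
have q0 : 0 < q by rewrite divr_gt0.
have q1 : q != 1 by apply: contra_neq p2 => h; rewrite -q2 h mulr1.
pose A s := cmod (affine b (cis s)) `^ p.
pose y s := ratio b (cis s).
have onT (k : C -> R) : (forall z, cmod z <= 1 -> {for z, continuous k}) ->
    continuous (fun t => k (cis t)).
  move=> ck s; apply: (@continuous_comp _ _ _ (fun t => cis t : C) k).
    exact: continuous_cis.
  by apply: ck; rewrite cmod_cis.
have c1 : continuous A := onT _ (fun z _ => @continuous_A b z).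
have c2 : continuous (fun t => A t * y t ^+ 2) := onT _ (fun z => @continuous_A_ratio2 b z b1).
have c3 : continuous (fun t => A t * y t `^ p) := onT _ (fun z => @continuous_A_ratio b z b1).
have e3 : circle_avg A = circle_avg (fun t => A t * y t `^ p) := eG.
have e2 : circle_avg (fun t => A t * y t ^+ 2) = circle_avg A := eV.
have y1 : y t = 1.
  have A0 : A t != 0.
    rewrite /A gt_eqF// powR_gt0// cmod_gt0; apply: affine_neq0 => //.
    by rewrite cmod_cis.
  apply: (@eq_moments_eq1 R q A y t q0 q1 _ _ c1 c2 _ _ _ t2 A0); rewrite ?q2//.
  - by move=> s; exact: powR_ge0.
  - by move=> s; exact: rb.
have a0 : affine b (cis t) != 0 by apply: affine_neq0 => //; rewrite cmod_cis.
move: y1; rewrite /y /ratio (cmodM (psi' _ * _)) (cmodM (psi' _)) cmodV cmod_aut_eq1 ?cmod_cis// mul1r.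
rewrite mulrAC => /(congr1 ( *%R^~ (cmod (affine b (cis t))))).
by rewrite divfK ?cmod_eq0// mul1r mulrC.
Qed.

End forward.

Section boundary_identity.
Context {R : realType}.
Local Notation C := R[i].
Implicit Types (phi : @disc_aut R) (b z w : C) (p t : R).

Lemma sqr_cmod_affine b z : cmod (affine b z) ^+ 2 =
  1 + 2 * complex.Re (b * z) + cmod b ^+ 2 * cmod z ^+ 2.
Proof.
rewrite -exprMn -cmodM !sqr_cmod /affine ReD ImD /=; ring.
Qed.

Lemma cmod_affine_inj b z w : cmod z = 1 -> cmod w = 1 ->
  cmod (affine b z) = cmod (affine b w) -> complex.Re (b * z) = complex.Re (b * w).
Proof.
move=> z1 w1 /(congr1 (fun x => x ^+ 2)); rewrite !sqr_cmod_affine z1 w1.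
lra.
Qed.

(** The case [b = 0] shows that the weight is 1 on the circle. Then [b = 1 / 2] and
    [b = i / 2] give the real and imaginary parts of [phi z = z] for [z] on the
    circle, and the fixed points [i], [-1], [- i] determine the two parameters. *)
Lemma aut_identity p phi :
  (forall b t, cmod b < 1 -> 0 < t < 2 * pi ->
    cmod (aut_weight phi (cis t)) `^ p^-1 * cmod (affine b (phi (cis t))) =
    cmod (affine b (cis t))) ->
  aut_scal phi = 1 /\ aut_root phi = 0.
Proof.
move=> H.
have half0 : 0 <= (1 / 2 : R) by rewrite divr_ge0.
have half1 : (1 / 2 : R) < 1 by rewrite ltr_pdivrMr// mul1r ltr1n.
pose h : C := (1 / 2)%:C%C.
have ch : cmod h < 1 by rewrite cmod_real.
have chi : cmod ('i%C * h) < 1.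
  by rewrite cmodM cmod_real// /cmod normc_def /= expr0n expr1n add0r sqrtr1 mul1r.
have fix_pt t : 0 < t < 2 * pi -> phi (cis t) = cis t.
  move=> t2.
  have w1 : cmod (aut_weight phi (cis t)) `^ p^-1 = 1.
    have := H 0 t; rewrite cmod0 ltr01 /affine !mul0r !addr0 cmod1 mulr1.
    by apply.
  have pt : cmod (phi (cis t)) = 1 by apply: cmod_aut_eq1; rewrite cmod_cis.
  have e b : cmod b < 1 -> complex.Re (b * phi (cis t)) = complex.Re (b * cis t).
    move=> b1; apply: cmod_affine_inj => //; first exact: cmod_cis.
    by have := H b t b1 t2; rewrite w1 mul1r.
  have := e _ ch; have := e _ chi.
  clear pt; move: (cis t) (phi (cis t)) => [x' y'] [x y].
  rewrite !ReM !ImM /= => e1 e2; apply/eqP; rewrite eq_complex /=.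
  by apply/andP; split; apply/eqP; lra.
have pi0 := pi_gt0 R.
have i1 : cis (pi / 2) = 'i%C :> C by rewrite /cis cos_pihalf sin_pihalf.
have i2 : cis pi = -1 :> C.
  by apply/eqP; rewrite eq_complex /= cospi sinpi oppr0 !eqxx.
have i3 : cis (pi + pi / 2) = - 'i%C :> C by rewrite cisD i1 i2 mulN1r.
have f1 : phi 'i%C = 'i%C by rewrite -i1; apply: fix_pt; apply/andP; split; lra.
have f2 : phi (-1) = -1 by rewrite -i2; apply: fix_pt; apply/andP; split; lra.
have f3 : phi (- 'i%C) = - 'i%C by rewrite -i3; apply: fix_pt; apply/andP; split; lra.
have cleared z : cmod z = 1 -> phi z = z ->
    aut_scal phi * (z - aut_root phi) = z * (1 - (aut_root phi)^*%C * z).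
  move=> z1 pz; rewrite -[X in _ = X * _]pz /aut_fun divfK//.
  by apply: aut_den_closed; rewrite z1.
have ci : cmod ('i%C : C) = 1 by rewrite -i1 cmod_cis.
have g1 := cleared _ ci f1.
have g2 := cleared (-1) (etrans (cmodN _) cmod1) f2.
have g3 := cleared (- 'i%C) (etrans (cmodN _) ci) f3.
move: g1 g2 g3; move: (aut_scal phi) (aut_root phi) => [l m] [x y].
move=> /eqP + /eqP + /eqP; rewrite !eq_complex /=.
move=> /andP[/eqP g1 /eqP g1'] /andP[/eqP g2 /eqP g2'] /andP[/eqP g3 /eqP g3'].
have l1 : l = 1 by lra.
have m0 : m = 0 by lra.
subst l m.
have x0 : x = 0 by lra.
have y0 : y = 0 by lra.
by rewrite x0 y0.
Qed.

End boundary_identity.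

(** * Change of variable on the circle *)

Section circle_change_of_variable.
Context {R : realType}.
Local Notation C := R[i].
Implicit Types (phi psi : @disc_aut R) (z w : C) (t : R).

Lemma cmod_aut_weight phi z : cmod z <= 1 -> cmod (aut_weight phi z) =
  (1 - cmod (aut_root phi) ^+ 2) / cmod (1 - (aut_root phi)^*%C * z) ^+ 2.
Proof.
move=> z1; rewrite /aut_weight cmodM cmodV cmodX; congr (_ / _).
rewrite cmodE -rmorphXn /= -(rmorph1 (real_complex R)) -rmorphB /= cmod_real//.
by rewrite subr_ge0 expr_le1 ?cmod_ge0// ltW// cmod_aut_root.
Qed.

Lemma aut_root_gap phi : 0 < 1 - cmod (aut_root phi) ^+ 2.
Proof. by rewrite subr_gt0 expr_lt1 ?cmod_ge0// cmod_aut_root. Qed.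

Lemma Re_aut_den_gt0 phi z : cmod z <= 1 ->
  0 < complex.Re (1 - (aut_root phi)^*%C * z).
Proof.
move=> z1; rewrite ReD ReN /= subr_gt0.
apply: le_lt_trans (ler_norm _) _; apply: le_lt_trans (norm_Re_le_cmod _) _.
rewrite cmodM cmodJ; apply: le_lt_trans (cmod_aut_root phi).
by rewrite ler_piMr// cmod_ge0.
Qed.

Let is_derive_atan_quot (X Y : R -> R) (dX dY t : R) : X t != 0 ->
  is_derive t 1 X dX -> is_derive t 1 Y dY ->
  is_derive t 1 (fun s => atan (Y s / X s))
    ((dY * X t - Y t * dX) / (X t ^+ 2 + Y t ^+ 2)).
Proof.
move=> X0 hX hY.
have N0 : X t ^+ 2 + Y t ^+ 2 != 0.
  by rewrite gt_eqF// ltr_pwDl ?sqr_ge0// exprn_even_gt0.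
have hV : is_derive t 1 (fun s => (X s)^-1) (- (X t) ^- 2 *: dX).
  apply: DeriveDef; first by apply: derivableV; [|case: hX].
  by rewrite deriveV// derive_val.
have hQ := is_deriveM hY hV.
have hA := is_derive1_comp (is_derive1_atan ((Y * (fun s => (X s)^-1)) t)) hQ.
apply: (is_derive_eq hA).
rewrite -[(Y * _) t]/(Y t * (X t)^-1) -![_ *: _]/(_ * _).
field.
by rewrite X0 N0.
Qed.

(** With [l] the angle of [aut_scal phi] and [v = 1 - conj a * e^(i t)], one has
    [phi (e^(i t)) = e^(i (t + l)) * conj v / v], which is unimodular of angle
    [t + l - 2 arg v]. *)
Lemma aut_circle_angle phi : exists theta : R -> R,
  [/\ forall t, is_derive t 1 theta (cmod (aut_weight phi (cis t))),
      theta (2 * pi) = theta 0 + 2 * pi &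
      forall t, phi (cis t) = cis (theta t)].
Proof.
have [l _ lE] := circle_polar (cmod_aut_scal phi).
pose a := aut_root phi; pose al := complex.Re a; pose be := complex.Im a.
pose X t := 1 - (al * cos t + be * sin t).
pose Y t := be * cos t - al * sin t.
have vE t : 1 - a^*%C * cis t = (X t +i* Y t)%C.
  rewrite /X /Y /al /be; case: (a) => x y; apply/eqP.
  by rewrite eq_complex /=; apply/andP; split; apply/eqP; ring.
have X0 t : 0 < X t.
  have := @Re_aut_den_gt0 phi (cis t); rewrite cmod_cis lexx => /(_ isT).
  by rewrite -/a vE.
have cX t : is_derive t 1 X (al * sin t - be * cos t).
  have h := is_deriveB (is_derive_cst (1 : R) t 1)
    (is_deriveD (is_deriveZ al (is_derive_cos t)) (is_deriveZ be (is_derive_sin t))).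
  by apply: (is_derive_eq h); rewrite -![_ *: _]/(_ * _); ring.
have cY t : is_derive t 1 Y (- be * sin t - al * cos t).
  have h := is_deriveB (is_deriveZ be (is_derive_cos t)) (is_deriveZ al (is_derive_sin t)).
  by apply: (is_derive_eq h); rewrite -![_ *: _]/(_ * _); ring.
exists (fun t => t + l - 2 * atan (Y t / X t)); split.
- move=> t; have hA := is_derive_atan_quot (lt0r_neq0 (X0 t)) (cX t) (cY t).
  have h := is_deriveB (is_deriveD (is_derive_id t (1 : R)) (is_derive_cst l t 1))
    (is_deriveZ 2 hA).
  apply: (is_derive_eq h); rewrite -![_ *: _]/(_ * _).
  rewrite cmod_aut_weight ?cmod_cis// -/a vE !sqr_cmod /= -/al -/be addr0.
  have N0 : X t ^+ 2 + Y t ^+ 2 != 0.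
    by rewrite gt_eqF// ltr_pwDl ?sqr_ge0// exprn_gt0.
  apply: (mulIf N0); rewrite divfK// mulrBl mul1r -!mulrA mulVf// mulr1.
  rewrite /X /Y; have := cos2Dsin2 t; move: (cos t) (sin t) => c s cs.
  have -> : al ^+ 2 + be ^+ 2 = (al ^+ 2 + be ^+ 2) * (c ^+ 2 + s ^+ 2) by rewrite cs mulr1.
  ring.
- by rewrite /X /Y !(mulr_natl pi) cos2pi sin2pi cos0 sin0; ring.
- move=> t.
  have Rv : 0 < complex.Re (X t +i* Y t)%C := X0 t.
  have := cmod_cis_atan Rv => /=.
  set A := atan _; set m := cmod _ => mA.
  have m0 : m != 0 by rewrite cmod_eq0; exact: Re_gt0_neq0.
  have v0 : (X t +i* Y t)%C != 0 by exact: Re_gt0_neq0.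
  have unitA : (cis A : C) != 0 by rewrite -cmod_gt0 cmod_cis.
  have mc : m%:C%C != 0 by rewrite -cmod_gt0 cmod_real ?cmod_ge0// lt_neqAle eq_sym m0 cmod_ge0.
  have conjv : ((X t +i* Y t)^*)%C = m%:C%C * cis (- A).
    by rewrite -mA rmorphM /= /cis cosN sinN; congr (_ * _); apply/eqP; rewrite eq_complex /= oppr0 !eqxx.
  rewrite /aut_fun -/a vE lE.
  have -> : cis t - a = cis t * ((X t +i* Y t)^*)%C.
    rewrite -vE rmorphB rmorph1 rmorphM /= conjcK mulrBr mulr1.
    by rewrite mulrCA -sqr_cmodC cmod_cis expr1n mulr1.
  rewrite conjv -mA; clearbody m.
  have -> : t + l - 2 * A = l + t + - A + - A by ring.
  rewrite !cisD.
  have e : cis A * cis (- A) = 1 :> C by rewrite -cisD subrr cis0.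
  apply: (mulIf (mulf_neq0 mc unitA)); rewrite divfK ?mulf_neq0//.
  transitivity (cis l * (cis t * (m%:C%C * cis (- A))) * (cis A * cis (- A)) : C).
    by rewrite e mulr1.
  ring.
Qed.

(** On the circle, [phi] is a change of angle whose speed is the modulus of its
    derivative. *)
Lemma circle_avg_aut phi (k : C -> R) :
  (forall z, cmod z = 1 -> {for z, continuous k}) ->
  circle_avg (fun t => cmod (aut_weight phi (cis t)) * k (phi (cis t))) =
  circle_avg (fun t => k (cis t)).
Proof.
move=> ck; have [theta [dth th2 thE]] := aut_circle_angle phi.
rewrite -(@circle_avg_subst R (fun t => k (cis t)) theta
  (fun t => cmod (aut_weight phi (cis t))) _ _ _ dth th2).
- by congr circle_avg; apply/funext => t; rewrite thE.
- move=> t; apply: (@continuous_comp _ _ _ (fun t => cis t : C) k).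
    exact: continuous_cis.
  by apply: ck; rewrite cmod_cis.
- by move=> t; rewrite cis_periodic.
- move=> t.
  apply: (@continuous_comp _ _ _ (fun t => aut_weight phi (cis t)) (@cmod R)); last exact: continuous_cmod.
  apply: (@continuous_comp _ _ _ (fun t => cis t : C) (aut_weight phi)).
    exact: continuous_cis.
  by apply: derivable_continuous; apply: derivable_aut_weight; rewrite cmod_cis.
Qed.

End circle_change_of_variable.

(** * Surjective isometries by weighted composition *)

Section boundary_mean.
Context {R : realType}.
Local Notation C := R[i].
Implicit Types (f : C -> C) (p r : R).

(** The means increase with the radius and tend to the boundary mean. *)
Lemma radial_mean_le_boundary p f r : 1 <= p ->
  (forall z, cmod z <= 1 -> derivable f z 1) -> 0 <= r < 1 ->
  radial_mean p f r <= circle_avg (fun t => cmod (f (cis t)) `^ p).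
Proof.
move=> p1 df /andP[r0 r1]; have p0 : 0 < p by exact: lt_le_trans p1.
have hol : holomorphic_on unit_disc f.
  by move=> z; rewrite unit_discE => z1; apply/df/ltW.
have ck z : cmod z <= 1 -> {for z, continuous (fun z => cmod (f z) `^ p)}.
  move=> z1.
  exact: (continuous_comp (derivable_continuous (df z z1)) (@continuous_cmod_powR R _ p0 _)).
have [m rm] := rad_gt r1.
apply: (cvgr_to_ge (cvg_circle_avg ck)).
apply: filterS (nbhs_infty_ge m) => k mk.
have /andP[k0 k1] := @rad_itv R k.
apply: (radial_mean_homo p1 hol r0 _ k1).
by apply: le_trans rm _; exact: rad_homo.
Qed.

End boundary_mean.

Section weighted_composition.
Context {R : realType} {p : R} {p1 : 1 <= p}.
Local Notation C := R[i].
Implicit Types (phi psi : @disc_aut R) (z w : C) (f g : hardy p1) (r t e : R).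

Let p0 : 0 < p. Proof. exact: lt_le_trans p1. Qed.

Definition aut_den phi z : C := 1 - (aut_root phi)^*%C * z.

(** A holomorphic branch of the power [1 / p] of [aut_weight phi]: the denominator has
    positive real part, hence a logarithm. *)
Definition aut_root_weight phi z : C :=
  ((1 - cmod (aut_root phi) ^+ 2) `^ p^-1)%:C%C *
  cexp (- (2 / p)%:C%C * clog (aut_den phi z)).

Lemma cmod_aut_root_weight phi z : cmod z <= 1 ->
  cmod (aut_root_weight phi z) `^ p = cmod (aut_weight phi z).
Proof.
move=> z1; have g0 := aut_root_gap phi; have v0 := Re_aut_den_gt0 phi z1.
have c0 : 0 < cmod (aut_den phi z) by rewrite cmod_gt0; exact: Re_gt0_neq0.
rewrite /aut_root_weight cmodM cmod_cexp cmod_real ?powR_ge0//.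
rewrite powRM ?powR_ge0 ?expR_ge0// -powRrM mulVf ?gt_eqF// powRr1 ?(ltW g0)//.
rewrite cmod_aut_weight//; congr (_ * _).
have -> : complex.Re (- (2 / p)%:C%C * clog (aut_den phi z)) =
    - (2 / p * ln (cmod (aut_den phi z))) by rewrite mulNr ReN ReM /= mul0r subr0.
rewrite /powR gt_eqF ?expR_gt0// expRK -/(aut_den phi z).
have -> : p * - (2 / p * ln (cmod (aut_den phi z))) = - (ln (cmod (aut_den phi z)) *+ 2).
  by rewrite -mulr_natl; field; rewrite gt_eqF.
by rewrite expRN -mulr_natl mulrC expRM_natr lnK.
Qed.

Lemma derivable_aut_root_weight phi z : cmod z <= 1 ->
  derivable (aut_root_weight phi) z 1.
Proof.
move=> z1; have v0 := Re_aut_den_gt0 phi z1.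
apply: derivable_MlC.
have dd : derivable (aut_den phi) z 1.
  apply: derivableB; [exact: derivable_cst|apply: derivableZ; exact: (@derivable_id C C)].
have dl : derivable clog (aut_den phi z) 1 by have [] := is_derive_clog v0.
have dm : derivable (fun w => - (2 / p)%:C%C * clog (aut_den phi w)) z 1.
  apply: derivable_MlC; exact: (derivable_compC dd dl).
apply: (derivable_compC dm).
by have [] := is_derive_cexp (- (2 / p)%:C%C * clog (aut_den phi z)).
Qed.

(** The logarithms of the two denominators differ by a sign and the real constant
    [ln (1 - |a|^2)], which the constant factors of the weights compensate. *)
Lemma aut_root_weight_mul phi psi z w : cmod (aut_root phi) = cmod (aut_root psi) ->
  cmod w <= 1 ->
  aut_den phi z = (1 - cmod (aut_root phi) ^+ 2)%:C%C / aut_den psi w ->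
  aut_root_weight phi z * aut_root_weight psi w = 1.
Proof.
move=> ab w1 zw; have g0 := aut_root_gap phi; have v0 := Re_aut_den_gt0 psi w1.
rewrite /aut_root_weight zw clogV// -ab; set c := 1 - _ in g0 *.
have -> a b : (c `^ p^-1)%:C%C * cexp a * ((c `^ p^-1)%:C%C * cexp b) =
    (c `^ p^-1 * c `^ p^-1)%:C%C * cexp (a + b) :> C.
  by rewrite cexpD rmorphM /=; ring.
have -> : - (2 / p)%:C%C * ((ln c)%:C%C - clog (aut_den psi w)) +
    - (2 / p)%:C%C * clog (aut_den psi w) = (- (2 / p * ln c))%:C%C :> C.
  by rewrite rmorphN rmorphM /=; ring.
rewrite -powRD; last by apply/implyP => _; rewrite gt_eqF.
rewrite /cexp /= cis0 mulr1 -rmorphM /= /powR gt_eqF// -expRD.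
rewrite (_ : _ + _ = 0) ?expR0//.
by field; rewrite gt_eqF.
Qed.

Definition weighted phi (f : C -> C) z : C := aut_root_weight phi z * f (phi z).

Lemma holomorphic_weighted phi (f : C -> C) : holomorphic_on unit_disc f ->
  holomorphic_on unit_disc (weighted phi f).
Proof.
move=> hf z; rewrite unit_discE => z1.
apply: derivable_mulC; first exact: derivable_aut_root_weight (ltW z1).
apply: (derivable_compC (derivable_aut (phi := phi) (ltW z1))).
by apply: hf; apply: aut_disc; rewrite unit_discE.
Qed.

(** The dilated function is holomorphic across the boundary of the disc, where the
    change of angle [circle_avg_aut] turns the weighted mean into a mean of [f] over
    the circle of radius [rad n]. *)
Lemma weighted_dilation_mean phi f n r : 0 <= r < 1 ->
  radial_mean p (weighted phi (fun z => f ((rad n)%:C%C * z))) r <= hardy_pow p f.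
Proof.
move=> r01; have /andP[s0 s1] := @rad_itv R n.
set s := rad n in s0 s1 *; set h := weighted phi _.
have df z : cmod z <= 1 -> derivable (fun z => f (s%:C%C * z)) z 1.
  move=> z1; have dm := derivable_MlC (a := s%:C%C) (@derivable_id C C z 1).
  apply: (derivable_compC dm); apply: hardy_holo; rewrite unit_discE cmodM cmod_real//.
  by apply: le_lt_trans s1; rewrite ler_piMr.
have dh z : cmod z <= 1 -> derivable h z 1.
  move=> z1; apply: derivable_mulC; first exact: derivable_aut_root_weight.
  exact: (derivable_compC (f := fun z => f (s%:C%C * z)) (derivable_aut (phi := phi) z1)
    (df _ (cmod_aut_le1 phi z1))).
apply: le_trans (radial_mean_le_boundary p1 dh r01) _.
have -> : circle_avg (fun t => cmod (h (cis t)) `^ p) = radial_mean p f s.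
  rewrite /radial_mean -(circle_avg_aut phi (k := fun z => cmod (f (s%:C%C * z)) `^ p)).
    congr circle_avg; apply/funext => t.
    rewrite /h /weighted cmodM powRM ?cmod_ge0// cmod_aut_root_weight ?cmod_cis//.
  move=> z z1; have z1' : cmod z <= 1 by rewrite z1.
  exact: (continuous_comp (derivable_continuous (df z z1')) (@continuous_cmod_powR R _ p0 _)).
exact: le_hardy_pow (rad_itv n).
Qed.

(** On a fixed circle, the dilated functions converge uniformly to [f] composed with
    [phi] as the factor [rad n] tends to 1. *)
Lemma weighted_mean phi f r : 0 <= r < 1 ->
  radial_mean p (weighted phi f) r <= hardy_pow p f.
Proof.
move=> r01; have /andP[r0 r1] := r01.
pose gamma t := phi (r%:C%C * cis t).
have rc t : cmod (r%:C%C * cis t : C) <= 1 by rewrite cmod_circle// ltW.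
have g1 t : cmod (gamma t) < 1.
  by rewrite -unit_discE; apply: aut_disc; rewrite unit_discE cmod_circle.
have cgamma : continuous gamma.
  move=> t; apply: (@continuous_comp _ _ _ (fun t => r%:C%C * cis t : C) phi).
    exact: continuous_circle_path.
  exact: aut_continuous.
pose k z := cmod (f z) `^ p.
have ck z : cmod z < 1 -> {for z, continuous k}.
  move=> z1; have cf := holomorphic_continuous (@hardy_holo _ _ _ f) z1.
  exact: (continuous_comp cf (@continuous_cmod_powR R _ p0 _)).
pose w t := cmod (aut_weight phi (r%:C%C * cis t)).
have cw : continuous w.
  move=> t; apply: (@continuous_comp _ _ _ (fun t => aut_weight phi (r%:C%C * cis t)) (@cmod R)); last exact: continuous_cmod.
  apply: (@continuous_comp _ _ _ (fun t => r%:C%C * cis t : C) (aut_weight phi)).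
    exact: continuous_circle_path.
  exact/derivable_continuous/derivable_aut_weight.
set B := cmod (1 - `|aut_root phi| ^+ 2) / (1 - cmod (aut_root phi)) ^+ 2.
have wB t : w t <= B by exact: cmod_aut_weight_le.
have B0 : 0 <= B by apply: le_trans (wB 0); exact: cmod_ge0.
have meanE (h : C -> C) : radial_mean p (weighted phi h) r =
    circle_avg (fun t => w t * cmod (h (gamma t)) `^ p).
  congr circle_avg; apply/funext => t.
  by rewrite /weighted cmodM powRM ?cmod_ge0// cmod_aut_root_weight.
have dil n z : cmod z < 1 -> cmod ((rad n)%:C%C * z) < 1.
  move=> z1; have /andP[s0 s1] := @rad_itv R n.
  by rewrite cmodM cmod_real// mulr_ilt1// ?cmod_ge0.
apply/ler_addgt0Pr => e e0.
have e10 : 0 < e / (B + 1) by rewrite divr_gt0// ltr_wpDl.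
have [N HN] := cvg_path_unif cgamma (fun t => ck _ (g1 t)) e10.
apply: le_trans (lerD (weighted_dilation_mean phi f N r01) (lexx e)).
rewrite !meanE -lerBlDl; apply: le_trans (ler_norm _) _.
apply: (@le_trans _ _ (circle_avg (fun _ => e))); last by rewrite circle_avg_cst.
apply: circle_avg_diff.
- move=> t; apply: cvgM; first exact: cw.
  exact: (@continuous_comp _ _ _ gamma k t (cgamma t) (ck _ (g1 t))).
- move=> t; apply: cvgM; first exact: cw.
  apply: (@continuous_comp _ _ _ (fun t => (rad N)%:C%C * gamma t) k).
    by apply: cvgM; [exact: cvg_cst|exact: cgamma].
  exact/ck/dil/g1.
- by move=> t; exact: cvg_cst.
move=> t t01; rewrite -mulrBr normrM ger0_norm ?cmod_ge0// distrC.
have := HN N t (leqnn _) t01 => /ltW h.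
apply: le_trans (ler_pM _ _ (wB t) h) _ => //; first exact: cmod_ge0.
rewrite mulrCA mulrC ler_piMl// ?(ltW e0)// ler_pdivrMr ?ltr_wpDl// mul1r lerDl//.
Qed.

Lemma wcomp_subproof phi f : cutoff (weighted phi f) \in hardy_mem p1.
Proof.
apply: (@cutoff_hardy _ _ _ _ (hardy_pow p f)).
  by apply: holomorphic_weighted; exact: hardy_holo.
exact: weighted_mean.
Qed.

Definition wcomp phi f : hardy p1 := Hardy (wcomp_subproof phi f).

Lemma wcompE phi f z : cmod z < 1 ->
  wcomp phi f z = aut_root_weight phi z * f (phi z).
Proof. exact: cutoff_in. Qed.

Lemma wcomp_linear phi : linear (wcomp phi).
Proof.
move=> a f g; apply: hardy_ext => z; rewrite unit_discE => z1.
rewrite -[(a *: wcomp phi f + _) z]/(a * wcomp phi f z + wcomp phi g z) !wcompE//.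
rewrite -[(a *: f + g) _]/(a * f _ + g _).
ring.
Qed.

HB.instance Definition _ phi := GRing.isLinear.Build C (hardy p1) (hardy p1) *:%R
  (wcomp phi) (wcomp_linear phi).

Lemma hardy_pow_wcomp_le phi f : hardy_pow p (wcomp phi f) <= hardy_pow p f.
Proof.
apply: (cvgr_to_le (@hardy_cvg _ _ _ (wcomp phi f))); apply: nearW => n.
by rewrite radial_mean_cutoff ?weighted_mean// rad_itv.
Qed.

End weighted_composition.

Section inverse_automorphism.
Context {R : realType}.
Local Notation C := R[i].
Implicit Types (phi : @disc_aut R) (z : C).

Lemma aut_inv_scalP phi : `|(aut_scal phi)^*%C| = 1.
Proof. by rewrite normcJ aut_scalP. Qed.

Lemma aut_inv_rootP phi : unit_disc (- (aut_scal phi * aut_root phi)).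
Proof. by rewrite unit_discE cmodN cmodM cmod_aut_scal mul1r cmod_aut_root. Qed.

Definition aut_inv phi := DiscAut (aut_inv_scalP phi) (aut_inv_rootP phi).

Lemma cmod_aut_inv_root phi : cmod (aut_root (aut_inv phi)) = cmod (aut_root phi).
Proof. by rewrite /= cmodN cmodM cmod_aut_scal mul1r. Qed.

Let scalJ phi : (aut_scal phi)^*%C * aut_scal phi = 1.
Proof. by rewrite mulrC -sqr_cmodC cmod_aut_scal expr1n. Qed.

Let gapE phi : (1 - cmod (aut_root phi) ^+ 2)%:C%C =
  1 - (aut_root phi)^*%C * aut_root phi.
Proof. by rewrite rmorphB rmorph1 /= sqr_cmodC mulrC. Qed.

Lemma aut_den_inv phi z : cmod z <= 1 ->
  aut_den phi (aut_inv phi z) =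
  (1 - cmod (aut_root phi) ^+ 2)%:C%C / aut_den (aut_inv phi) z.
Proof.
move=> z1; have d0 := aut_den_closed (aut_inv phi) z1.
rewrite /aut_den /aut_fun gapE.
set d := 1 - (aut_root (aut_inv phi))^*%C * z in d0 *.
apply: (mulIf d0); rewrite divfK// mulrBl mul1r -!mulrA mulVf// mulr1.
rewrite /d /= rmorphN rmorphM /=; have := scalJ phi.
move: (aut_scal phi) (aut_root phi) => l a lJ.
have -> : a^*%C * (l^*%C * (z - - (l * a))) = a^*%C * (l^*%C * z) + a^*%C * a * (l^*%C * l).
  by ring.
by rewrite lJ; ring.
Qed.

Lemma aut_inv_den phi z : cmod z <= 1 ->
  aut_den (aut_inv phi) (phi z) =
  (1 - cmod (aut_root phi) ^+ 2)%:C%C / aut_den phi z.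
Proof.
move=> z1; have d0 := aut_den_closed phi z1.
rewrite /aut_den /aut_fun gapE /=.
set d := 1 - (aut_root phi)^*%C * z in d0 *.
apply: (mulIf d0); rewrite divfK// mulrBl mul1r -!mulrA mulVf// mulr1.
rewrite /d rmorphN rmorphM /=; have := scalJ phi.
move: (aut_scal phi) (aut_root phi) => l a lJ.
have -> : - (l^*%C * a^*%C) * (l * (z - a)) = - (l^*%C * l) * (a^*%C * (z - a)) by ring.
by rewrite lJ; ring.
Qed.

Let aut_funE phi z : phi z = aut_scal phi * (z - aut_root phi) / aut_den phi z.
Proof. by []. Qed.

Let gap_neq0 phi : (1 - cmod (aut_root phi) ^+ 2)%:C%C != 0 :> C.
Proof. by rewrite -cmod_gt0 cmod_real ?aut_root_gap// ltW ?aut_root_gap. Qed.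

Lemma aut_invK phi z : cmod z <= 1 -> phi (aut_inv phi z) = z.
Proof.
move=> z1; have d0 : aut_den (aut_inv phi) z != 0 := aut_den_closed (aut_inv phi) z1.
have num : aut_inv phi z - aut_root phi =
    (aut_scal phi)^*%C * z * (1 - cmod (aut_root phi) ^+ 2)%:C%C / aut_den (aut_inv phi) z.
  rewrite gapE; apply: (mulIf d0); rewrite divfK// mulrBl aut_funE divfK//.
  rewrite /aut_den /= rmorphN rmorphM /=; have := scalJ phi.
  move: (aut_scal phi) (aut_root phi) => l a lJ.
  have -> : l^*%C * (z - - (l * a)) = l^*%C * z + l^*%C * l * a by ring.
  by rewrite lJ; ring.
rewrite [LHS]aut_funE num (aut_den_inv phi z1).
move: (gap_neq0 phi) d0; move: (_%:C%C) (aut_den _ _) => g d g0 d0.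
transitivity ((aut_scal phi)^*%C * aut_scal phi * z); last by rewrite scalJ mul1r.
by field; rewrite g0 d0.
Qed.

Lemma aut_funK phi z : cmod z <= 1 -> aut_inv phi (phi z) = z.
Proof.
move=> z1; have d0 : aut_den phi z != 0 := aut_den_closed phi z1.
have num : phi z - aut_root (aut_inv phi) =
    aut_scal phi * z * (1 - cmod (aut_root phi) ^+ 2)%:C%C / aut_den phi z.
  rewrite gapE; apply: (mulIf d0); rewrite divfK// mulrBl aut_funE divfK//.
  by rewrite /aut_den /=; ring.
rewrite [LHS]aut_funE num (aut_inv_den phi z1) /=.
move: (gap_neq0 phi) d0; move: (_%:C%C) (aut_den _ _) => g d g0 d0.
transitivity ((aut_scal phi)^*%C * aut_scal phi * z); last by rewrite scalJ mul1r.
by field; rewrite g0 d0.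
Qed.

End inverse_automorphism.

Section weighted_composition_isometry.
Context {R : realType} {p : R} {p1 : 1 <= p}.
Local Notation C := R[i].
Implicit Types (phi psi : @disc_aut R) (f g : hardy p1).

Let p0 : 0 < p. Proof. exact: lt_le_trans p1. Qed.

Lemma cmod_aut_lt1 phi z : cmod z < 1 -> cmod (phi z) < 1.
Proof. by rewrite -!unit_discE; exact: aut_disc. Qed.

Lemma wcompK phi : cancel (wcomp (p1 := p1) (aut_inv phi)) (wcomp phi).
Proof.
move=> f; apply: hardy_ext => z; rewrite unit_discE => z1.
rewrite wcompE// wcompE ?cmod_aut_lt1// aut_funK ?ltW// mulrA.
rewrite [X in X * _]mulrC (@aut_root_weight_mul _ _ p1 _ phi) ?mul1r ?ltW//.
  exact: cmod_aut_inv_root.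
by rewrite aut_inv_den ?ltW// cmod_aut_inv_root.
Qed.

Lemma wcomp_invK phi : cancel (wcomp (p1 := p1) phi) (wcomp (aut_inv phi)).
Proof.
move=> f; apply: hardy_ext => z; rewrite unit_discE => z1.
rewrite wcompE// wcompE ?cmod_aut_lt1// aut_invK ?ltW// mulrA.
rewrite [X in X * _]mulrC (@aut_root_weight_mul _ _ p1 _ (aut_inv phi)) ?mul1r ?ltW//.
  by rewrite cmod_aut_inv_root.
by rewrite aut_den_inv ?ltW.
Qed.

(** Both [wcomp phi] and its inverse are contractions. *)
Lemma hardy_norm_wcomp phi f : hardy_norm p (wcomp phi f) = hardy_norm p f.
Proof.
have [_ -> _ _] := hardy_powP p1 (@hardy_holo _ _ _ (wcomp phi f)) (hardy_fin (wcomp phi f)).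
have [_ -> _ _] := hardy_powP p1 (@hardy_holo _ _ _ f) (hardy_fin f).
suff -> : hardy_pow p (wcomp phi f) = hardy_pow p f by [].
apply/le_anti/andP; split; first exact: hardy_pow_wcomp_le.
by rewrite -{1}(wcomp_invK phi f); exact: hardy_pow_wcomp_le.
Qed.

(** The isometry [wcomp psi] carries multiplication by the variable to multiplication by
    [psi]. Hence both multiplications are equivalent to the same one, and
    [wcomp psi \o wcomp (aut_inv psi')] intertwines them. *)
Lemma mulop_equiv psi psi' :
  isom_equiv (mulop p1 (aut_hinf psi')) (mulop p1 (aut_hinf psi)).
Proof.
exists (wcomp psi \o wcomp (aut_inv psi')), (wcomp psi' \o wcomp (aut_inv psi)).
split.
- by move=> f; rewrite [LHS]hardy_norm_wcomp [LHS]hardy_norm_wcomp.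
- by move=> f; rewrite /= wcomp_invK wcompK.
- by move=> f; rewrite /= wcomp_invK wcompK.
apply/funext => f; apply: hardy_ext => z; rewrite unit_discE => z1.
have z2 := cmod_aut_lt1 psi z1.
set g := wcomp psi' (wcomp (aut_inv psi) f).
have fE : wcomp psi (wcomp (aut_inv psi') g) = f by rewrite /g wcomp_invK wcompK.
rewrite [RHS]wcompE// wcompE// -[mulop _ _ _ z]/(psi z * f z).
rewrite -{1}fE wcompE// wcompE//.
rewrite -[mulop _ _ _ _]/(psi' (aut_inv psi' (psi z)) * g (aut_inv psi' (psi z))).
rewrite aut_invK ?ltW//; ring.
Qed.

End weighted_composition_isometry.

Section trivial_automorphism.
Context {R : realType}.
Local Notation C := R[i].

Lemma croot1 (p : R) : croot p 1 = 1.
Proof.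
have c1 : cmod (1 : C) = 1 := cmod1.
by rewrite /croot /carg c1 powR1 /= ltxx divr1 acos1 mul0r cis0 mulr1.
Qed.

Lemma weighted_comp_id p (phi : @disc_aut R) (f : C -> C) z :
  aut_scal phi = 1 -> aut_root phi = 0 -> unit_disc z ->
  weighted_comp p phi f z = f z.
Proof.
move=> l1 a0 Dz; rewrite /weighted_comp aut_derive1// a0 normr0 expr0n subr0.
by rewrite rmorph0 mul0r subr0 expr1n divr1 croot1 mul1r /aut_fun l1 a0 rmorph0 mul0r !subr0 divr1 mul1r.
Qed.

End trivial_automorphism.

(** * Isometric equivalence *)

Theorem corollary1 (R : realType) (p : R) (p1 : 1 <= p) (p2 : p != 2)
    (psi : disc_aut (R := R)) (S : hardy p1 -> hardy p1)
    (hS : codim1_isometry p1 S) :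
  isom_equiv S (mulop p1 (aut_hinf psi)) <->
  exists psi' : disc_aut (R := R), S = mulop p1 (aut_hinf psi').
Proof.
split; last by move=> [psi' ->]; exact: mulop_equiv.
move=> [U [V [Uiso UV VU E]]]; have [psi' [phi Sdef]] := hS.
have intertwine f : U (S f) = mulop p1 (aut_hinf psi) (U f) by rewrite E /= UV.
have [l1 a0] := aut_identity (fun b t => boundary_ratio Sdef Uiso intertwine p2).
exists psi'; apply/funext => f; apply: hardy_ext => z Dz.
by rewrite Sdef// weighted_comp_id.
Qed.
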